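(* Let $n=2$ or $n=3$, and let $L_0$ be a compact subset of $\operatorname{GL}_n(\mathbb R)/\operatorname{GL}_n(\mathbb Z)$. Then there exists an integer $m>0$ such that \[\sqrt{\int_{L_0}\lvert E_X(t)\rvert^2\,d\mu(X)} = O\big(t^{(n-1)/2}(\log t)^m\big)\qquad\text{as } t\to\infty .\]
   Context: $\Omega$ is the closed standard unit ball in $\mathbb R^n$. A lattice is a set $X\mathbb Z^n$ with $X\in\operatorname{GL}_n(\mathbb R)$; the space of lattices is identified with $\operatorname{GL}_n(\mathbb R)/\operatorname{GL}_n(\mathbb Z)$, equipped with the measure $\mu$ induced by the Haar measure on $\operatorname{GL}_n(\mathbb R)$. For $X\in\operatorname{GL}_n(\mathbb R)$ and $t>0$, $N_X(t)=\#(X\mathbb Z^n\cap t\Omega)=\#(\mathbb Z^n\cap t\Omega_X)$ where $\Omega_X=X^{-1}\Omega$, and $E_X(t)=N_X(t)-\operatorname{vol}(t\Omega_X)$ (these depend only on the coset $X\operatorname{GL}_n(\mathbb Z)$). *)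

(* Defs.v *)
From HB Require Import structures.
From mathcomp Require Import all_boot all_order all_algebra.
From mathcomp Require Import finmap.
From mathcomp Require Import all_classical all_reals all_analysis.
From mathcomp Require Import measurable_realfun.
Import Order.TTheory GRing.Theory Num.Theory.
Import numFieldNormedType.Exports.

Set Implicit Arguments.
Unset Strict Implicit.
Unset Printing Implicit Defensive.

Local Open Scope classical_set_scope.
Local Open Scope ring_scope.

(* T as a measurable space with its Borel sigma-algebra. *)
Definition borel (T : ptopologicalType) : Type := g_sigma_algebraType (@open T).
HB.instance Definition _ (T : ptopologicalType) :=
  Measurable.copy (borel T) (g_sigma_algebraType (@open T)).

(* The topology is induced by that of the n x n real matrices. *)
Definition GL (R : realType) (n : nat) : Type :=
  set_type [set X : 'M[R]_n | X \in unitmx].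
HB.instance Definition _ (R : realType) (n : nat) :=
  Topological.copy (GL R n) (set_type [set X : 'M[R]_n | X \in unitmx]).

Definition glmx (R : realType) (n : nat) (X : GL R n) : 'M[R]_n := set_val X.

Lemma glmx_unit (R : realType) (n : nat) (X : GL R n) : glmx X \in unitmx.
Proof. exact: set_valP X. Qed.

Definition mkGL (R : realType) (n : nat) (M : 'M[R]_n) (uM : M \in unitmx) :
    GL R n :=
  exist _ M (@mem_set _ [set X : 'M[R]_n | X \in unitmx] M uM).

HB.instance Definition _ (R : realType) (n : nat) :=
  isPointed.Build (GL R n) (mkGL (unitmx1 R n)).

Lemma GLmul_subproof (R : realType) (n : nat) (X Y : GL R n) :
  glmx X *m glmx Y \in unitmx.
Proof. by rewrite unitmx_mul !glmx_unit. Qed.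

Definition GLmul (R : realType) (n : nat) (X Y : GL R n) : GL R n :=
  mkGL (GLmul_subproof X Y).

(* X GL_n(Z) = Y GL_n(Z), where GL_n(Z) consists of the integer matrices that
   are invertible over the integers. *)
Definition same_coset (R : realType) (n : nat) : rel (GL R n) :=
  fun X Y =>
  `[< exists2 U : 'M[int]_n, U \in unitmx & glmx Y = glmx X *m map_mx intr U >].

Lemma same_coset_refl (R : realType) (n : nat) : reflexive (@same_coset R n).
Proof.
move=> X; apply/asboolP; exists 1%:M; first exact: unitmx1.
by rewrite map_mx1 mulmx1.
Qed.

Lemma same_coset_sym (R : realType) (n : nat) : symmetric (@same_coset R n).
Proof.
suff H : forall X Y, same_coset X Y -> @same_coset R n Y X.
  by move=> X Y; apply/idP/idP; exact: H.
move=> X Y /asboolP[U uU XY]; apply/asboolP; exists (invmx U).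
  by rewrite unitmx_inv.
by rewrite XY -mulmxA -map_mxM mulmxV// map_mx1 mulmx1.
Qed.

Lemma same_coset_trans (R : realType) (n : nat) : transitive (@same_coset R n).
Proof.
move=> Y X Z /asboolP[U uU XY] /asboolP[V uV YZ]; apply/asboolP.
exists (U *m V); first by rewrite unitmx_mul uU.
by rewrite YZ XY map_mxM mulmxA.
Qed.

Definition same_coset_equiv (R : realType) (n : nat) : equiv_rel (GL R n) :=
  EquivRel (@same_coset R n) (@same_coset_refl R n) (@same_coset_sym R n)
    (@same_coset_trans R n).

(* GL_n(R) / GL_n(Z) *)
Notation lattices R n :=
  (quotient_topology {eq_quot (same_coset_equiv R n)}%qT).

Definition coset (R : realType) (n : nat) (X : GL R n) : lattices R n :=
  (\pi_(lattices R n) X)%qT.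

(* Left Haar measures; they are only determined up to a positive factor.
   Regularity is automatic as GL_n(R) is locally compact and second countable,
   and GL_n(R) is unimodular. *)
Definition is_haar (R : realType) (n : nat)
    (nu : {measure set (borel (GL R n)) -> \bar R}) : Prop :=
  [/\ forall (X : GL R n) (A : set (borel (GL R n))), measurable A ->
        nu (GLmul X @` A) = nu A,
      forall K : set (GL R n), compact K -> (nu K < +oo)%E
    & nu [set: GL R n] != 0%E].

(* mu is the quotient of nu by the counting measure of GL_n(Z): integrating over
   GL_n(R) amounts to summing over each coset and then integrating over the
   space of cosets (Weil's formula). *)
Definition is_induced_measure (R : realType) (n : nat)
    (nu : {measure set (borel (GL R n)) -> \bar R})
    (mu : {measure set (borel (lattices R n)) -> \bar R}) : Prop :=
  forall f : borel (GL R n) -> \bar R,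
    measurable_fun [set: borel (GL R n)] f -> (forall X, 0 <= f X)%E ->
    (\int[nu]_X f X = \int[mu]_L \esum_(X in @coset R n @^-1` [set L]) f X)%E.

(* n-dimensional Lebesgue measure (of Borel sets), as the n-fold product of
   the Lebesgue measure on R: the integral over the first coordinate of the
   (n-1)-dimensional measure of the sections, R^0 being a point of mass 1. *)
Fixpoint vol (R : realType) (n : nat) : set 'cV[R]_n -> \bar R :=
  match n with
  | 0 => fun A => (\1_A (0 : 'cV[R]_0))%:E
  | n'.+1 => fun A =>
      (\int[@lebesgue_measure R]_x
         vol [set v : 'cV[R]_n' | A (col_mx (x%:M : 'cV[R]_1) v)])%E
  end.

(* t A *)
Definition dilate (R : realType) (n : nat) (t : R) (A : set 'cV[R]_n) :
  set 'cV[R]_n := [set t *: v | v in A].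

Definition unit_ball (R : realType) (n : nat) : set 'cV[R]_n :=
  [set v | \sum_i v i 0 ^+ 2 <= 1].

(* X Z^n *)
Definition lattice_of (R : realType) (n : nat) (X : GL R n) : set 'cV[R]_n :=
  [set glmx X *m map_mx intr z | z in [set: 'cV[int]_n]].

(* Omega_X = X^-1 Omega *)
Definition ball_of (R : realType) (n : nat) (X : GL R n) : set 'cV[R]_n :=
  [set invmx (glmx X) *m v | v in @unit_ball R n].

(* fset_set is the honest enumeration here, the set being finite *)
Definition lattice_count (R : realType) (n : nat) (X : GL R n) (t : R) : nat :=
  #|` fset_set (lattice_of X `&` dilate t (@unit_ball R n)) |%fset.

Definition lattice_error (R : realType) (n : nat) (X : GL R n) (t : R) : R :=
  (lattice_count X t)%:R - fine (vol (dilate t (ball_of X))).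

(* The error depends only on the coset of X; it is evaluated at a chosen
   representative. *)
Definition coset_error (R : realType) (n : nat) (L : lattices R n) (t : R) : R :=
  lattice_error (repr L) t.

(* Main.v *)
Require Import Defs.
From HB Require Import structures.
From mathcomp Require Import finmap.
From mathcomp Require Import all_boot all_order all_algebra.
From mathcomp Require Import all_classical all_reals all_analysis.
From mathcomp Require Import measurable_realfun.
From mathcomp Require Import perm ring lra zify.
Import Order.TTheory GRing.Theory Num.Theory.
Import numFieldNormedType.Exports.

Set Implicit Arguments.
Unset Strict Implicit.
Unset Printing Implicit Defensive.

Local Open Scope classical_set_scope.
Local Open Scope ring_scope.

(* Completing squares writes |X z|^2 as A (z3 + a z1 + b z2)^2 + B (z2 + c z1)^2
   + D z1^2 (for n = 2: A (z2 + a z1)^2 + D z1^2).  Counting slice by slice, the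
   error becomes a sum, over integer vectors p, of one-dimensional discrepancies
   F_p at the phase p . (a, b), plus terms coming from the integrals over the
   slices, which are of the same kind in lower dimension.  The slice functions
   are concave on their supports, so each F_p is 1-periodic and its sum over the
   translates by multiples of 1/k is bounded independently of k.

   Right multiplication of X by unipotent matrices only translates the phases
   (a, b, c).  Averaging the square of the error over translations by (1/N) Z,
   with N highly divisible, the correlation of F_p and F_q is negligible when p
   and q are independent, and at most V^2 / (k l) when p : q = k : l in lowest
   terms.  Hence the average is O(t^(n-1) (log t)^2), with the square of the
   logarithm coming from the harmonic sums over k and l.  As the unipotent
   matrices stay in a fixed compact set, invariance of the Haar measure and
   Tonelli's theorem transfer this bound to the integral of the squared error
   over a compact subset of GL_n(R), hence, by Weil's formula, over L0. *)

(** * Correlations of equidistributed periodic functions *)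

(** All means are finite: on the grid of step 1/N the correlation estimates are exact changes of
    variable, without integrals over the phases or Fourier series, and N is a factorial so that
    every integer needed as a denominator divides it. The size of the discrepancies comes from a
    single bound, 2 w, for a concave profile that varies by at most w over unit distance. Stretching
    the profile by k does not increase w, hence the independence of k. For the indicator, square
    root and parabolic profiles, w is of order 1, t^(1/2) and t. They enter through about t^2, t and
    1 phases when n = 3, and the first two through about t and 1 when n = 2. So w^2 times the number
    of phases is always of order t^(n-1): no stage of the slicing dominates. The profile (r -
    u^2)^(i/2) is concave on its support only for i <= 2, which confines this argument to n <= 3. N
    and the range T of the summation variables are fixed by t and the compact set before the lattice
    is chosen. One finite set of unipotent matrices then serves all lattices at once, as the
    transfer to the Haar measure requires. *)

(* In particular the mean of F over the translates by multiples of 1/a is O(1/a). *)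
Definition equidistributed (R : realType) (V : R) (F : R -> R) : Prop :=
  (forall x, F (x + 1) = F x) /\
  (forall (a : nat) x, (0 < a)%N -> `|\sum_(j < a) F (x + j%:R / a%:R)| <= V).

(* The second variable is a dummy in dimension 2. *)
Definition torsion_sum (R : realType) (N : nat) (Phi : R -> R -> R) : R :=
  \sum_(i < N) \sum_(j < N) Phi (i%:R / N%:R) (j%:R / N%:R).

Lemma periodic_nat (R : realType) (F : R -> R) (n : nat) x :
  (forall x, F (x + 1) = F x) -> F (x + n%:R) = F x.
Proof.
move=> perF; elim: n x => [|n IHn] x; first by rewrite addr0.
by rewrite -addn1 natrD addrA perF IHn.
Qed.

Lemma periodic_int (R : realType) (F : R -> R) (k : int) x :
  (forall x, F (x + 1) = F x) -> F (x + k%:~R) = F x.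
Proof.
move=> perF; case: (intP k) => [|n|n]; first by rewrite addr0.
  exact: periodic_nat.
by rewrite -(periodic_nat n.+1)// rmorphN /= subrK.
Qed.

Lemma equidistributed_le (R : realType) (V : R) (F : R -> R) x :
  equidistributed V F -> `|F x| <= V.
Proof. by case=> _ /(_ 1%N x isT); rewrite big_ord1 mul0r addr0. Qed.

Lemma sum_periodic_shift (R : realType) (N : nat) (G : int -> R) (k : int) :
  (forall m, G (m + N%:Z) = G m) ->
  \sum_(i < N) G (i%:Z + k) = \sum_(i < N) G i%:Z.
Proof.
have H1 (H : int -> R) : (forall m, H (m + N%:Z) = H m) ->
    \sum_(i < N) H (i%:Z + 1) = \sum_(i < N) H i%:Z.
  move=> perH; apply: (addrI (H 0)).
  rewrite -[LHS](_ : \sum_(i < N.+1) H i%:Z = _); last first.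
    by rewrite big_ord_recl; congr (_ + _); apply: eq_bigr => i _; rewrite lift0 -addn1 PoszD.
  by rewrite big_ord_recr /= -[N%:Z]add0r perH addrC.
have Hn (H : int -> R) (n : nat) : (forall m, H (m + N%:Z) = H m) ->
    \sum_(i < N) H (i%:Z + n%:Z) = \sum_(i < N) H i%:Z.
  move=> perH; elim: n => [|n IHn]; first by under eq_bigr do rewrite addr0.
  rewrite -IHn -(H1 (fun m => H (m + n%:Z))); last by move=> m; rewrite addrAC perH.
  by apply: eq_bigr => i _; rewrite -addrA -PoszD.
move=> perG; case: (intP k) => [|n|n]; last 2 [exact: Hn].
  by under eq_bigr do rewrite addr0.
rewrite -(Hn (fun m => G (m - n.+1%:Z)) n.+1); last by move=> m; rewrite addrAC perG.
by apply: eq_bigr => i _; rewrite addrK.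
Qed.

Lemma torsion_sum_shift (R : realType) (N : nat) (Phi : R -> R -> R) (k l : int) :
  (0 < N)%N ->
  (forall x y, Phi (x + 1) y = Phi x y) -> (forall x y, Phi x (y + 1) = Phi x y) ->
  torsion_sum N Phi =
  torsion_sum N (fun x y => Phi (x + k%:~R / N%:R) (y + l%:~R / N%:R)).
Proof.
move=> N0 per1 per2; have N0' : N%:R != 0 :> R by rewrite pnatr_eq0 -lt0n.
have per x (H : R -> R) : (forall x, H (x + 1) = H x) ->
  H ((x + N%:Z)%:~R / N%:R) = H (x%:~R / N%:R).
  by move=> perH; rewrite intrD mulrDl mulfV// perH.
rewrite /torsion_sum.
rewrite -(@sum_periodic_shift R N (fun m => \sum_(j < N) Phi (m%:~R / N%:R) (j%:R / N%:R)) k).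
  apply: eq_bigr => i _.
  rewrite -(@sum_periodic_shift R N (fun m => Phi ((i%:Z + k)%:~R / N%:R) (m%:~R / N%:R)) l).
    by apply: eq_bigr => j _; rewrite !intrD !mulrDl.
  by move=> m; rewrite (per _ (Phi _)).
by move=> m; apply: eq_bigr => j _; rewrite (per _ (Phi^~ _)).
Qed.

Lemma sum_chinese (R : realType) (a b : nat) (f g : nat -> R) :
  coprime a b -> (0 < a)%N -> (0 < b)%N ->
  \sum_(k < a * b) f (k %% b)%N * g (k %% a)%N =
  (\sum_(i < b) f i) * (\sum_(j < a) g j).
Proof.
move=> cab a0 b0; rewrite big_distrlr /= pair_big /=.
pose h (k : 'I_(a * b)) : 'I_b * 'I_a :=
  (Ordinal (ltn_pmod k b0), Ordinal (ltn_pmod k a0)).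
have bh : bijective h.
  apply: inj_card_bij; last by rewrite card_prod !card_ord mulnC.
  move=> k l [/eqP kl /eqP kl']; apply: val_inj => /=.
  rewrite -(modn_small (ltn_ord k)) -(modn_small (ltn_ord l)); apply/eqP.
  by rewrite chinese_remainder// kl kl'.
by rewrite (reindex h) //=; apply: onW_bij.
Qed.

Lemma torsion_sum_le (R : realType) (N : nat) (Phi : R -> R -> R) (W : R) :
  (forall x y, `|Phi x y| <= W) -> `|torsion_sum N Phi| <= N%:R ^+ 2 * W.
Proof.
move=> PhiW; apply: le_trans (ler_norm_sum _ _ _) _.
apply: (@le_trans _ _ (\sum_(i < N) \sum_(j < N) W)).
  apply: ler_sum => i _; apply: le_trans (ler_norm_sum _ _ _) _.
  exact: ler_sum.
by rewrite !sumr_const !card_ord -mulrnA -[W *+ _]mulr_natl natrM expr2.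
Qed.

Lemma torsion_sum_sum (R : realType) (N : nat) (I : Type) (r : seq I)
    (Phi : I -> R -> R -> R) :
  \sum_(k <- r) torsion_sum N (Phi k) =
  torsion_sum N (fun x y => \sum_(k <- r) Phi k x y).
Proof.
rewrite /torsion_sum exchange_big /=; apply: eq_bigr => i _.
by rewrite exchange_big.
Qed.

Definition dot (R : realType) (p : int * int) (x y : R) : R :=
  p.1%:~R * x + p.2%:~R * y.

Lemma dot_per1 (R : realType) (F : R -> R) p x y :
  (forall x, F (x + 1) = F x) -> F (dot p (x + 1) y) = F (dot p x y).
Proof.
move=> perF; rewrite -[RHS](periodic_int p.1)//; congr F; rewrite /dot; ring.
Qed.

Lemma dot_per2 (R : realType) (F : R -> R) p x y :
  (forall x, F (x + 1) = F x) -> F (dot p x (y + 1)) = F (dot p x y).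
Proof.
move=> perF; rewrite -[RHS](periodic_int p.2)//; congr F; rewrite /dot; ring.
Qed.

Lemma torsion_corr_shift (R : realType) (N : nat) (F G : R -> R) (p q : int * int)
    (k l : int) :
  (0 < N)%N -> (forall x, F (x + 1) = F x) -> (forall x, G (x + 1) = G x) ->
  torsion_sum N (fun x y => F (dot p x y) * G (dot q x y)) =
  torsion_sum N (fun x y => F (dot p x y + (p.1 * k + p.2 * l)%:~R / N%:R) *
                            G (dot q x y + (q.1 * k + q.2 * l)%:~R / N%:R)).
Proof.
move=> N0 perF perG; rewrite (torsion_sum_shift k l N0); last 2 first.
- by move=> x y; rewrite !dot_per1.
- by move=> x y; rewrite !dot_per2.
congr torsion_sum; apply/funext => x; apply/funext => y.
by congr (F _ * G _); rewrite /dot !intrD !intrM; ring.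
Qed.

(* Translating (x, y) in a direction orthogonal to q fixes the second factor and
   averages the first one over the multiples of 1/M. *)
Lemma corr_independent (R : realType) (V : R) (N M : nat) (F G : R -> R)
    (p q : int * int) :
  equidistributed V F -> equidistributed V G -> (0 < N)%N -> (0 < M)%N ->
  p.1 * q.2 - p.2 * q.1 != 0 ->
  (`|(p.1 * q.2 - p.2 * q.1)%R| * M %| N)%N ->
  `|torsion_sum N (fun x y => F (dot p x y) * G (dot q x y))|
    <= N%:R ^+ 2 * (V ^+ 2 / M%:R).
Proof.
move=> eF eG N0 M0 D0 /dvdnP[c0 Nc0]; set D := (_ - _) in D0 Nc0.
have [c cE] : exists c : int, N%:Z = c * D * M%:Z.
  by exists (c0%:Z * Num.sg D); rewrite Nc0 !PoszM abszE normrEsg !mulrA.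
have M0' : M%:R != 0 :> R by rewrite pnatr_eq0 -lt0n.
have N0' : N%:R != 0 :> R by rewrite pnatr_eq0 -lt0n.
have V0 : 0 <= V by exact: le_trans (normr_ge0 _) (equidistributed_le 0 eF).
set I := torsion_sum _ _.
have : `|M%:R * I| <= N%:R ^+ 2 * V ^+ 2.
  have -> : M%:R * I = torsion_sum N (fun x y =>
      (\sum_(j < M) F (dot p x y + j%:R / M%:R)) * G (dot q x y)).
    rewrite (_ : torsion_sum N _ = torsion_sum N (fun x y =>
      \sum_(j <- enum 'I_M) F (dot p x y + j%:R / M%:R) * G (dot q x y))); last first.
      congr torsion_sum; apply/funext => x; apply/funext => y.
      by rewrite big_enum mulr_suml.
    rewrite -torsion_sum_sum big_enum /=.
    transitivity (\sum_(j < M) I).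
      by rewrite sumr_const card_ord mulr_natl.
    apply: eq_bigr => j _.
    rewrite /I (@torsion_corr_shift _ _ _ _ _ _ (j%:Z * q.2 * c) (- (j%:Z * q.1 * c))) //; last 2 first.
    - by case: eF.
    - by case: eG.
    congr torsion_sum; apply/funext => x; apply/funext => y.
    congr (F (_ + _) * G _); last first.
      by rewrite (_ : _ + _ = 0 :> int) ?mul0r ?addr0//; ring.
    apply: (mulIf N0'); rewrite divfK//; apply: (mulIf M0').
    rewrite [RHS]mulrAC divfK// -[N%:R]/(N%:Z%:~R) -[M%:R]/(M%:Z%:~R) -[j%:R]/(j%:Z%:~R) -!intrM cE /D.
    by congr (_%:~R); ring.
  apply: torsion_sum_le => x y; rewrite normrM expr2; apply: ler_pM => //.
    by case: eF => _; apply.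
  exact: equidistributed_le eG.
rewrite normrM normr_nat mulrA ler_pdivlMr ?ltr0n//.
by rewrite mulrC.
Qed.

Lemma periodic_mod (R : realType) (F : R -> R) x (k b : nat) :
  (forall x, F (x + 1) = F x) -> (0 < b)%N ->
  F (x + k%:R / b%:R) = F (x + (k %% b)%N%:R / b%:R).
Proof.
move=> perF b0; rewrite {1}(divn_eq k b) natrD natrM mulrDl mulfK; last first.
  by rewrite pnatr_eq0 -lt0n.
by rewrite addrCA addrC periodic_nat.
Qed.

Lemma equidistributedN (R : realType) (V : R) (F : R -> R) :
  equidistributed V F -> equidistributed V (fun x => F (- x)).
Proof.
move=> [perF VF]; split=> [x|a x a0].
  by rewrite -[LHS]perF; congr F; ring.
have -> : \sum_(j < a) F (- (x + j%:R / a%:R)) =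
          \sum_(j < a) F ((- x + 1 / a%:R) + j%:R / a%:R).
  rewrite (reindex_inj rev_ord_inj) /=; apply: eq_bigr => j _.
  rewrite -[LHS]perF natrB//; congr F; rewrite -addn1 natrD.
  by field; rewrite pnatr_eq0 -lt0n.
exact: VF.
Qed.

(* Translations along w by multiples of 1/(a b) move the two phases by
   independent multiples of 1/b and 1/a, by the Chinese remainder theorem. *)
Lemma corr_collinear (R : realType) (V : R) (N a b : nat) (F G : R -> R)
    (w : int * int) :
  equidistributed V F -> equidistributed V G -> (0 < N)%N ->
  (0 < a)%N -> (0 < b)%N -> coprime a b ->
  (exists k l : int, (w.1 * k + w.2 * l) * (a * b)%:Z = N%:Z) ->
  `|torsion_sum N (fun x y => F (dot (a%:Z * w.1, a%:Z * w.2) x y) *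
                              G (dot (b%:Z * w.1, b%:Z * w.2) x y))|
    <= N%:R ^+ 2 * (V ^+ 2 / (a%:R * b%:R)).
Proof.
move=> eF eG N0 a0 b0 cab [k [l klN]].
have a0' : a%:R != 0 :> R by rewrite pnatr_eq0 -lt0n.
have b0' : b%:R != 0 :> R by rewrite pnatr_eq0 -lt0n.
have N0' : N%:R != 0 :> R by rewrite pnatr_eq0 -lt0n.
have V0 : 0 <= V by exact: le_trans (normr_ge0 _) (equidistributed_le 0 eF).
set p := (_, _); set q := (_, _); set I := torsion_sum _ _.
have : `|(a * b)%:R * I| <= N%:R ^+ 2 * V ^+ 2.
  have -> : (a * b)%:R * I = torsion_sum N (fun x y =>
      (\sum_(i < b) F (dot p x y + i%:R / b%:R)) *
      (\sum_(j < a) G (dot q x y + j%:R / a%:R))).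
    rewrite (_ : torsion_sum N _ = torsion_sum N (fun x y =>
      \sum_(m <- enum 'I_(a * b)) F (dot p x y + m%:R / b%:R) *
                         G (dot q x y + m%:R / a%:R))); last first.
      congr torsion_sum; apply/funext => x; apply/funext => y.
      rewrite big_enum -(@sum_chinese R a b (fun i => F (dot p x y + i%:R / b%:R))
        (fun j => G (dot q x y + j%:R / a%:R)))//.
      apply: eq_bigr => m _; congr (_ * _).
        by rewrite -periodic_mod//; case: eF.
      by rewrite -periodic_mod//; case: eG.
    rewrite -torsion_sum_sum big_enum /=.
    transitivity (\sum_(m < a * b) I).
      by rewrite sumr_const card_ord mulr_natl.
    apply: eq_bigr => m _.
    rewrite /I (@torsion_corr_shift _ _ _ _ _ _ (m%:Z * k) (m%:Z * l)) //; last 2 first.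
    - by case: eF.
    - by case: eG.
    congr torsion_sum; apply/funext => x; apply/funext => y.
    congr (F (_ + _) * G (_ + _)).
      apply: (mulIf N0'); rewrite divfK//; apply: (mulIf b0').
      rewrite [RHS]mulrAC divfK// -[N%:R]/(N%:Z%:~R) -[b%:R]/(b%:Z%:~R) -[m%:R]/(m%:Z%:~R) -!intrM -klN PoszM.
      by congr (_%:~R); rewrite /=; ring.
    apply: (mulIf N0'); rewrite divfK//; apply: (mulIf a0').
    rewrite [RHS]mulrAC divfK// -[N%:R]/(N%:Z%:~R) -[a%:R]/(a%:Z%:~R) -[m%:R]/(m%:Z%:~R) -!intrM -klN PoszM.
    by congr (_%:~R); rewrite /=; ring.
  apply: torsion_sum_le => x y; rewrite normrM expr2; apply: ler_pM => //.
    by case: eF => _; apply.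
  by case: eG => _; apply.
rewrite normrM normr_nat -natrM mulrA ler_pdivlMr ?ltr0n ?muln_gt0 ?a0//.
by rewrite mulrC.
Qed.

(** * Collinear integer vectors and the second moment of a sum over phases *)

Lemma int_coprime_factor (x y : int) : x != 0 -> y != 0 ->
  exists a b : nat, exists w : int, exists e : bool,
    [/\ (0 < a)%N, (0 < b)%N, coprime a b, x = a%:Z * w & y = (-1) ^+ e * b%:Z * w].
Proof.
move=> x0 y0; set g := gcdn `|x| `|y|.
have g0 : (0 < g)%N by rewrite gcdn_gt0 absz_gt0 x0.
have [a xa] : exists a, `|x|%N = (a * g)%N by apply/dvdnP; exact: dvdn_gcdl.
have [b yb] : exists b, `|y|%N = (b * g)%N by apply/dvdnP; exact: dvdn_gcdr.
have a0 : (0 < a)%N by move: x0; rewrite -absz_gt0 xa muln_gt0 => /andP[].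
have b0 : (0 < b)%N by move: y0; rewrite -absz_gt0 yb muln_gt0 => /andP[].
exists a, b, ((-1) ^+ (x < 0)%R * g%:Z), ((x < 0)%R (+) (y < 0)%R); split => //.
- rewrite /coprime -(eqn_pmul2r g0) mul1n muln_gcdl -xa -yb.
  exact/eqP.
- by rewrite mulrCA -PoszM -xa abszE -intEsign.
- rewrite [LHS]intEsign yb PoszM signr_addb.
  by case: (x < 0)%R; rewrite ?expr0 ?expr1; ring.
Qed.

(** A nonzero first coordinate determines [a], [b] and the sign, after division by the gcd;
    collinearity and Gauss's lemma then show that [a] divides the second coordinate of [p]. The sign
    is kept apart in [e] because [corr_collinear] takes positive multipliers. *)
Lemma collinear_factor (p q : int * int) : p != 0 -> q != 0 ->
  p.1 * q.2 - p.2 * q.1 = 0 ->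
  exists a b : nat, exists w : int * int, exists e : bool,
    [/\ (0 < a)%N, (0 < b)%N, coprime a b, p = (a%:Z * w.1, a%:Z * w.2) &
        q = ((-1) ^+ e * b%:Z * w.1, (-1) ^+ e * b%:Z * w.2)].
Proof.
case: p q => [p1 p2] [q1 q2] /=; rewrite /eq_op /= !negb_and => p0 q0 /eqP.
rewrite subr_eq0 => /eqP pq.
have [p10|p10] := eqVneq p1 0.
  rewrite p10 eqxx /= in p0; have q10 : q1 = 0.
    by apply/eqP; move/eqP: pq; rewrite p10 mul0r eq_sym mulf_eq0 (negPf p0).
  rewrite q10 eqxx /= in q0.
  have [a [b [w [e [a0 b0 cab pw qw]]]]] := int_coprime_factor p0 q0.
  by exists a, b, (0, w), e; rewrite p10 q10 !mulr0; split => //; congr pair.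
have q10 : q1 != 0.
  apply: contraTneq q0 => q10; rewrite q10 eqxx /= negbK.
  by move/eqP: pq; rewrite q10 mulr0 mulf_eq0 (negPf p10).
have [a [b [w [e [a0 b0 cab pw qw]]]]] := int_coprime_factor p10 q10.
have w0 : w != 0 by apply: contraNneq p10 => w0; rewrite pw w0 mulr0.
have aq : a%:Z * q2 = (-1) ^+ e * b%:Z * p2.
  apply: (mulIf w0); rewrite -[RHS]mulrAC -qw [RHS]mulrC -pq pw; ring.
have /dvdzP[v p2v] : (a%:Z %| p2)%Z.
  rewrite -(@Gauss_dvdzr _ b%:Z).
    by apply/dvdzP; exists ((-1) ^+ e * q2); rewrite -mulrA [q2 * _]mulrC aq; case: (e); rewrite ?expr0 ?expr1; ring.
  by rewrite /coprimez /gcdz /= (eqP cab).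
exists a, b, (w, v), e; split => //=.
  by rewrite p2v [v * _]mulrC pw.
rewrite qw; congr pair; apply: (@mulfI _ a%:Z); first by rewrite eqz_nat -lt0n.
by rewrite aq p2v; ring.
Qed.

Lemma sum_pred1_le (R : realType) (I : eqType) (S : seq I) (x : I) : uniq S ->
  \sum_(p <- S) (p == x)%:R <= 1 :> R.
Proof.
move=> uS; rewrite -natr_sum lern1; elim: S uS => [|y S IH] /=; first by rewrite big_nil.
move=> /andP[yS uS]; rewrite big_cons; case: eqVneq => [<-|_]; last by rewrite add0n IH.
rewrite big_seq big1 ?addn0// => z zS.
by case: eqVneq => // zy; rewrite -zy zS in yS.
Qed.

(** The two cases are merged into one bound by indicators, so that it can be summed over all pairs.
    The divisors of [N] that are used are the determinant, at most 2 T^2, times [M] in the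
    independent case, and the product of [a], [b] and a coordinate of [w], at most T^3, in the
    collinear case. Closure of [S] under division makes the common direction [w] available as an
    index. *)
Lemma corr_bound (R : realType) (V : R) (N T M : nat) (S : seq (int * int))
    (F : int * int -> R -> R) :
  (0 < N)%N -> (0 < M)%N ->
  (forall d, (0 < d <= 2 * T ^ 3 * M)%N -> (d %| N)%N) ->
  (forall p, p \in S -> [/\ p != 0, (`|p.1| <= T)%N & (`|p.2| <= T)%N]) ->
  (forall (a : nat) w, (0 < a)%N -> (a%:Z * w.1, a%:Z * w.2) \in S -> w \in S) ->
  (forall p, p \in S -> equidistributed V (F p)) ->
  forall p q, p \in S -> q \in S ->
  `|torsion_sum N (fun x y => F p (dot p x y) * F q (dot q x y))| <=
  N%:R ^+ 2 * V ^+ 2 * (M%:R^-1 +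
    \sum_(a < T) \sum_(b < T) \sum_(w <- S) \sum_(e : bool)
      (p == (a.+1%:Z * w.1, a.+1%:Z * w.2))%:R *
      (q == ((-1) ^+ e * b.+1%:Z * w.1, (-1) ^+ e * b.+1%:Z * w.2))%:R *
      (a.+1%:R^-1 * b.+1%:R^-1)).
Proof.
move=> N0 M0 divN ST Sdiv eF p q pS qS.
have [p0 p1T p2T] := ST _ pS; have [q0 q1T q2T] := ST _ qS.
have T0 : (0 < T)%N.
  rewrite lt0n; apply: contraNneq p0 => T0; move: p1T p2T.
  by rewrite T0 !leqn0 !absz_eq0; case: (p) => [x y] /= /eqP -> /eqP ->.
have V2 : 0 <= N%:R ^+ 2 * V ^+ 2 by rewrite mulr_ge0 ?sqr_ge0.
have T3 : (T ^ 2 <= T ^ 3)%N by rewrite leq_pexp2l.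
have [D0|D0] := eqVneq (p.1 * q.2 - p.2 * q.1) 0; last first.
  apply: le_trans (_ : _ <= N%:R ^+ 2 * (V ^+ 2 / M%:R)) _.
    apply: corr_independent => //; [exact: eF..|].
    apply: divN; rewrite muln_gt0 absz_gt0 D0 M0 /= leq_mul2r; apply/orP; right.
    have : (`|(p.1 * q.2 - p.2 * q.1)%R| <= `|(p.1 * q.2)%R| + `|(p.2 * q.1)%R|)%N by lia.
    rewrite !abszM => /leq_trans; apply.
    apply: leq_trans (_ : _ <= 2 * T ^ 2)%N _; last by rewrite leq_mul2l T3 orbT.
    by rewrite mul2n -addnn expnS expn1 leq_add// leq_mul.
  rewrite mulrA ler_wpM2l// lerDl.
  by do !(apply: sumr_ge0 => ? _); rewrite !mulr_ge0 ?invr_ge0.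
have [a [b [w [e [a0 b0 cab pE qE]]]]] := collinear_factor p0 q0 D0.
have wS : w \in S by apply: (Sdiv a) => //; rewrite -pE.
have [w0 w1T w2T] := ST _ wS.
have [aT bT] : (a <= T)%N /\ (b <= T)%N.
  have : (w.1 != 0) || (w.2 != 0).
    by move: w0; case: (w) => [x y]; rewrite /eq_op /= negb_and.
  case/orP => wi0; move: p1T p2T q1T q2T; rewrite pE qE /= -!mulrA !abszMsign !abszM => p1T p2T q1T q2T.
    by split; [move: p1T|move: q1T]; apply: leq_trans; rewrite leq_pmulr// absz_gt0.
  by split; [move: p2T|move: q2T]; apply: leq_trans; rewrite leq_pmulr// absz_gt0.
have kl : exists k l : int, (w.1 * k + w.2 * l) * (a * b)%:Z = N%:Z.
  have H z : z != 0 -> (`|z| <= T)%N -> exists k, (z * k) * (a * b)%:Z = N%:Z.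
    move=> z0 zT; have /dvdnP[k kE] : (a * b * `|z| %| N)%N.
      apply: divN; rewrite !muln_gt0 a0 b0 absz_gt0 z0 /=.
      apply: leq_trans (_ : _ <= T ^ 3)%N _; last by rewrite -mulnA mulnCA leq_pmulr// muln_gt0 M0.
      by rewrite !expnS expn0 muln1 -mulnA leq_mul// leq_mul.
    exists (k%:Z * Num.sg z); rewrite kE !PoszM abszE normrEsg; ring.
  have [w10|w10] := eqVneq w.1 0; last by have [k kE] := H _ w10 w1T; exists k, 0; rewrite mulr0 addr0.
  have w20 : w.2 != 0 by apply: contraNneq w0 => w20; apply/eqP; case: (w) w10 w20 => x y /= -> ->.
  by have [k kE] := H _ w20 w2T; exists 0, k; rewrite mulr0 add0r.
apply: le_trans (_ : _ <= N%:R ^+ 2 * (V ^+ 2 / (a%:R * b%:R))) _.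
  have -> : torsion_sum N (fun x y => F p (dot p x y) * F q (dot q x y)) =
      torsion_sum N (fun x y => F p (dot (a%:Z * w.1, a%:Z * w.2) x y) *
        (fun z => F q ((-1) ^+ e * z)) (dot (b%:Z * w.1, b%:Z * w.2) x y)).
    congr torsion_sum; apply/funext => x; apply/funext => y.
    congr (F p _ * F q _); first by rewrite {1}pE.
    by rewrite qE /dot /= !intrM rmorphXn /= rmorphN1; ring.
  apply: (@corr_collinear R V N a b (F p) (fun z => F q ((-1) ^+ e * z)) w) => //; first exact: eF.
  case: (e); last first.
    by rewrite (_ : (fun=> _) = F q); [exact: eF|apply/funext => x; rewrite expr0 mul1r].
  rewrite (_ : (fun=> _) = fun x => F q (- x)); last by apply/funext => x; rewrite expr1 mulN1r.
  exact/equidistributedN/eF.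
rewrite mulrA ler_wpM2l// ler_wpDl ?invr_ge0//.
rewrite -(prednK a0) -(prednK b0) in aT bT pE qE *.
rewrite (bigD1 (Ordinal aT)) //= (bigD1 (Ordinal bT)) //= (big_rem w)//= (bigD1 e)//=.
rewrite -pE -qE !eqxx !mul1r invfM -!addrA lerDl.
by rewrite !addr_ge0//; do ?(apply: sumr_ge0 => ? _); rewrite ?mulr_ge0 ?invr_ge0.
Qed.

(** Independent pairs contribute at most |S|^2 / M <= |S|. For given [a] and [b], a collinear pair
    is determined by [w] and a sign, so there are at most 2 |S| of them, each weighted by 1/(a b);
    summing over [a] and [b] gives the square of the harmonic sum. *)
Lemma second_moment (R : realType) (V : R) (N T M : nat) (S : seq (int * int))
    (F : int * int -> R -> R) :
  (0 < N)%N -> (0 < M)%N -> (size S <= M)%N ->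
  (forall d, (0 < d <= 2 * T ^ 3 * M)%N -> (d %| N)%N) ->
  uniq S ->
  (forall p, p \in S -> [/\ p != 0, (`|p.1| <= T)%N & (`|p.2| <= T)%N]) ->
  (forall (a : nat) w, (0 < a)%N -> (a%:Z * w.1, a%:Z * w.2) \in S -> w \in S) ->
  (forall p, p \in S -> equidistributed V (F p)) ->
  torsion_sum N (fun x y => (\sum_(p <- S) F p (dot p x y)) ^+ 2) <=
  N%:R ^+ 2 * V ^+ 2 * (size S)%:R * (1 + 2 * (\sum_(a < T) a.+1%:R^-1) ^+ 2).
Proof.
move=> N0 M0 SM divN uS ST Sdiv eF.
have V2 : 0 <= N%:R ^+ 2 * V ^+ 2 by rewrite mulr_ge0 ?sqr_ge0.
have -> : torsion_sum N (fun x y => (\sum_(p <- S) F p (dot p x y)) ^+ 2) =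
    \sum_(p <- S) \sum_(q <- S)
      torsion_sum N (fun x y => F p (dot p x y) * F q (dot q x y)).
  under eq_bigr do rewrite torsion_sum_sum; rewrite torsion_sum_sum.
  congr torsion_sum; apply/funext => x; apply/funext => y.
  by rewrite expr2 mulr_suml; apply: eq_bigr => p _; rewrite mulr_sumr.
apply: le_trans (_ : \sum_(p <- S) \sum_(q <- S) N%:R ^+ 2 * V ^+ 2 * (M%:R^-1 +
    \sum_(a < T) \sum_(b < T) \sum_(w <- S) \sum_(e : bool)
      (p == (a.+1%:Z * w.1, a.+1%:Z * w.2))%:R *
      (q == ((-1) ^+ e * b.+1%:Z * w.1, (-1) ^+ e * b.+1%:Z * w.2))%:R *
      (a.+1%:R^-1 * b.+1%:R^-1)) <= _).
  rewrite big_seq [leRHS]big_seq; apply: ler_sum => p pS.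
  rewrite big_seq [leRHS]big_seq; apply: ler_sum => q qS.
  by apply: le_trans (ler_norm _) _; exact: (@corr_bound R V N T M S F).
under eq_bigr do rewrite -mulr_sumr; rewrite -mulr_sumr -[leRHS]mulrA.
rewrite ler_wpM2l//.
under eq_bigr do rewrite big_split /=; rewrite big_split /= [leRHS]mulrDr mulr1.
apply: lerD.
  under eq_bigr do rewrite big_const_seq iter_addr_0 count_predT.
  rewrite big_const_seq iter_addr_0 count_predT -mulrnA -[leLHS]mulr_natr natrM mulrA.
  by rewrite ler_piMl// mulrC ler_pdivrMr ?ltr0n// mul1r ler_nat.
pose g a b w e (p q : int * int) : R := (p == (a%:Z * w.1, a%:Z * w.2))%:R *
      (q == ((-1) ^+ e * b%:Z * w.1, (-1) ^+ e * b%:Z * w.2))%:R *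
      (a%:R^-1 * b%:R^-1).
rewrite (_ : \sum_(p <- S) _ = \sum_(a < T) \sum_(b < T) \sum_(w <- S) \sum_(e : bool)
   \sum_(p <- S) \sum_(q <- S) g a.+1 b.+1 w e p q); last first.
  under eq_bigr do rewrite exchange_big /=; rewrite exchange_big /=; apply: eq_bigr => a _.
  under eq_bigr do rewrite exchange_big /=; rewrite exchange_big /=; apply: eq_bigr => b _.
  under eq_bigr do rewrite exchange_big /=; rewrite exchange_big /=; apply: eq_bigr => w _.
  by under eq_bigr do rewrite exchange_big /=; rewrite exchange_big.
apply: le_trans (_ : \sum_(a < T) \sum_(b < T) \sum_(w <- S) \sum_(e : bool)
   (a.+1%:R^-1 * b.+1%:R^-1) <= _).
  do !(apply: ler_sum => ? _); rewrite /g.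
  under eq_bigr do rewrite -mulr_suml -mulr_sumr.
  rewrite -!mulr_suml ler_piMl ?mulr_ge0 ?invr_ge0// mulr_ile1 ?sum_pred1_le//.
    by apply: sumr_ge0.
  by apply: sumr_ge0.
rewrite expr2 big_distrlr /= mulrCA mulr_sumr mulr_sumr.
apply: ler_sum => a _; rewrite !mulr_sumr; apply: ler_sum => b _.
rewrite big_const_seq iter_addr_0 count_predT big_bool /=.
by rewrite -[leLHS]mulr_natl le_eqVlt; apply/orP; left; apply/eqP; ring.
Qed.

(** * Lattice sums of concave profiles *)

Definition int_range (K : nat) : seq int :=
  [seq i%:Z - K%:Z | i <- iota 0 (2 * K).+1].

Lemma mem_int_range (K : nat) (x : int) : (x \in int_range K) = (`|x| <= K)%N.
Proof.
apply/mapP/idP => [[i]|xK]; first by rewrite mem_iota => iK ->; lia.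
by exists `|(x + K%:Z)%R|%N; [rewrite mem_iota|]; lia.
Qed.

Lemma int_range_uniq (K : nat) : uniq (int_range K).
Proof. by rewrite map_inj_uniq ?iota_uniq// => i j /addIr[]. Qed.

Lemma eq_sum_support (R : realType) (I : eqType) (s1 s2 : seq I) (G : I -> R) :
  uniq s1 -> uniq s2 -> (forall x, G x != 0 -> (x \in s1) = (x \in s2)) ->
  \sum_(x <- s1) G x = \sum_(x <- s2) G x.
Proof.
move=> u1 u2 G12.
have H s : \sum_(x <- s) G x = \sum_(x <- s | G x != 0) G x.
  by rewrite [RHS]big_mkcond; apply: eq_bigr => x _; case: eqVneq.
rewrite (H s1) (H s2) -[LHS]big_filter -[RHS]big_filter.
apply: perm_big; apply: uniq_perm; rewrite ?filter_uniq// => x.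
by rewrite !mem_filter; case: (boolP (G x != 0)) => //= /G12.
Qed.

Definition supported (R : realType) (H : R) (f : R -> R) : Prop :=
  forall u, H < `|u| -> f u = 0.

(* The sum of f (k + x) over all integers k, for f supported in [-H, H]. *)
Definition lattice_sum (R : realType) (H : R) (f : R -> R) (x : R) : R :=
  \sum_(k <- int_range (Num.bound (H + `|x|))) f (k%:~R + x).

Lemma lattice_sumE (R : realType) (H : R) (f : R -> R) (x : R) (s : seq int) :
  supported H f -> uniq s ->
  (forall k : int, f (k%:~R + x) != 0 -> k \in s) ->
  lattice_sum H f x = \sum_(k <- s) f (k%:~R + x).
Proof.
move=> Hf us sH; apply: eq_sum_support => //; first exact: int_range_uniq.
move=> k fk; have kH : `|k%:~R + x| <= H.
  by rewrite leNgt; apply: contraNN fk => /Hf ->.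
rewrite sH// mem_int_range -(ler_nat R) natr_absz intr_norm.
have H0 : 0 <= H + `|x|.
  by rewrite addr_ge0//; exact: le_trans (normr_ge0 _) kH.
apply: ltW; apply: le_lt_trans (archi_boundP H0).
by rewrite -[X in `|X|](addrK x) (le_trans (ler_normB _ _))// lerD2r.
Qed.

Lemma lattice_sum_window (R : realType) (H : R) (f : R -> R) (x : R) (s : seq int) :
  supported H f -> uniq s ->
  (forall k : int, `|k%:~R + x| <= H -> k \in s) ->
  lattice_sum H f x = \sum_(k <- s) f (k%:~R + x).
Proof.
move=> Hf us sH; apply: lattice_sumE => // k fk; apply: sH.
by rewrite leNgt; apply: contraNN fk => /Hf ->.
Qed.

Lemma lattice_sum_range (R : realType) (H : R) (f : R -> R) (x : R) (K : nat) :
  supported H f -> H + `|x| <= K%:R ->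
  lattice_sum H f x = \sum_(k <- int_range K) f (k%:~R + x).
Proof.
move=> Hf HK; apply: lattice_sum_window => // [|k kH]; first exact: int_range_uniq.
rewrite mem_int_range -(ler_nat R) natr_absz intr_norm; apply: le_trans HK.
by rewrite -[X in `|X|](addrK x) (le_trans (ler_normB _ _))// lerD2r.
Qed.

Lemma lattice_sum_periodic (R : realType) (H : R) (f : R -> R) (x : R) :
  supported H f -> lattice_sum H f (x + 1) = lattice_sum H f x.
Proof.
move=> Hf; set s := int_range (Num.bound (H + `|x + 1|)).
rewrite (@lattice_sum_window _ _ _ x [seq k + 1 | k <- s])//.
- by rewrite big_map; apply: eq_bigr => k _; rewrite intrD; congr f; ring.
- by rewrite map_inj_uniq ?int_range_uniq// => i j /addIr.
move=> k kH; apply/mapP; exists (k - 1); last by rewrite subrK.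
rewrite mem_int_range -(ler_nat R) natr_absz intr_norm.
have H0 : 0 <= H + `|x + 1|.
  by rewrite addr_ge0//; exact: le_trans (normr_ge0 _) kH.
apply: ltW; apply: le_lt_trans (archi_boundP H0).
have -> : (k - 1)%:~R = (k%:~R + x) - (x + 1) :> R by rewrite intrD rmorphN1; ring.
by rewrite (le_trans (ler_normB _ _))// lerD2r.
Qed.

(** Euclidean division m = k a + j identifies the points k + j/a with the multiples m/a. A bound on
    the sum over translates thus becomes a bound on one lattice sum of a stretched profile. *)
Lemma lattice_sum_refine (R : realType) (H : R) (f : R -> R) (a : nat) (x : R) :
  supported H f -> (0 < a)%N ->
  \sum_(j < a) lattice_sum H f (x + j%:R / a%:R) =
  lattice_sum (a%:R * H) (fun u => f (u / a%:R)) (a%:R * x).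
Proof.
move=> Hf a0; have a0' : 0 < a%:R :> R by rewrite ltr0n.
have [H0|H0] := ltP H 0.
  rewrite /lattice_sum big1; last first.
    by move=> j _; rewrite big1// => k _; apply: Hf; exact: lt_le_trans H0 _.
  by rewrite big1// => k _; apply: Hf; exact: lt_le_trans H0 _.
set K := Num.bound (H + `|x| + 1).
have KP : H + `|x| + 1 < K%:R by apply: archi_boundP; rewrite !addr_ge0.
rewrite (@lattice_sum_window _ _ _ _ [seq k * a%:Z + j%:Z | k <- int_range K, j <- iota 0 a]).
- rewrite big_allpairs_dep /= exchange_big /= [RHS](big_nth 0) size_iota big_mkord.
  apply: eq_bigr => j _; rewrite nth_iota// (@lattice_sum_range _ _ _ _ K)//.
    apply: eq_bigr => k _; congr f; rewrite intrD intrM /=.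
    by field; rewrite pnatr_eq0 -lt0n.
  apply: le_trans (ltW KP); rewrite -addrA lerD2l (le_trans (ler_normD _ _))// lerD2l.
  by rewrite normf_div !normr_nat ler_pdivrMr// mul1r ler_nat ltnW.
- move=> u; rewrite -[u in `|u|](divfK (lt0r_neq0 a0')) normrM normr_nat mulrC.
  by rewrite ltr_pM2r//; apply: Hf.
- apply: allpairs_uniq; rewrite ?int_range_uniq ?iota_uniq//.
  move=> u v /allpairsP[[k i] [_ ia ->]] /allpairsP[[l j] [_ ja ->]] /= e.
  rewrite !mem_iota /= in ia ja; have : k = l by nia.
  by move=> kl; rewrite kl in e *; congr pair; lia.
move=> m mH; apply/allpairsP; exists ((m %/ a%:Z)%Z, `|(m %% a%:Z)%Z|%N) => /=.
have am0 : (0 <= m %% a%:Z)%Z by rewrite modz_ge0// eqz_nat -lt0n.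
have ama : (m %% a%:Z < a%:Z)%Z by rewrite ltz_pmod.
split; last by rewrite {1}(divz_eq m a) gez0_abs.
  rewrite mem_int_range -(ler_nat R) natr_absz intr_norm; apply: le_trans (ltW KP).
  have E : (m %/ a)%Z%:~R = (m%:~R + a%:R * x) / a%:R - x - (m %% a)%Z%:~R / a%:R :> R.
    rewrite {2}(divz_eq m a) intrD intrM; field; rewrite pnatr_eq0 -lt0n//.
  rewrite E (le_trans (ler_normB _ _))// lerD//.
    rewrite (le_trans (ler_normB _ _))// lerD2r normrM normfV normr_nat.
    by rewrite ler_pdivrMr// [H * _]mulrC.
  rewrite normf_div normr_nat ler_pdivrMr// mul1r ger0_norm ?ler0z//.
  by rewrite -[a%:R]/(a%:Z%:~R) ler_int ltW.
rewrite mem_iota /=; lia.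
Qed.

(** Concavity is imposed on [-H, H] only, since a profile such as [slice0] jumps at the ends of its
    support. The bound [w] on the variation over unit distance covers these jumps too. *)
Definition concave_profile (R : realType) (H w : R) (f : R -> R) : Prop :=
  [/\ supported H f, forall u, 0 <= f u,
      forall u v d, `|u| <= H -> `|v| <= H -> 0 <= d <= 1 ->
        (1 - d) * f u + d * f v <= f ((1 - d) * u + d * v) &
      forall u v, `|u - v| <= 1 -> `|f u - f v| <= w].

Lemma telescope_int_range (R : realType) (K : nat) (g : int -> R) :
  \sum_(k <- int_range K) (g (k + 1) - g k) = g (K%:Z + 1) - g (- K%:Z).
Proof.
rewrite big_map -[iota 0 _]/(index_iota 0 (2 * K).+1).
rewrite (eq_bigr (fun i => g (i.+1%:Z - K%:Z) - g (i%:Z - K%:Z))); last first.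
  by move=> i _; congr (g _ - _); rewrite -addn1 PoszD; ring.
rewrite (@telescope_sumr _ _ _ (fun i => g (i%:Z - K%:Z)))//.
by congr (g _ - g _); lia.
Qed.

(** By concavity f(k + x + d) is at least the convex combination of f(k + x) and f(k + 1 + x), and
    by periodicity these combinations add up to the lattice sum at [x]. This fails at most for the
    two unit intervals that cross an end of the support, and each of them costs at most [w]. *)
Lemma lattice_sum_chord (R : realType) (H w : R) (f : R -> R) (x d : R) :
  concave_profile H w f -> 0 <= d <= 1 ->
  lattice_sum H f x - 2 * w <= lattice_sum H f (x + d).
Proof.
move=> [Hf f0 fc fw] d01.
have w0 : 0 <= w by apply: le_trans (normr_ge0 _) (fw 0 0 _); rewrite subrr normr0.
have [H0|H0] := ltP H 0.
  rewrite /lattice_sum !big1 => [||k _]; first by rewrite sub0r oppr_le0 mulr_ge0.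
    by move=> k _; apply: Hf; exact: lt_le_trans H0 _.
  by apply: Hf; exact: lt_le_trans H0 _.
set K := Num.bound (H + `|x| + 2).
have KP : H + `|x| + 2 < K%:R by apply: archi_boundP; rewrite !addr_ge0.
have [d0 d1] := andP d01.
rewrite (@lattice_sum_range _ _ _ (x + d) K)//; last first.
  by rewrite (le_trans _ (ltW KP))// -addrA lerD2l (le_trans (ler_normD _ _))// lerD2l ger0_norm//; lra.
have E : lattice_sum H f x = \sum_(k <- int_range K)
    ((1 - d) * f (k%:~R + x) + d * f (k%:~R + (x + 1))).
  rewrite big_split /= -!mulr_sumr -!(@lattice_sum_range _ H)//.
  - by rewrite lattice_sum_periodic//; ring.
  - by rewrite (le_trans _ (ltW KP))// -addrA lerD2l (le_trans (ler_normD _ _))// lerD2l normr1; lra.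
  - by rewrite (le_trans _ (ltW KP))// -addrA lerD2l lerDl.
(* The increments of [c1] and [c2] mark the unit intervals that cross -H and H; telescoping shows
   that each is charged at most once. *)
pose c1 (k : int) : R := (- H <= k%:~R + x)%R%:R.
pose c2 (k : int) : R := (H < k%:~R + x)%R%:R.
have tele (c : int -> R) : (forall k, 0 <= c k <= 1) -> \sum_(k <- int_range K) (c (k + 1) - c k) <= 1.
  move=> c01; rewrite telescope_int_range.
  by have := c01 (K%:Z + 1); have := c01 (- K%:Z); lra.
have b01 (b : bool) : 0 <= (b%:R : R) <= 1 by rewrite ler0n lern1 leq_b1.
apply: le_trans (_ : _ <= \sum_(k <- int_range K)
    ((1 - d) * f (k%:~R + x) + d * f (k%:~R + (x + 1))
     - w * ((c1 (k + 1) - c1 k) + (c2 (k + 1) - c2 k)))) _.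
  rewrite big_split /= -E lerD2l sumrN lerN2 -mulr_sumr [2 * w]mulrC ler_wpM2l// big_split /=.
  by have := tele c1 (fun k => b01 _); have := tele c2 (fun k => b01 _); lra.
apply: ler_sum => k _; rewrite /c1 /c2 intrD addrACA.
set u := k%:~R + x.
have -> : k%:~R + (x + 1) = u + 1 by rewrite /u addrA.
have -> : k%:~R + (x + d) = u + d by rewrite /u addrA.
have -> : k%:~R + 1%:~R + x = u + 1 by rewrite /u; ring.
have fu : f u <= w + f (u + 1).
  have := fw u (u + 1); rewrite (_ : u - (u + 1) = - 1); last ring.
  by rewrite normrN1 => /(_ (lexx _)); rewrite ler_norml => /andP[_]; lra.
have fu1 : f (u + 1) <= w + f u.
  have := fw (u + 1) u; rewrite (_ : u + 1 - u = 1); last ring.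
  by rewrite normr1 => /(_ (lexx _)); rewrite ler_norml => /andP[_]; lra.
have fu0 := f0 u; have fu10 := f0 (u + 1); have fud := f0 (u + d).
have du : 0 <= d * f u <= f u by rewrite mulr_ge0//= ler_piMl.
have du1 : 0 <= d * f (u + 1) <= f (u + 1) by rewrite mulr_ge0//= ler_piMl.
clear E tele KP.
have [a|a] := leP (- H) u; have [b|b] := ltP H (u + 1).
- rewrite (_ : f (u + 1) = 0) in fu fu1 fu10 du1 *; last by apply: Hf; rewrite ltr_normr b.
  rewrite (_ : - H <= u + 1); last lra.
  have [c|c] := ltP H u; last by rewrite /=; lra.
  by rewrite (_ : f u = 0) /= ?mulr0; [lra|apply: Hf; rewrite ltr_normr c].
- rewrite (_ : (- H <= u + 1) = true); last lra.
  rewrite (_ : (H < u) = false); last by apply/negbTE; rewrite -leNgt; lra.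
  have := fc u (u + 1) d; rewrite (_ : _ * u + _ = u + d); last ring.
  rewrite !ler_norml d01 => /(_ _ _ isT) fc'; apply: le_trans (fc' _ _); lra.
- rewrite (_ : f u = 0) in fu fu1 fu0 du *; last by apply: Hf; rewrite ltr_normr ltrNr a orbT.
  rewrite (_ : f (u + 1) = 0) in fu fu1 fu10 du1 *; last by apply: Hf; rewrite ltr_normr b.
  rewrite (_ : (- H <= u + 1) = true); last lra.
  rewrite (_ : (H < u) = false); last by apply/negbTE; rewrite -leNgt; lra.
  by rewrite /=; lra.
- rewrite (_ : f u = 0) in fu fu1 fu0 du *; last by apply: Hf; rewrite ltr_normr ltrNr a orbT.
  rewrite (_ : (H < u) = false); last by apply/negbTE; rewrite -leNgt; lra.
  have [c|c] := leP (- H) (u + 1); first by rewrite /=; lra.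
  by rewrite (_ : f (u + 1) = 0) /= ?mulr0; [lra|apply: Hf; rewrite ltr_normr ltrNr c orbT].
Qed.

Lemma lattice_sum_osc (R : realType) (H w : R) (f : R -> R) (x y : R) :
  concave_profile H w f -> `|lattice_sum H f x - lattice_sum H f y| <= 2 * w.
Proof.
move=> pf; have Hf : supported H f by case: pf.
have le z t : lattice_sum H f z - 2 * w <= lattice_sum H f t.
  have -> : t = (z + (t - z - (Num.floor (t - z))%:~R)) + (Num.floor (t - z))%:~R by ring.
  rewrite periodic_int; last by move=> ?; exact: lattice_sum_periodic.
  apply: lattice_sum_chord => //; have := floor_itv (t - z).
  by rewrite intrD => /andP[]; lra.
by rewrite ler_norml; have := le x y; have := le y x; lra.
Qed.

(** The image of Lebesgue measure under x -> s x + c, multiplied by s, agrees with Lebesgue measure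
    on half-open intervals, hence everywhere. *)
Lemma integral_affine (R : realType) (s c : R) (F : R -> \bar R) : 0 < s ->
  measurable_fun setT F -> (forall x, 0 <= F x)%E ->
  (\int[@lebesgue_measure R]_x F x =
   s%:E * \int[@lebesgue_measure R]_x F (s * x + c)%R)%E.
Proof.
move=> s0 mF F0.
have mphi : measurable_fun setT (fun x : R => s * x + c : measurableTypeR R).
  by apply: measurable_funD => //; exact: measurable_funM.
pose m := mscale (NngNum (ltW s0))
  (measure_function_pushforward__canonical__measure_function_Measure (@lebesgue_measure R) mphi).
rewrite (@eq_measure_integral _ _ _ _ m).
  by rewrite ge0_integral_mscale//= ge0_integral_pushforward//.
move=> A mA _; apply: lebesgue_measure_unique => //.
move=> _ [[a b] /= ab <-]; rewrite /m /mscale /= /pushforward /=.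
rewrite (_ : _ @^-1` _ = `](a - c) / s, (b - c) / s]%classic); last first.
  apply/seteqP; split => x /=; rewrite !in_itv /= => /andP[ax xb].
    by rewrite ltr_pdivrMr// ler_pdivlMr// [x * s]mulrC; lra.
  by move: ax xb; rewrite ltr_pdivrMr// ler_pdivlMr// [x * s]mulrC; lra.
rewrite !lebesgue_measure_itv /= !lte_fin ltr_pM2r ?invr_gt0// ltrD2r.
case: ifPn => _; last by rewrite mule0.
rewrite -!EFinD -EFinM; congr EFin.
by field; rewrite gt_eqF.
Qed.

Lemma integral_scaled_indic01 (R : realType) (c : R) : 0 <= c ->
  (\int[@lebesgue_measure R]_x (c * \1_(`[0%R, 1%R[%classic) x)%:E = c%:E)%E.
Proof.
move=> c0; have mI : measurable_fun setT (fun x : R => (\1_(`[0%R, 1%R[%classic) x : R)%:E).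
  apply/measurable_EFinP; exact: measurable_indic.
under eq_integral do rewrite EFinM.
rewrite ge0_integralZl//=.
rewrite integral_indic// setIT /= lebesgue_measure_itv /= lte_fin ltr01.
by rewrite oppr0 adde0 mule1.
Qed.

Lemma lattice_sum_indic01 (R : realType) (H : R) (f : R -> R) (K : nat) :
  supported H f -> `|H| + 1 <= K%:R ->
  (fun x => lattice_sum H f x * \1_(`[0%R, 1%R[%classic) x) =
  (fun x => (\sum_(k <- int_range K) f (k%:~R + x)) * \1_(`[0%R, 1%R[%classic) x).
Proof.
move=> Hf KP; apply/funext => x.
rewrite indicE; case: (boolP (x \in _)) => [|_]; last by rewrite !mulr0.
rewrite inE /= in_itv /= => /andP[x0 x1]; rewrite (@lattice_sum_range _ _ _ _ K)//.
by apply: le_trans KP; rewrite [in `|x|]ger0_norm// lerD ?ler_norm// ltW.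
Qed.

(** Cut the line into the intervals [k, k + 1[ and translate each of them to [0, 1[; the bounded
    support leaves finitely many k. *)
Lemma integral_unfold (R : realType) (H : R) (f : R -> R) :
  supported H f -> (forall u, 0 <= f u) -> measurable_fun setT f ->
  (\int[@lebesgue_measure R]_x (f x)%:E =
   \int[@lebesgue_measure R]_x (lattice_sum H f x * \1_(`[0%R, 1%R[%classic) x)%:E)%E.
Proof.
move=> Hf f0 mf; set K := Num.bound (`|H| + 1).
have KP : `|H| + 1 < K%:R by apply: archi_boundP; rewrite addr_ge0.
pose g (k : int) (x : R) : R := f x * \1_(`[k%:~R : R, (k + 1)%:~R[%classic) x.
have mg k : measurable_fun setT (fun x => (g k x)%:E).
  apply/measurable_EFinP; apply: measurable_funM => //; exact: measurable_indic.
have g0 k x : (0 <= (g k x)%:E)%E by rewrite lee_fin mulr_ge0.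
have fE x : f x = \sum_(k <- int_range K) g k x.
  have [xH|xH] := ltP H `|x|; first by rewrite Hf// big1// => k _; rewrite /g Hf// mul0r.
  have /andP[fl1 fl2] := floor_itv x.
  have flK : Num.floor x \in int_range K.
    rewrite mem_int_range -(ler_nat R) natr_absz intr_norm; apply: le_trans (ltW KP).
    move: xH; have := ler_norm H; rewrite !ler_norml => ?.
    by move=> /andP[? ?]; move: fl2; rewrite intrD; lra.
  rewrite (bigD1_seq (Num.floor x)) ?int_range_uniq//= big1 ?addr0; last first.
    move=> k kx; rewrite /g indicE memNset ?mulr0//= in_itv /= => /andP[kx1 kx2].
    by case/eqP: kx; apply/esym/floor_def; rewrite kx1.
  by rewrite /g indicE mem_set ?mulr1//= in_itv /= fl1.
transitivity (\sum_(k <- int_range K) \int[@lebesgue_measure R]_x (g k x)%:E)%E.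
  rewrite -ge0_integral_sum//; apply: eq_integral => x _.
  by rewrite fE sumEFin.
transitivity (\sum_(k <- int_range K) \int[@lebesgue_measure R]_x
    (f (k%:~R + x) * \1_(`[0%R, 1%R[%classic) x)%:E)%E.
  apply: eq_bigr => k _; rewrite (@integral_affine _ 1 k%:~R)// mul1e.
  apply: eq_integral => x _; rewrite mul1r /g addrC; congr (f _ * _)%:E.
  rewrite !indicE; congr ((nat_of_bool _)%:R); apply/idP/idP; rewrite !inE /= !in_itv /= intrD => /andP[] ? ?; apply/andP; split; lra.
rewrite -ge0_integral_sum//.
- apply: eq_integral => x _; rewrite sumEFin -mulr_suml; congr EFin.
  by have /(congr1 (@^~ x)) := lattice_sum_indic01 Hf (ltW KP).
- move=> k; apply/measurable_EFinP; apply: measurable_funM; last exact: measurable_indic.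
  by apply: measurableT_comp => //; exact: measurable_funD.
- by move=> k x _; rewrite lee_fin mulr_ge0.
Qed.

(** After unfolding, [I] is the mean of the lattice sum over a period, and a function that
    oscillates by at most 2 w stays within 2 w of its mean. *)
Lemma lattice_sum_integral (R : realType) (H w I : R) (f : R -> R) (x : R) :
  concave_profile H w f -> measurable_fun setT f ->
  (\int[@lebesgue_measure R]_x (f x)%:E = I%:E)%E ->
  `|lattice_sum H f x - I| <= 2 * w.
Proof.
move=> pf mf; have [Hf f0 _ fw] := pf; rewrite (integral_unfold Hf f0 mf) => IE.
have KP : `|H| + 1 < (Num.bound (`|H| + 1))%:R by apply: archi_boundP; rewrite addr_ge0.
have osc y : `|lattice_sum H f x - lattice_sum H f y| <= 2 * w by exact: lattice_sum_osc.
have ls0 y : 0 <= lattice_sum H f y by apply: sumr_ge0.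
have w0 : 0 <= w by apply: le_trans (normr_ge0 _) (fw 0 0 _); rewrite subrr normr0.
have mls : measurable_fun setT (fun y : R => (lattice_sum H f y * \1_(`[0%R, 1%R[%classic) y)%:E).
  apply/measurable_EFinP; rewrite (lattice_sum_indic01 Hf (ltW KP)).
  apply: measurable_funM; last exact: measurable_indic.
  apply: measurable_sum => k.
  by apply: measurableT_comp => //; exact: measurable_funD.
have mc (c : R) : measurable_fun setT (fun y : R => (c * \1_(`[0%R, 1%R[%classic) y)%:E).
  by apply/measurable_EFinP; apply: measurable_funM => //; exact: measurable_indic.
rewrite ler_distlC; apply/andP; split.
  have [c0|c0] := leP 0 (lattice_sum H f x - 2 * w); last first.
    apply: le_trans (ltW c0) _; rewrite -lee_fin -IE; apply: integral_ge0 => y _.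
    by rewrite lee_fin mulr_ge0.
  rewrite -lee_fin -IE -[leLHS]integral_scaled_indic01//.
  apply: ge0_le_integral => // [y _||y _]; first by rewrite lee_fin mulr_ge0.
    exact: mc.
  by rewrite lee_fin ler_wpM2r//; have := osc y; rewrite ler_norml; lra.
rewrite -lee_fin -IE -[leRHS]integral_scaled_indic01 ?addr_ge0 ?mulr_ge0//.
apply: ge0_le_integral => // [y _||y _]; first by rewrite lee_fin mulr_ge0.
  exact: mc.
by rewrite lee_fin ler_wpM2r//; have := osc y; rewrite ler_norml; lra.
Qed.

Lemma equidistributed_shift (R : realType) (V c : R) (F : R -> R) :
  equidistributed V F -> equidistributed V (fun x => F (x + c)).
Proof.
move=> [perF VF]; split=> [x|a x a0]; first by rewrite addrAC perF.
by under eq_bigr do rewrite addrAC; exact: VF.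
Qed.

Lemma concave_profile_scale (R : realType) (H w : R) (f : R -> R) (a : nat) :
  concave_profile H w f -> (0 < a)%N ->
  concave_profile (a%:R * H) w (fun u => f (u / a%:R)).
Proof.
move=> [Hf f0 fc fw] a0; have a0' : 0 < a%:R :> R by rewrite ltr0n.
have scale (u : R) : `|u / a%:R| = `|u| / a%:R by rewrite normf_div normr_nat.
split => // [u|u v d uH vH d01|u v uv].
- by rewrite mulrC -ltr_pdivlMr// -scale; exact: Hf.
- rewrite (_ : ((1 - d) * u + d * v) / a%:R = (1 - d) * (u / a%:R) + d * (v / a%:R)); last ring.
  by apply: fc => //; rewrite scale ler_pdivrMr// mulrC.
- apply: fw; rewrite -mulrBl scale ler_pdivrMr// mul1r (le_trans uv)//.
  by rewrite ler1n.
Qed.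

(** The sum over the [a] translates is the lattice sum of the profile stretched by [a]. Its integral
    is a I and its variation over unit distance is still at most [w], so the previous bound applies
    with the same constant. *)
Lemma profile_equidistributed (R : realType) (H w I : R) (f : R -> R) :
  concave_profile H w f -> measurable_fun setT f ->
  (\int[@lebesgue_measure R]_x (f x)%:E = I%:E)%E ->
  equidistributed (2 * w) (fun x => lattice_sum H f x - I).
Proof.
move=> pf mf IE; have [Hf f0 _ _] := pf.
split=> [x|a x a0]; first by rewrite lattice_sum_periodic.
have a0' : 0 < a%:R :> R by rewrite ltr0n.
rewrite sumrB lattice_sum_refine// sumr_const card_ord -[I *+ a]mulr_natl.
have mfa : measurable_fun setT (fun u : R => f (u / a%:R)).
  by apply: measurableT_comp => //; exact: measurable_funM.
apply: lattice_sum_integral => //; first exact: concave_profile_scale.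
rewrite (@integral_affine _ a%:R 0)//.
- under eq_integral do rewrite addr0 [a%:R * _]mulrC mulrK ?unitfE ?gt_eqF//.
  by rewrite IE EFinM.
- exact/measurable_EFinP.
- by move=> x0; rewrite lee_fin.
Qed.

(* Up to constants, slice_i is the volume of the i-dimensional slices of a ball
   of squared radius r, at distance u from the centre. *)
Definition slice0 (R : realType) (r u : R) : R := (u ^+ 2 <= r)%R%:R.
Definition slice1 (R : realType) (r u : R) : R := Num.sqrt (r - u ^+ 2).
Definition slice2 (R : realType) (r u : R) : R := Num.max 0 (r - u ^+ 2).

Lemma sqrt_le_norm (R : realType) (r u : R) : Num.sqrt r < `|u| -> r < u ^+ 2.
Proof.
move=> ru; have [r0|r0] := ltP r 0; first by rewrite (lt_le_trans r0) ?sqr_ge0.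
by rewrite -[u ^+ 2]real_normK ?num_real// -(sqr_sqrtr r0) ltr_pXn2r ?nnegrE.
Qed.

Lemma norm_le_sqrt (R : realType) (r u : R) : 0 <= r ->
  (`|u| <= Num.sqrt r) = (u ^+ 2 <= r).
Proof.
move=> r0; rewrite -[in RHS](sqr_sqrtr r0) -[u ^+ 2]real_normK ?num_real//.
by rewrite ler_pXn2r ?nnegrE.
Qed.

Lemma slice_chord (R : realType) (r u v d : R) : 0 <= d <= 1 ->
  (1 - d) * (r - u ^+ 2) + d * (r - v ^+ 2) <= r - ((1 - d) * u + d * v) ^+ 2.
Proof.
move=> /andP[d0 d1]; rewrite -subr_ge0.
rewrite (_ : _ - _ = d * (1 - d) * (u - v) ^+ 2); last ring.
by rewrite mulr_ge0 ?sqr_ge0// mulr_ge0// subr_ge0.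
Qed.

Lemma slice0_profile (R : realType) (r : R) :
  concave_profile (Num.sqrt r) 1 (slice0 r).
Proof.
have [r0|r0] := ltP r 0.
  have s0 u : slice0 r u = 0.
    by rewrite /slice0 leNgt (lt_le_trans r0) ?sqr_ge0.
  split => [u _|u|u v d _ _ _|u v _]; rewrite !s0 ?mulr0 ?addr0 ?subrr ?normr0//.
split => [u /sqrt_le_norm|u|u v d|u v _].
- by rewrite /slice0 ltNge => /negbTE ->.
- by rewrite /slice0 ler0n.
- rewrite !norm_le_sqrt// /slice0 => ur vr d01; rewrite ur vr.
  have -> : ((1 - d) * u + d * v) ^+ 2 <= r.
    rewrite -subr_ge0; apply: le_trans (slice_chord r u v d01).
    by have /andP[d0 d1] := d01; rewrite addr_ge0// mulr_ge0 ?subr_ge0.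
  by rewrite /= !mulr1 subrK.
rewrite /slice0; case: (u ^+ 2 <= r); case: (v ^+ 2 <= r) => /=;
  by rewrite ?subrr ?subr0 ?sub0r ?normrN ?normr1 ?normr0.
Qed.

(** On the support the slope of r - u^2 is at most 2 sqrt r in absolute value, and truncation at 0
    does not increase the variation. *)
Lemma slice2_profile (R : realType) (r : R) :
  concave_profile (Num.sqrt r) (2 * Num.sqrt r) (slice2 r).
Proof.
have [r0|r0] := ltP r 0.
  have s0 u : slice2 r u = 0.
    by apply/max_idPl; have := sqr_ge0 u; lra.
  by split => [u _|u|u v d _ _ _|u v _]; rewrite !s0 ?mulr0 ?addr0 ?subrr ?normr0// mulr_ge0.
split => [u /sqrt_le_norm|u|u v d|].
- by rewrite /slice2 => ru; apply/max_idPl; lra.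
- by rewrite /slice2 le_max lexx.
- rewrite !norm_le_sqrt// /slice2 => ur vr d01.
  have := slice_chord r u v d01.
  by rewrite (@max_r _ _ 0 (r - u ^+ 2)) ?subr_ge0// (@max_r _ _ 0 (r - v ^+ 2)) ?subr_ge0// le_max => ->; rewrite orbT.
have H u v : `|u - v| <= 1 -> slice2 r u - slice2 r v <= 2 * Num.sqrt r.
  rewrite /slice2 => uv.
  have v0 : 0 <= Num.max 0 (r - v ^+ 2) by rewrite le_max lexx.
  have v1 : r - v ^+ 2 <= Num.max 0 (r - v ^+ 2) by rewrite le_max lexx orbT.
  have [ur|ur] := leP (r - u ^+ 2) 0; first by have := sqrtr_ge0 r; lra.
  have us : `|u| <= Num.sqrt r by rewrite norm_le_sqrt//; lra.
  rewrite lerBlDr.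
  set s := Num.sqrt r in us *; have sr : s ^+ 2 = r by rewrite sqr_sqrtr.
  move: us uv; rewrite !ler_norml => /andP[u1 u2] /andP[uv1 uv2].
  have [vs|vs] := leP (v ^+ 2) r; last first.
    have : s < `|v| by rewrite ltNge norm_le_sqrt// -ltNge.
    move: v0 v1; set m := Num.max _ _ => v0 v1; rewrite -sr ltr_normr => /orP[vs'|vs'].
      by have : 0 <= (1 - (s - u)) * (s + u) by [rewrite mulr_ge0//; lra]; lra.
    by have : 0 <= (1 - (s + u)) * (s - u) by [rewrite mulr_ge0//; lra]; lra.
  have : `|v| <= s by rewrite norm_le_sqrt.
  rewrite ler_norml => /andP[v2 v3]; move: v0 v1; set m := Num.max _ _ => v0 v1.
  have [uv|uv] := leP 0 (u + v).
    by have : 0 <= (1 - (v - u)) * (u + v) by [rewrite mulr_ge0//; lra]; lra.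
  by have : 0 <= (1 - (u - v)) * (- (u + v)) by [rewrite mulr_ge0//; lra]; lra.
by move=> u v uv; rewrite ler_norml; have := H _ _ uv; rewrite distrC in uv; have := H _ _ uv; lra.
Qed.

Lemma sqrt_sub_le (R : realType) (x y : R) : 0 <= y -> y <= x ->
  Num.sqrt x - Num.sqrt y <= Num.sqrt (x - y).
Proof.
move=> y0 yx; rewrite lerBlDr.
have := sqrtr_ge0 y; have := sqrtr_ge0 (x - y) => a0 b0.
rewrite -[leRHS]ger0_norm ?addr_ge0// -sqrtr_sqr ler_wsqrtr//.
rewrite sqrrD !sqr_sqrtr ?subr_ge0//.
by have := mulr_ge0 a0 b0; lra.
Qed.

Lemma slice1E (R : realType) (r u : R) : slice1 r u = Num.sqrt (slice2 r u).
Proof.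
rewrite /slice1 /slice2; case: leP => // h; rewrite sqrtr0; exact/ler0_sqrtr/ltW.
Qed.

(** The slope is unbounded at the ends of the support, but sqrt x - sqrt y <= sqrt (x - y) turns the
    variation 2 sqrt r of [slice2] into its square root. Concavity is the convexity of the disc:
    after squaring, the gap is d (1 - d) times the squared distance of two points of the circle. *)
Lemma slice1_profile (R : realType) (r : R) :
  concave_profile (Num.sqrt r) (Num.sqrt (2 * Num.sqrt r)) (slice1 r).
Proof.
have [Hf f0 _ fw] := slice2_profile r.
split => [u ru|u|u v d|].
- by rewrite slice1E Hf// sqrtr0.
- exact: sqrtr_ge0.
- have [r0|r0] := ltP r 0.
    by rewrite /slice1 => _ _ _; rewrite !ler0_sqrtr ?mulr0 ?addr0//; apply: ltW; rewrite (le_lt_trans _ r0)// gerBl sqr_ge0.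
  rewrite !norm_le_sqrt// /slice1 => ur vr /andP[d0 d1].
  set a := Num.sqrt (r - u ^+ 2); set b := Num.sqrt (r - v ^+ 2).
  have a0 : 0 <= a by exact: sqrtr_ge0.
  have b0 : 0 <= b by exact: sqrtr_ge0.
  have aE : a ^+ 2 = r - u ^+ 2 by rewrite sqr_sqrtr// subr_ge0.
  have bE : b ^+ 2 = r - v ^+ 2 by rewrite sqr_sqrtr// subr_ge0.
  have d1' : 0 <= 1 - d by rewrite subr_ge0.
  rewrite -[leLHS]ger0_norm ?addr_ge0 ?mulr_ge0// -sqrtr_sqr ler_wsqrtr//.
  rewrite -subr_ge0 (_ : _ - _ = d * (1 - d) * ((a - b) ^+ 2 + (u - v) ^+ 2)).
    by rewrite !mulr_ge0// addr_ge0 ?sqr_ge0.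
  have -> : r - ((1 - d) * u + d * v) ^+ 2 - ((1 - d) * a + d * b) ^+ 2 =
     r - (1 - d) ^+ 2 * (a ^+ 2 + u ^+ 2) - d ^+ 2 * (b ^+ 2 + v ^+ 2)
       - 2 * d * (1 - d) * (a * b + u * v) by ring.
  have -> : (a - b) ^+ 2 + (u - v) ^+ 2 =
     (a ^+ 2 + u ^+ 2) + (b ^+ 2 + v ^+ 2) - 2 * (a * b + u * v) by ring.
  by rewrite aE bE !subrK; ring.
have H u v : `|u - v| <= 1 -> slice1 r u - slice1 r v <= Num.sqrt (2 * Num.sqrt r).
  move=> uv; rewrite !slice1E.
  have [le|lt] := leP (slice2 r v) (slice2 r u).
    apply: le_trans (sqrt_sub_le _ le) _ => //; apply: ler_wsqrtr.
    exact: le_trans (ler_norm _) (fw _ _ uv).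
  apply: le_trans (sqrtr_ge0 _); rewrite subr_le0; exact/ler_wsqrtr/ltW.
by move=> u v uv; rewrite ler_norml; have := H _ _ uv; rewrite distrC in uv; have := H _ _ uv; lra.
Qed.

Lemma measurable_slice0 (R : realType) (r : R) : measurable_fun setT (slice0 r).
Proof.
have -> : slice0 r = \1_[set u : R | u ^+ 2 <= r].
  by apply/funext => u; rewrite indicE /slice0 /=; congr ((nat_of_bool _)%:R); apply/idP/idP; rewrite inE.
apply: measurable_indic; rewrite -[X in measurable X]setTI.
by apply: measurable_fun_le => //; exact: exprn_measurable.
Qed.

Lemma measurable_slice2 (R : realType) (r : R) : measurable_fun setT (slice2 r).
Proof.
apply: measurable_maxr => //; apply: measurable_funB => //; exact: exprn_measurable.
Qed.

Lemma measurable_slice1 (R : realType) (r : R) : measurable_fun setT (slice1 r).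
Proof.
rewrite (_ : slice1 r = Num.sqrt \o slice2 r); last by apply/funext => u; rewrite slice1E.
apply: measurableT_comp; last exact: measurable_slice2.
by apply: continuous_measurable_fun => x; exact: sqrt_continuous.
Qed.

Lemma integral_slice0 (R : realType) (r : R) :
  (\int[@lebesgue_measure R]_x (slice0 r x)%:E = (2 * Num.sqrt r)%:E)%E.
Proof.
have [r0|r0] := ltP r 0.
  rewrite (eq_integral (cst 0%E)) ?integral0 ?ler0_sqrtr ?mulr0 ?(ltW r0)// => u _.
  by rewrite /slice0 leNgt (lt_le_trans r0) ?sqr_ge0.
have s0 := sqrtr_ge0 r.
under eq_integral => u _.
  rewrite (_ : slice0 r u = \1_(`[- Num.sqrt r, Num.sqrt r]%classic) u); last first.
    rewrite indicE /slice0 /=; congr ((nat_of_bool _)%:R); rewrite -norm_le_sqrt// ler_norml.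
    by apply/idP/idP; rewrite inE /= in_itv.
  over.
rewrite integral_indic//= setIT lebesgue_measure_itv /= lte_fin.
case: ltP => h; first by rewrite -EFinD; congr EFin; ring.
by congr EFin; lra.
Qed.

(** The numbers [kappa1] and [kappa2] are pi/2 and 4/3. They are kept as integrals because they
    enter the lattice sums and the volume in the same way and cancel. *)
Definition kappa1 (R : realType) : R :=
  fine (\int[@lebesgue_measure R]_x (slice1 1 x)%:E)%E.
Definition kappa2 (R : realType) : R :=
  fine (\int[@lebesgue_measure R]_x (slice2 1 x)%:E)%E.

Lemma integral_unit_slice (R : realType) (f : R -> R) :
  measurable_fun setT f -> (forall u, 0 <= f u <= slice0 1 u) ->
  (\int[@lebesgue_measure R]_x (f x)%:E)%E \is a fin_num.
Proof.
move=> mf f01; rewrite ge0_fin_numE; last first.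
  by apply: integral_ge0 => u _; rewrite lee_fin; have /andP[] := f01 u.
apply: (@le_lt_trans _ _ (\int[@lebesgue_measure R]_x (slice0 1 x)%:E)%E).
  apply: ge0_le_integral => //.
  - by move=> u _; rewrite lee_fin; have /andP[] := f01 u.
  - exact/measurable_EFinP.
  - by apply/measurable_EFinP; exact: measurable_slice0.
  - by move=> u _; rewrite lee_fin; have /andP[] := f01 u.
by rewrite integral_slice0 ltry.
Qed.

Lemma integral_slice1 (R : realType) (r : R) :
  (\int[@lebesgue_measure R]_x (slice1 r x)%:E = (kappa1 R * Num.max 0 r)%:E)%E.
Proof.
have [r0|r0] := leP r 0.
  rewrite mulr0 (eq_integral (cst 0%E)) ?integral0// => u _.
  by rewrite /slice1 ler0_sqrtr//; have := sqr_ge0 u; lra.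
have s0 : 0 < Num.sqrt r by rewrite sqrtr_gt0.
rewrite (@integral_affine _ (Num.sqrt r) 0)//; last 2 first.
- by apply/measurable_EFinP; exact: measurable_slice1.
- by move=> u; rewrite lee_fin sqrtr_ge0.
under eq_integral => u _.
  rewrite addr0 (_ : slice1 r _ = Num.sqrt r * slice1 1 u); last first.
    rewrite /slice1 -sqrtrM ?ltW// exprMn sqr_sqrtr ?ltW//; congr Num.sqrt; ring.
  rewrite EFinM; over.
rewrite ge0_integralZl//=; last 2 first.
- by apply/measurable_EFinP; exact: measurable_slice1.
- by move=> u _; rewrite lee_fin sqrtr_ge0.
rewrite muleA -EFinM -expr2 sqr_sqrtr ?ltW// mulrC EFinM /kappa1 fineK//.
apply: integral_unit_slice; first exact: measurable_slice1.
move=> u; rewrite sqrtr_ge0 /slice0 /slice1; case: (leP (u ^+ 2) 1) => /= u1.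
  by rewrite -[leRHS]sqrtr1 ler_wsqrtr// gerBl sqr_ge0.
by rewrite ler0_sqrtr//; lra.
Qed.

Lemma integral_slice2 (R : realType) (r : R) :
  (\int[@lebesgue_measure R]_x (slice2 r x)%:E = (kappa2 R * (Num.sqrt r) ^+ 3)%:E)%E.
Proof.
have [r0|r0] := leP r 0.
  rewrite ler0_sqrtr// expr0n mulr0 (eq_integral (cst 0%E)) ?integral0// => u _.
  by rewrite /slice2 max_l//; have := sqr_ge0 u; lra.
have s0 : 0 < Num.sqrt r by rewrite sqrtr_gt0.
rewrite (@integral_affine _ (Num.sqrt r) 0)//; last 2 first.
- by apply/measurable_EFinP; exact: measurable_slice2.
- by move=> u; rewrite lee_fin le_max lexx.
under eq_integral => u _.
  rewrite addr0 (_ : slice2 r _ = Num.sqrt r ^+ 2 * slice2 1 u); last first.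
    rewrite /slice2 maxr_pMr ?sqr_ge0// mulr0 exprMn sqr_sqrtr ?ltW//; congr Num.max; ring.
  rewrite EFinM; over.
rewrite ge0_integralZl//=; last 2 first.
- by apply/measurable_EFinP; exact: measurable_slice2.
- by move=> u _; rewrite lee_fin le_max lexx.
rewrite muleA -EFinM -exprS [kappa2 R * _]mulrC [RHS]EFinM /kappa2 fineK//.
apply: integral_unit_slice; first exact: measurable_slice2.
move=> u; rewrite /slice0 /slice2 le_max lexx /=; case: (leP (u ^+ 2) 1) => /= u1.
  by rewrite ge_max ler01/= gerBl sqr_ge0.
by rewrite ge_max lexx/=; lra.
Qed.

Lemma kappa1_ge0 (R : realType) : 0 <= kappa1 R.
Proof.
by rewrite fine_ge0//; apply: integral_ge0 => u _; rewrite lee_fin sqrtr_ge0.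
Qed.

(** * Mean squares of sums over boxes of integer vectors *)

Definition punctured_box (T1 T2 : nat) : seq (int * int) :=
  [seq p <- [seq (x, y) | x <- int_range T1, y <- int_range T2] | p != 0].

Lemma mem_punctured_box (T1 T2 : nat) (p : int * int) :
  (p \in punctured_box T1 T2) = [&& p != 0, (`|p.1| <= T1)%N & (`|p.2| <= T2)%N].
Proof.
rewrite mem_filter; congr andb; rewrite -!mem_int_range.
apply/allpairsP/andP => [[[x y] [xT yT ->]]//|[p1 p2]].
by exists p; case: p p1 p2.
Qed.

Definition divisible_upto (N K : nat) : Prop :=
  (0 < N)%N /\ forall d, (0 < d <= K)%N -> (d %| N)%N.

Lemma divisible_upto_fact (K : nat) : divisible_upto K`! K.
Proof.
split; first exact: fact_gt0.
by move=> d /andP[d0 dK]; apply: dvdn_fact; rewrite d0.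
Qed.

Definition harmonic_sum (R : realType) (T : nat) : R := \sum_(a < T) a.+1%:R^-1.

Lemma harmonic_sum_le (R : realType) (T : nat) :
  harmonic_sum R T.+1 <= 1 + ln T.+1%:R.
Proof.
rewrite /harmonic_sum; elim: T => [|T IHT]; first by rewrite big_ord1 ln1 addr0 invr1.
rewrite big_ord_recr /=.
have T1 : 0 < T.+1%:R :> R by [].
have T2 : 0 < T.+2%:R :> R by [].
suff : T.+2%:R^-1 <= ln T.+2%:R - ln T.+1%:R :> R.
  by move=> h; apply: le_trans (lerD IHT h) _; rewrite -addrA subrKC.
rewrite -lerN2 opprB -ln_div ?posrE//.
rewrite (_ : T.+1%:R / T.+2%:R = 1 + (- T.+2%:R^-1)); last first.
  apply: (mulIf (lt0r_neq0 T2)).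
  by rewrite divfK ?lt0r_neq0// mulrDl mulNr mulVf ?lt0r_neq0// mul1r -[in RHS]natr1 addrK.
by apply: le_ln1Dx; rewrite ltrN2 invf_lt1// ltr1n.
Qed.

(** The phase of the zero vector is constant and does not average out. Its term is split off by (s +
    f)^2 <= 2 s^2 + 2 f^2 and bounded by V^2, which turns the factor 1 + 2 h^2 of [second_moment]
    into 2 (1 + 2 h^2) + 2. *)
Lemma mean_square (R : realType) (V : R) (N T1 T2 : nat) (F : int -> int -> R -> R) :
  divisible_upto N (2 * (maxn T1 T2) ^ 3 * ((2 * T1).+1 * (2 * T2).+1)) ->
  (forall x y, equidistributed V (F x y)) ->
  torsion_sum N (fun a b => (\sum_(x <- int_range T1) \sum_(y <- int_range T2)
     F x y (x%:~R * a + y%:~R * b)) ^+ 2) <=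
  N%:R ^+ 2 * V ^+ 2 * ((2 * T1).+1 * (2 * T2).+1)%:R *
    (4 + 4 * harmonic_sum R (maxn T1 T2) ^+ 2).
Proof.
move=> [N0 divN] eF; set M := (_ * _)%N; set T := maxn T1 T2.
set S := punctured_box T1 T2.
have V0 : 0 <= V by exact: le_trans (normr_ge0 _) (equidistributed_le 0 (eF 0 0)).
have sizeS : (size S <= M)%N.
  rewrite size_filter (leq_trans (count_size _ _))// size_allpairs /int_range.
  by rewrite !size_map !size_iota.
have uS : uniq S.
  rewrite filter_uniq// allpairs_uniq ?int_range_uniq//.
  by move=> [x y] [z w].
have := @second_moment R V N T M S (fun p => F p.1 p.2) N0 _ sizeS divN uS _ _ _.
rewrite -/(harmonic_sum R T); set P := torsion_sum _ _ => /(_ _ _ _ _) SM.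
have {}SM : P <= N%:R ^+ 2 * V ^+ 2 * (size S)%:R * (1 + 2 * harmonic_sum R T ^+ 2).
  apply: SM => //.
  - move=> p; rewrite mem_punctured_box => /and3P[p0 p1 p2]; split => //.
      by rewrite (leq_trans p1)// leq_maxl.
    by rewrite (leq_trans p2)// leq_maxr.
  - move=> a [w1 w2] a0; rewrite !mem_punctured_box /= !abszM.
    move=> /and3P[p0 p1 p2]; apply/and3P; split.
    + by apply: contraNneq p0 => -[-> ->]; rewrite !mulr0.
    + by rewrite (leq_trans _ p1)// leq_pmull.
    + by rewrite (leq_trans _ p2)// leq_pmull.
apply: (@le_trans _ _ (2 * P + 2 * (N%:R ^+ 2 * V ^+ 2))).
  rewrite /P /torsion_sum.
  have -> : 2 * (N%:R ^+ 2 * V ^+ 2) = \sum_(i < N) \sum_(j < N) (2 * V ^+ 2).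
    by rewrite !sumr_const !card_ord -mulrnA -[RHS]mulr_natr natrM; ring.
  rewrite mulr_sumr -big_split /=; apply: ler_sum => i _.
  rewrite mulr_sumr -big_split /=; apply: ler_sum => j _.
  set a := _ / _; set b := _ / _.
  have -> : \sum_(x <- int_range T1) \sum_(y <- int_range T2)
      F x y (x%:~R * a + y%:~R * b) =
      \sum_(p <- S) F p.1 p.2 (dot p a b) + F 0 0 0.
    rewrite big_filter.
    transitivity (\sum_(p <- [seq (x, y) | x <- int_range T1, y <- int_range T2])
       F p.1 p.2 (dot p a b)).
      by rewrite big_allpairs.
    have u0 : uniq [seq (x, y) | x <- int_range T1, y <- int_range T2].
      by apply: allpairs_uniq; rewrite ?int_range_uniq// => -[x y] [z w].
    have m0 : (0, 0) \in [seq (x, y) | x <- int_range T1, y <- int_range T2].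
      by apply/allpairsP; exists (0, 0); rewrite !mem_int_range.
    rewrite (bigD1_seq _ m0 u0) /= addrC; congr (_ + F 0 0 _).
    by rewrite /dot /= !mul0r addr0.
  have := equidistributed_le 0 (eF 0 0); set f0 := F 0 0 0; set s := \sum_(p <- S) _.
  rewrite ler_norml => /andP[h1 h2].
  have : f0 ^+ 2 <= V ^+ 2 by rewrite -ler_sqrt ?sqr_ge0// !sqrtr_sqr (ger0_norm V0) ler_norml h1.
  have := sqr_ge0 (s - f0); nra.
have M1 : 1 <= M%:R :> R by rewrite ler1n.
have NV : 0 <= N%:R ^+ 2 * V ^+ 2 by rewrite mulr_ge0 ?sqr_ge0.
have h0 := sqr_ge0 (harmonic_sum R T).
have S1 : (size S)%:R <= M%:R :> R by rewrite ler_nat.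
have SM2 : N%:R ^+ 2 * V ^+ 2 * (size S)%:R * (1 + 2 * harmonic_sum R T ^+ 2) <=
   N%:R ^+ 2 * V ^+ 2 * M%:R * (1 + 2 * harmonic_sum R T ^+ 2).
  by rewrite ler_wpM2r ?ler_wpM2l//; lra.
have M2 : N%:R ^+ 2 * V ^+ 2 <= N%:R ^+ 2 * V ^+ 2 * M%:R by rewrite ler_peMr.
by move: SM SM2 M2; lra.
Qed.

(** * Discrepancies of binary and ternary quadratic forms *)

Definition disc0 (R : realType) (r x : R) : R :=
  lattice_sum (Num.sqrt r) (slice0 r) x - 2 * Num.sqrt r.
Definition disc1 (R : realType) (r x : R) : R :=
  lattice_sum (Num.sqrt r) (slice1 r) x - kappa1 R * Num.max 0 r.
Definition disc2 (R : realType) (r x : R) : R :=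
  lattice_sum (Num.sqrt r) (slice2 r) x - kappa2 R * Num.sqrt r ^+ 3.

Lemma disc0_equidistributed (R : realType) (r : R) :
  equidistributed 2 (disc0 r).
Proof.
rewrite -[2](mulr1 2); apply: profile_equidistributed (integral_slice0 r).
  exact: slice0_profile.
exact: measurable_slice0.
Qed.

Lemma disc1_equidistributed (R : realType) (r : R) :
  equidistributed (2 * Num.sqrt (2 * Num.sqrt r)) (disc1 r).
Proof.
apply: profile_equidistributed (integral_slice1 r); first exact: slice1_profile.
exact: measurable_slice1.
Qed.

Lemma disc2_equidistributed (R : realType) (r : R) :
  equidistributed (2 * (2 * Num.sqrt r)) (disc2 r).
Proof.
apply: profile_equidistributed (integral_slice2 r); first exact: slice2_profile.
exact: measurable_slice2.
Qed.

Lemma disc0_neg (R : realType) (r x : R) : r < 0 -> disc0 r x = 0.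
Proof.
move=> r0; rewrite /disc0 ler0_sqrtr ?(ltW r0)// mulr0 subr0 /lattice_sum big1// => k _.
by rewrite /slice0 leNgt (lt_le_trans r0) ?sqr_ge0.
Qed.

Lemma disc1_neg (R : realType) (r x : R) : r < 0 -> disc1 r x = 0.
Proof.
move=> r0; rewrite /disc1 max_l ?(ltW r0)// mulr0 subr0 /lattice_sum big1// => k _.
by rewrite /slice1 ler0_sqrtr//; have := sqr_ge0 (k%:~R + x); lra.
Qed.

Lemma sum_int_range_le (R : realType) (G : int -> R) (T K : nat) :
  (T <= K)%N -> (forall x, G x != 0 -> (`|x| <= T)%N) ->
  \sum_(x <- int_range K) G x = \sum_(x <- int_range T) G x.
Proof.
move=> TK GT; apply: eq_sum_support; rewrite ?int_range_uniq// => x Gx.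
by rewrite !mem_int_range (GT _ Gx) (leq_trans (GT _ Gx) TK).
Qed.

Definition count2 (R : realType) (A D a t : R) (K : nat) : R :=
  \sum_(x <- int_range K) \sum_(y <- int_range K)
    (A * (y%:~R + a * x%:~R) ^+ 2 + D * x%:~R ^+ 2 <= t ^+ 2)%R%:R.

(** The slice of the ellipse at x has length 2 sqrt ((t^2 - D x^2) / A), which is 2 sqrt (D / A)
    times [slice1 (t ^+ 2 / D) x]; this is its integral over x. *)
Definition vol2 (R : realType) (A D t : R) : R :=
  2 * Num.sqrt (D / A) * (kappa1 R * (t ^+ 2 / D)).

(** The last term compares the sum of the slice lengths with the area. Its phase is 0 and no
    translation of [a] moves it, but as a single term of order t^(1/2) it is harmless. *)
Definition error2 (R : realType) (A D t : R) (T : nat) (a : R) : R :=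
  \sum_(x <- int_range T)
     disc0 ((t ^+ 2 - D * x%:~R ^+ 2) / A) (a * x%:~R) +
  2 * Num.sqrt (D / A) * disc1 (t ^+ 2 / D) 0.

(** For fixed x the count over y is the slice length plus [disc0], and the sum of the lengths over x
    is the area plus a multiple of [disc1]. Two ranges are needed: [K] has to contain all y and so
    may depend on [a], whereas [T] only bounds x, and the discrepancies vanish beyond it. *)
Lemma count2E (R : realType) (A D a t : R) (T K : nat) :
  0 < A -> 0 < D -> (T <= K)%N ->
  (forall x : int, D * x%:~R ^+ 2 <= t ^+ 2 -> (`|x| <= T)%N) ->
  (forall x y : int, A * (y%:~R + a * x%:~R) ^+ 2 + D * x%:~R ^+ 2 <= t ^+ 2 ->
     (`|y| <= K)%N) ->
  count2 A D a t K - vol2 A D t = error2 A D t T a.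
Proof.
move=> A0 D0 TK xT yK; pose rho (x : int) := (t ^+ 2 - D * x%:~R ^+ 2) / A.
have slice (x y : int) : (A * (y%:~R + a * x%:~R) ^+ 2 + D * x%:~R ^+ 2 <= t ^+ 2)%R%:R =
    slice0 (rho x) (y%:~R + a * x%:~R) :> R.
  rewrite /slice0 /rho ler_pdivlMr// [_ * A]mulrC; congr ((nat_of_bool _)%:R).
  by apply/idP/idP => h; lra.
have -> : count2 A D a t K = \sum_(x <- int_range K)
   (disc0 (rho x) (a * x%:~R) + 2 * Num.sqrt (D / A) * slice1 (t ^+ 2 / D) (x%:~R + 0)).
  apply: eq_bigr => x _; under eq_bigr do rewrite slice.
  rewrite -(@lattice_sumE _ (Num.sqrt (rho x))) ?int_range_uniq//; last 2 first.
  - by have [] := slice0_profile (rho x).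
  - move=> k; rewrite mem_int_range -slice pnatr_eq0 eqb0 negbK; exact: yK.
  rewrite /disc0 addr0 -mulrA /slice1 -sqrtrM ?divr_ge0 ?ltW//.
  rewrite (_ : D / A * _ = rho x) ?subrK//.
  by rewrite /rho; field; rewrite !gt_eqF.
rewrite big_split /= -mulr_sumr /error2 -addrA; congr (_ + _).
  apply: sum_int_range_le => // x; apply: contraNT; rewrite -ltnNge => Tx.
  rewrite disc0_neg// /rho ltr_pdivrMr// mul0r subr_lt0 ltNge.
  by apply/negP => /xT; rewrite leqNgt Tx.
rewrite -(@lattice_sumE _ (Num.sqrt (t ^+ 2 / D))) ?int_range_uniq//; last 2 first.
- by have [] := slice1_profile (t ^+ 2 / D).
- move=> k; rewrite mem_int_range addr0 /slice1 => k0; apply: leq_trans TK; apply: xT.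
  rewrite leNgt; apply: contraNN k0 => k0; rewrite ler0_sqrtr// subr_le0.
  by rewrite ler_pdivrMr// mulrC ltW.
rewrite /vol2 -mulrBr; congr (_ * (_ - _ * _)).
by rewrite max_r// divr_ge0 ?sqr_ge0 ?ltW.
Qed.

Lemma mean_error2 (R : realType) (A D t a : R) (T N : nat) :
  divisible_upto N (2 * T ^ 3 * ((2 * T).+1 * (2 * 0).+1)) ->
  torsion_sum N (fun u _ => error2 A D t T (a + u) ^+ 2) <=
  N%:R ^+ 2 * (2 * (2 ^+ 2 * (2 * T).+1%:R * (4 + 4 * harmonic_sum R T ^+ 2)) +
   2 * (2 * Num.sqrt (D / A) * (2 * Num.sqrt (2 * Num.sqrt (t ^+ 2 / D)))) ^+ 2).
Proof.
move=> divN.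
pose F (x y : int) (th : R) := disc0 ((t ^+ 2 - D * x%:~R ^+ 2) / A) (th + a * x%:~R).
have := @mean_square R 2 N T 0 F; rewrite maxn0 => /(_ divN) ms.
have {}ms := ms (fun x y => equidistributed_shift _ (disc0_equidistributed _)).
have := equidistributed_le 0 (disc1_equidistributed (t ^+ 2 / D)).
set d := disc1 _ _; set v := 2 * Num.sqrt (2 * _) => dv.
set e := 2 * Num.sqrt (D / A).
have e0 : 0 <= e by rewrite mulr_ge0 ?sqrtr_ge0.
have ed : (e * d) ^+ 2 <= (e * v) ^+ 2.
  have v0 : 0 <= v by exact: le_trans dv.
  rewrite -[(e * d) ^+ 2]real_normK ?num_real// ler_pXn2r ?nnegrE ?(mulr_ge0 e0 v0)//.
  by rewrite normrM (ger0_norm e0) ler_wpM2l.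
set P := torsion_sum _ _ in ms.
apply: (@le_trans _ _ (2 * P + N%:R ^+ 2 * (2 * (e * v) ^+ 2))).
  have -> : N%:R ^+ 2 * (2 * (e * v) ^+ 2) = \sum_(i < N) \sum_(j < N) (2 * (e * v) ^+ 2).
    by rewrite !sumr_const !card_ord -mulrnA -[RHS]mulr_natr natrM; ring.
  rewrite /P /torsion_sum mulr_sumr -big_split /=; apply: ler_sum => i _.
  rewrite mulr_sumr -big_split /=; apply: ler_sum => j _.
  rewrite /error2 -/e -/d; set s := \sum_(x <- _) _; set s' := \sum_(x <- _) _.
  have -> : s = s'.
    apply: eq_bigr => x _; rewrite /= big_cons big_nil addr0 /F; congr disc0.
    by rewrite mul0r addr0 mulrDl addrC [x%:~R * _]mulrC.
  by have := sqr_ge0 (s' - e * d); move: ed; nra.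
rewrite mulrDr lerD2r; move: ms; rewrite muln0 muln1 => ms.
by move: ms; nra.
Qed.

Definition count3 (R : realType) (A B D a b c t : R) (K : nat) : R :=
  \sum_(x <- int_range K) \sum_(y <- int_range K) \sum_(z <- int_range K)
    (A * (z%:~R + (a * x%:~R + b * y%:~R)) ^+ 2 +
     B * (y%:~R + c * x%:~R) ^+ 2 + D * x%:~R ^+ 2 <= t ^+ 2)%R%:R.

Definition vol3 (R : realType) (A B D t : R) : R :=
  2 * Num.sqrt (B / A) *
    (kappa1 R * (D / B) * (kappa2 R * Num.sqrt (t ^+ 2 / D) ^+ 3)).

(** Counting over z leaves lengths, proportional to [slice1] in y; summing these over y leaves
    areas, proportional to [slice2] in x; summing these over x leaves the volume. Each of the three
    passages contributes its discrepancy. *)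
Definition error3 (R : realType) (A B D t : R) (T : nat) (a b c : R) : R :=
  \sum_(x <- int_range T) \sum_(y <- int_range T)
     disc0 ((t ^+ 2 - D * x%:~R ^+ 2 - B * (y%:~R + c * x%:~R) ^+ 2) / A)
           (a * x%:~R + b * y%:~R) +
  2 * Num.sqrt (B / A) *
    (\sum_(x <- int_range T) disc1 ((t ^+ 2 - D * x%:~R ^+ 2) / B) (c * x%:~R) +
     kappa1 R * (D / B) * disc2 (t ^+ 2 / D) 0).

Lemma count3E (R : realType) (A B D a b c t : R) (T K : nat) :
  0 < A -> 0 < B -> 0 < D -> (T <= K)%N ->
  (forall x : int, D * x%:~R ^+ 2 <= t ^+ 2 -> (`|x| <= T)%N) ->
  (forall x y : int, B * (y%:~R + c * x%:~R) ^+ 2 + D * x%:~R ^+ 2 <= t ^+ 2 ->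
     (`|y| <= T)%N) ->
  (forall x y z : int, A * (z%:~R + (a * x%:~R + b * y%:~R)) ^+ 2 +
     B * (y%:~R + c * x%:~R) ^+ 2 + D * x%:~R ^+ 2 <= t ^+ 2 -> (`|z| <= K)%N) ->
  count3 A B D a b c t K - vol3 A B D t = error3 A B D t T a b c.
Proof.
move=> A0 B0 D0 TK xT yT zK.
pose h (x : int) := (t ^+ 2 - D * x%:~R ^+ 2) / B.
pose rho (x y : int) := (t ^+ 2 - D * x%:~R ^+ 2 - B * (y%:~R + c * x%:~R) ^+ 2) / A.
have slice (x y z : int) : (A * (z%:~R + (a * x%:~R + b * y%:~R)) ^+ 2 +
     B * (y%:~R + c * x%:~R) ^+ 2 + D * x%:~R ^+ 2 <= t ^+ 2)%R%:R =
    slice0 (rho x y) (z%:~R + (a * x%:~R + b * y%:~R)) :> R.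
  rewrite /slice0 /rho ler_pdivlMr// [_ * A]mulrC; congr ((nat_of_bool _)%:R).
  by apply/idP/idP => ?; lra.
have xK (x : int) : t ^+ 2 - D * x%:~R ^+ 2 >= 0 -> (`|x| <= T)%N.
  by rewrite subr_ge0; exact: xT.
have yK (x y : int) : t ^+ 2 - D * x%:~R ^+ 2 - B * (y%:~R + c * x%:~R) ^+ 2 >= 0 -> (`|y| <= T)%N.
  by move=> ?; apply: (yT x); lra.
have -> : count3 A B D a b c t K = \sum_(x <- int_range K) \sum_(y <- int_range K)
   (disc0 (rho x y) (a * x%:~R + b * y%:~R) +
    2 * Num.sqrt (B / A) * slice1 (h x) (y%:~R + c * x%:~R)).
  apply: eq_bigr => x _; apply: eq_bigr => y _; under eq_bigr do rewrite slice.
  rewrite -(@lattice_sumE _ (Num.sqrt (rho x y))) ?int_range_uniq//; last 2 first.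
  - by have [] := slice0_profile (rho x y).
  - move=> k; rewrite mem_int_range -slice pnatr_eq0 eqb0 negbK; exact: zK.
  rewrite /disc0 -mulrA /slice1 -sqrtrM ?divr_ge0 ?ltW//.
  rewrite (_ : B / A * _ = rho x y) ?subrK//.
  by rewrite /rho /h; field; rewrite !gt_eqF.
have -> : \sum_(x <- int_range K) \sum_(y <- int_range K)
   (disc0 (rho x y) (a * x%:~R + b * y%:~R) +
    2 * Num.sqrt (B / A) * slice1 (h x) (y%:~R + c * x%:~R)) =
  \sum_(x <- int_range K) ((\sum_(y <- int_range T) disc0 (rho x y) (a * x%:~R + b * y%:~R)) +
    2 * Num.sqrt (B / A) * (disc1 (h x) (c * x%:~R) + kappa1 R * (D / B) *
     slice2 (t ^+ 2 / D) (x%:~R + 0))).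
  apply: eq_bigr => x _; rewrite big_split /= -mulr_sumr; congr (_ + _ * _).
    apply: sum_int_range_le => // y; apply: contraNT; rewrite -ltnNge => Ty.
    rewrite disc0_neg// /rho ltr_pdivrMr// mul0r ltNge.
    by apply/negP => /yK; rewrite leqNgt Ty.
  rewrite -(@lattice_sumE _ (Num.sqrt (h x))) ?int_range_uniq//; last 2 first.
  - by have [] := slice1_profile (h x).
  - move=> y; rewrite mem_int_range /slice1 => y0; apply: leq_trans TK; apply: (@yK x).
    rewrite leNgt; apply: contraNN y0 => y0; rewrite ler0_sqrtr// subr_le0.
    by rewrite /h ler_pdivrMr// mulrC; lra.
  rewrite /disc1 -addrA -[LHS]addr0; congr (_ + _); rewrite -mulrA addrC -mulrBr.
  rewrite /slice2 maxr_pMr ?divr_ge0 ?ltW// mulr0 addr0 (_ : D / B * _ = h x) ?subrr ?mulr0//.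
  by rewrite /h; field; rewrite !gt_eqF.
rewrite big_split /= -mulr_sumr /error3 -addrA; congr (_ + _).
  apply: sum_int_range_le => // x; apply: contraNT; rewrite -ltnNge => Tx.
  rewrite big1// => y _.
  rewrite disc0_neg// /rho ltr_pdivrMr// mul0r.
  have : t ^+ 2 < D * x%:~R ^+ 2 by rewrite ltNge; apply/negP => /xT; rewrite leqNgt Tx.
  have : 0 <= B * (y%:~R + c * x%:~R) ^+ 2 by rewrite mulr_ge0 ?sqr_ge0 ?ltW.
  by lra.
rewrite /vol3 -mulrBr big_split /= -addrA; congr (_ * (_ + _)).
  apply: sum_int_range_le => // x; apply: contraNT; rewrite -ltnNge => Tx.
  rewrite disc1_neg// ltr_pdivrMr// mul0r ltNge.
  by apply/negP => /xK; rewrite leqNgt Tx.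
rewrite -mulr_sumr -mulrBr; congr (_ * _); rewrite /disc2; congr (_ - _).
rewrite -(@lattice_sumE _ (Num.sqrt (t ^+ 2 / D))) ?int_range_uniq//.
  by have [] := slice2_profile (t ^+ 2 / D).
move=> k; rewrite mem_int_range addr0 /slice2 => k0; apply: leq_trans TK; apply: xT.
rewrite leNgt; apply: contraNN k0 => k0; apply/eqP/max_idPl; rewrite subr_le0.
by rewrite ler_pdivrMr// mulrC ltW.
Qed.

(** The radii in the first sum depend on [c], so that sum is averaged over the translations of [a]
    and [b] at each fixed [c]; the second sum depends on [c] alone and is averaged over k. As the
    first bound is uniform in [a], the base point of [a] may be any function of the translation of
    [c], which the group action will require. *)
Lemma mean_error3 (R : realType) (A B D t b c : R) (a : R -> R) (T N : nat) :
  0 < B -> 0 < D ->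
  divisible_upto N (2 * T ^ 3 * ((2 * T).+1 * (2 * T).+1)) ->
  \sum_(k < N) torsion_sum N (fun u v =>
    error3 A B D t T (a (k%:R / N%:R) + u) (b + v) (c + k%:R / N%:R) ^+ 2) <=
  N%:R ^+ 3 * (3 * (2 ^+ 2 * ((2 * T).+1 * (2 * T).+1)%:R * (4 + 4 * harmonic_sum R T ^+ 2)) +
   (2 * Num.sqrt (B / A)) ^+ 2 *
     (3 * ((2 * Num.sqrt (2 * Num.sqrt (t ^+ 2 / B))) ^+ 2 * (2 * T).+1%:R *
        (4 + 4 * harmonic_sum R T ^+ 2)) +
      3 * (kappa1 R * (D / B) * (2 * (2 * Num.sqrt (t ^+ 2 / D)))) ^+ 2)).
Proof.
move=> B0 D0 divN; have N0 : (0 < N)%N by case: divN.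
set L := 4 + 4 * _; set M : R := ((2 * T).+1 * (2 * T).+1)%:R; set v1 := 2 * Num.sqrt (2 * _).
set e := 2 * Num.sqrt (B / A); set g := kappa1 R * _.
set v2 := g * _; set d := disc2 (t ^+ 2 / D) 0.
pose E1 (k : nat) (u v : R) := \sum_(x <- int_range T) \sum_(y <- int_range T)
     disc0 ((t ^+ 2 - D * x%:~R ^+ 2 - B * (y%:~R + (c + k%:R / N%:R) * x%:~R) ^+ 2) / A)
           ((a (k%:R / N%:R) + u) * x%:~R + (b + v) * y%:~R).
pose E2 (u : R) := \sum_(x <- int_range T)
   disc1 ((t ^+ 2 - D * x%:~R ^+ 2) / B) ((c + u) * x%:~R).
have ms1 (k : nat) : torsion_sum N (fun u v => E1 k u v ^+ 2) <= N%:R ^+ 2 * 2 ^+ 2 * M * L.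
  pose F (x y : int) (th : R) := disc0 ((t ^+ 2 - D * x%:~R ^+ 2 -
     B * (y%:~R + (c + k%:R / N%:R) * x%:~R) ^+ 2) / A)
      (th + (a (k%:R / N%:R) * x%:~R + b * y%:~R)).
  have ms := @mean_square R 2 N T T F; rewrite maxnn in ms.
  have {}ms := ms divN (fun x y => equidistributed_shift _ (disc0_equidistributed _)).
  apply: le_trans _ ms; rewrite le_eqVlt; apply/orP; left; apply/eqP.
  congr torsion_sum; apply/funext => u; apply/funext => v; congr (_ ^+ 2).
  apply: eq_bigr => x _; apply: eq_bigr => y _; rewrite /F; congr disc0; ring.
have ms2 : torsion_sum N (fun u _ => E2 u ^+ 2) <= N%:R ^+ 2 * v1 ^+ 2 * (2 * T).+1%:R * L.
  pose F (x y : int) (th : R) := disc1 ((t ^+ 2 - D * x%:~R ^+ 2) / B) (th + c * x%:~R).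
  have divN' : divisible_upto N (2 * T ^ 3 * ((2 * T).+1 * (2 * 0).+1)).
    split=> // m /andP[m0 mT]; case: divN => _; apply; rewrite m0 (leq_trans mT)//.
    by rewrite leq_mul2l leq_mul2l ltnS muln0 leq0n !orbT.
  have ms := @mean_square R v1 N T 0 F; rewrite maxn0 in ms.
  have {}ms := ms divN' _; rewrite muln0 muln1 in ms; apply: le_trans _ (ms _).
    rewrite le_eqVlt; apply/orP; left; apply/eqP.
    congr torsion_sum; apply/funext => u; apply/funext => v; congr (_ ^+ 2).
    apply: eq_bigr => x _; rewrite /= big_cons big_nil addr0 /F; congr disc1.
    by rewrite mul0r; ring.
  move=> x y; have := equidistributed_shift (c * x%:~R) (disc1_equidistributed ((t ^+ 2 - D * x%:~R ^+ 2) / B)).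
  move=> [? H]; split=> // m z m0; apply: le_trans (H m z m0) _.
  rewrite ler_wpM2l// ler_wsqrtr// ler_wpM2l// ler_wsqrtr// ler_wpM2r ?invr_ge0 ?(ltW B0)//.
  by rewrite gerBl mulr_ge0 ?sqr_ge0 ?ltW.
have D2 : (g * d) ^+ 2 <= v2 ^+ 2.
  have g0 : 0 <= g by rewrite !mulr_ge0 ?kappa1_ge0 ?invr_ge0 ?ltW.
  have dv := equidistributed_le 0 (disc2_equidistributed (t ^+ 2 / D)); rewrite -/d in dv.
  have v20 : 0 <= v2 by rewrite mulr_ge0// (le_trans _ dv).
  rewrite -[(g * d) ^+ 2]real_normK ?num_real// ler_pXn2r ?nnegrE//.
  by rewrite normrM (ger0_norm g0) ler_wpM2l.
have bound (k : 'I_N) : torsion_sum N (fun u v =>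
    error3 A B D t T (a (k%:R / N%:R) + u) (b + v) (c + k%:R / N%:R) ^+ 2) <=
    N%:R ^+ 2 * (3 * (2 ^+ 2 * M * L)) +
    N%:R ^+ 2 * (e ^+ 2 * (3 * E2 (k%:R / N%:R) ^+ 2 + 3 * v2 ^+ 2)).
  apply: (@le_trans _ _ (3 * torsion_sum N (fun u v => E1 k u v ^+ 2) +
     N%:R ^+ 2 * (e ^+ 2 * (3 * E2 (k%:R / N%:R) ^+ 2 + 3 * v2 ^+ 2)))); last first.
    by rewrite lerD2r; have := ms1 k; nra.
  set R2 := e ^+ 2 * _.
  have -> : N%:R ^+ 2 * R2 = \sum_(i < N) \sum_(j < N) R2.
    by rewrite !sumr_const !card_ord -mulrnA -[RHS]mulr_natr natrM; ring.
  rewrite /torsion_sum mulr_sumr -big_split /=; apply: ler_sum => i _.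
  rewrite mulr_sumr -big_split /=; apply: ler_sum => j _.
  rewrite /error3 -/e -/g -/d -/(E1 k _ _) -/(E2 _) /R2.
  set s1 := E1 _ _ _; set s2 := E2 _; set s3 := g * d.
  apply: (@le_trans _ _ (3 * s1 ^+ 2 + e ^+ 2 * (3 * s2 ^+ 2 + 3 * s3 ^+ 2))).
    have h1 := sqr_ge0 (s1 - e * s2); have h2 := sqr_ge0 (s1 - e * s3).
    have h3 := sqr_ge0 (e * s2 - e * s3).
    by rewrite -subr_ge0; lra.
  by rewrite lerD2l ler_wpM2l ?sqr_ge0// lerD2l ler_wpM2l.
apply: le_trans (ler_sum _ (fun k _ => bound k)) _.
rewrite big_split /= sumr_const card_ord -mulr_sumr -mulr_sumr big_split /= sumr_const card_ord.
rewrite -mulr_sumr; set S2 := \sum_(k < N) _.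
have N0' : 0 < N%:R :> R by rewrite ltr0n.
(* The extra factor N on the left is the sum over the dummy second variable of [torsion_sum]. *)
have S2E : S2 * N%:R <= N%:R ^+ 2 * v1 ^+ 2 * (2 * T).+1%:R * L.
  apply: le_trans ms2; rewrite /torsion_sum mulr_suml; apply: ler_sum => k _.
  by rewrite sumr_const card_ord mulr_natr.
have {}S2E : S2 <= N%:R * (v1 ^+ 2 * (2 * T).+1%:R * L).
  rewrite -(ler_pM2r N0'); apply: le_trans S2E _.
  by rewrite le_eqVlt; apply/orP; left; apply/eqP; ring.
have NN : 0 <= N%:R ^+ 2 * (e ^+ 2) by rewrite mulr_ge0 ?sqr_ge0.
have := ler_wpM2l NN S2E.
rewrite -[X in X + _ <= _]mulr_natr -[X in 3 * S2 + X]mulr_natr.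
by move=> h; rewrite -subr_ge0; move: h; rewrite -subr_ge0; lra.
Qed.

(** * Choice of the window and bounds uniform in the form *)

Lemma ln4_ge1 (R : realType) (t : R) : 4 <= t -> 1 <= ln t.
Proof.
move=> t4; have t0 : 0 < t by lra.
rewrite -ler_expR lnK ?posrE//; apply: le_trans t4.
(* Squaring this gives exp 1 <= 4, the origin of the threshold 4 for t. *)
have h : 2^-1 <= expR (- 2^-1) :> R by apply: le_trans (expR_ge1Dx _); lra.
have : expR 1 * (expR (- 2^-1) * expR (- 2^-1)) = 1 :> R.
  by rewrite -!expRD (_ : _ + _ = 0) ?expR0//; lra.
have : 4^-1 <= expR (- 2^-1) * expR (- 2^-1) :> R by nra.
have := expR_gt0 (1 : R); nra.
Qed.

(** [T] is a multiple of t rounded up. The factor 1 + M leaves room for |y| <= |y + c x| + |c| |x|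
    with |c| <= M, so that in dimension 3 the same [T] bounds both x and y. *)
Lemma window_size (R : realType) (e M : R) : 0 < e -> 0 <= M ->
  exists K0 K1 : R, [/\ 0 <= K0, 0 <= K1 & forall t, 4 <= t -> exists T : nat,
    [/\ t * (1 + M) <= Num.sqrt e * T%:R, (2 * T).+1%:R <= K0 * t &
        4 + 4 * harmonic_sum R T ^+ 2 <= K1 * ln t ^+ 2]].
Proof.
move=> e0 M0; have se0 : 0 < Num.sqrt e by rewrite sqrtr_gt0.
pose K := (1 + M) / Num.sqrt e + 1.
have K1 : 1 <= K by rewrite lerDr divr_ge0 ?addr_ge0 ?(ltW se0).
have lnK0 : 0 <= ln K by exact: ln_ge0.
exists (3 * K), (4 + 4 * (2 + ln K) ^+ 2); split; [lra| by rewrite addr_ge0// mulr_ge0 ?sqr_ge0|].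
move=> t t4; have t0 : 0 < t by lra.
have lt1 := ln4_ge1 t4.
pose s := (1 + M) / Num.sqrt e * t.
have s0 : 0 <= s by rewrite mulr_ge0 ?divr_ge0 ?addr_ge0 ?(ltW se0) ?(ltW t0).
exists (Num.truncn s).+1.
have sT : s < (Num.truncn s).+1%:R by exact: truncnS_gt.
have TK : (Num.truncn s).+1%:R <= K * t.
  by rewrite -natr1 /K mulrDl mul1r lerD ?truncn_le//; lra.
split.
- rewrite [leRHS]mulrC -ler_pdivrMr//; apply: le_trans (ltW sT).
  by rewrite /s le_eqVlt; apply/orP; left; apply/eqP; ring.
- rewrite -natr1 natrM; have : 1 <= (Num.truncn s).+1%:R :> R by rewrite ler1n.
  by move: TK; lra.
have hl := harmonic_sum_le R (Num.truncn s).
have h0 : 0 <= harmonic_sum R (Num.truncn s).+1 by apply: sumr_ge0 => i _; rewrite invr_ge0.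
have lT : ln (Num.truncn s).+1%:R <= ln K + ln t.
  by rewrite -lnM ?posrE//; [rewrite ler_ln ?posrE ?mulr_gt0//; lra|lra].
have : harmonic_sum R (Num.truncn s).+1 <= (2 + ln K) * ln t by nra.
move: h0; set h := harmonic_sum _ _ => h0 hle.
have : h ^+ 2 <= ((2 + ln K) * ln t) ^+ 2 by rewrite ler_pXn2r ?nnegrE// (le_trans h0).
rewrite exprMn; have : 1 <= ln t ^+ 2 by rewrite exprn_ege1.
by rewrite mulrDl; nra.
Qed.

Lemma window_le (R : realType) (e M t : R) (T : nat) (D x : R) : 0 < e -> 0 <= M -> 0 <= t ->
  t * (1 + M) <= Num.sqrt e * T%:R -> e <= D -> D * x ^+ 2 <= t ^+ 2 ->
  `|x| * (1 + M) <= T%:R.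
Proof.
move=> e0 M0 t0 tT eD Dx; have se0 : 0 < Num.sqrt e by rewrite sqrtr_gt0.
have xt : Num.sqrt e * `|x| <= t.
  rewrite -(ler_pXn2r (n := 2)) ?nnegrE ?mulr_ge0 ?(ltW se0)// exprMn sqr_sqrtr ?(ltW e0)//.
  rewrite real_normK ?num_real//; apply: le_trans Dx.
  by rewrite ler_wpM2r ?sqr_ge0.
rewrite -(ler_pM2l se0) mulrA; apply: le_trans tT.
by rewrite ler_wpM2r// addr_ge0.
Qed.

Lemma sqrt_div_le (R : realType) (e t D : R) : 0 < e -> 0 <= t -> e <= D ->
  Num.sqrt (t ^+ 2 / D) <= t / Num.sqrt e.
Proof.
move=> e0 t0 eD; have D0 : 0 < D by lra.
rewrite sqrtrM ?sqr_ge0// sqrtr_sqr ger0_norm// sqrtrV ?(ltW D0)//.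
rewrite ler_wpM2l// lef_pV2 ?posrE ?sqrtr_gt0//.
exact: ler_wsqrtr.
Qed.

(** The order of the quantifiers matters: [T] and [N] are chosen before [A], [D] and [a], so the
    translations do not depend on the lattice as long as it stays in a compact set. *)
Lemma mean_error2_le (R : realType) (e M : R) : 0 < e -> 0 <= M ->
  exists C : R, forall t, 4 <= t -> exists T N : nat,
    [/\ (0 < N)%N, t * (1 + M) <= Num.sqrt e * T%:R & forall A D a,
      e <= A -> e <= D <= M ->
      torsion_sum N (fun u _ => error2 A D t T (a + u) ^+ 2) <=
      N%:R ^+ 2 * (C * (t * ln t ^+ 2))].
Proof.
move=> e0 M0; have [K0 [K1 [K00 K10 H]]] := window_size e0 M0.
have se0 : 0 < Num.sqrt e by rewrite sqrtr_gt0.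
exists (8 * (K0 * K1) + 64 * (M / e / Num.sqrt e)) => t t4.
have [T [tT TK hK]] := H t t4; have t0 : 0 < t by lra.
have lt1 : 1 <= ln t ^+ 2 by rewrite exprn_ege1// ln4_ge1.
set N := (2 * T ^ 3 * ((2 * T).+1 * (2 * 0).+1))`!.
have divN := divisible_upto_fact (2 * T ^ 3 * ((2 * T).+1 * (2 * 0).+1)).
exists T, N; split => // [|A D a eA /andP[eD DM]]; first exact: fact_gt0.
apply: le_trans (mean_error2 _ _ _ _ divN) _; rewrite ler_wpM2l ?sqr_ge0//.
have A0 : 0 < A by lra.
have D0 : 0 < D by lra.
have h1 : (2 * T).+1%:R * (4 + 4 * harmonic_sum R T ^+ 2) <= (K0 * t) * (K1 * ln t ^+ 2).
  by apply: ler_pM => //; rewrite addr_ge0// mulr_ge0 ?sqr_ge0.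
have h2 : (2 * Num.sqrt (D / A) * (2 * Num.sqrt (2 * Num.sqrt (t ^+ 2 / D)))) ^+ 2 <=
    32 * (M / e / Num.sqrt e) * t.
  rewrite !exprMn !sqr_sqrtr ?mulr_ge0 ?invr_ge0 ?(ltW A0) ?(ltW D0)//.
  have h : D / A <= M / e by apply: ler_pM; rewrite ?invr_ge0 ?lef_pV2 ?posrE// ltW.
  have := sqrt_div_le e0 (ltW t0) eD; set q := Num.sqrt (_ / D) => hq.
  have : D / A * q <= M / e * (t / Num.sqrt e) by apply: ler_pM; rewrite ?divr_ge0 ?sqrtr_ge0 ?(ltW A0) ?(ltW D0).
  rewrite (_ : M / e * (t / Num.sqrt e) = M / e / Num.sqrt e * t); first by lra.
  by rewrite mulrCA mulrC.
have g0 : 0 <= M / e / Num.sqrt e * t by rewrite mulr_ge0 ?divr_ge0 ?(ltW e0) ?(ltW se0) ?(ltW t0).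
have h3 := ler_peMr g0 lt1.
by move: h1 h2 h3; lra.
Qed.

Lemma mean_error3_le (R : realType) (e M : R) : 0 < e -> 0 <= M ->
  exists C : R, forall t, 4 <= t -> exists T N : nat,
    [/\ (0 < N)%N, t * (1 + M) <= Num.sqrt e * T%:R & forall A B D b c (a : R -> R),
      e <= A -> e <= B <= M -> e <= D <= M ->
      \sum_(k < N) torsion_sum N (fun u v =>
        error3 A B D t T (a (k%:R / N%:R) + u) (b + v) (c + k%:R / N%:R) ^+ 2) <=
      N%:R ^+ 3 * (C * (t ^+ 2 * ln t ^+ 2))].
Proof.
move=> e0 M0; have [K0 [K1 [K00 K10 H]]] := window_size e0 M0.
have se0 : 0 < Num.sqrt e by rewrite sqrtr_gt0.
have Me0 : 0 <= M / e by rewrite divr_ge0 ?(ltW e0).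
pose q0 := (Num.sqrt e)^-1.
have q00 : 0 <= q0 by rewrite invr_ge0 ltW.
have k0 := kappa1_ge0 R.
pose C := 12 * (K0 ^+ 2 * K1) + 96 * (M / e) * (q0 * K0 * K1) +
    12 * (M / e) * (kappa1 R * (M / e) * (4 * q0)) ^+ 2.
exists C => t t4.
have [T [tT TK hK]] := H t t4; have t0 : 0 < t by lra.
have lt1 : 1 <= ln t ^+ 2 by rewrite exprn_ege1// ln4_ge1.
set N := (2 * T ^ 3 * ((2 * T).+1 * (2 * T).+1))`!.
have divN := divisible_upto_fact (2 * T ^ 3 * ((2 * T).+1 * (2 * T).+1)).
exists T, N; split => // [|A B D b c a eA /andP[eB BM] /andP[eD DM]]; first exact: fact_gt0.
have A0 : 0 < A by lra.
have B0 : 0 < B by lra.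
have D0 : 0 < D by lra.
apply: le_trans (@mean_error3 R A B D t b c a T N B0 D0 divN) _; rewrite ler_wpM2l ?exprn_ge0//.
have BA : 0 <= B / A <= M / e.
  by rewrite divr_ge0 ?(ltW A0) ?(ltW B0) ?(ltW D0)//=; apply: ler_pM; rewrite ?invr_ge0 ?lef_pV2 ?posrE// ltW.
have DB : 0 <= D / B <= M / e.
  by rewrite divr_ge0 ?(ltW A0) ?(ltW B0) ?(ltW D0)//=; apply: ler_pM; rewrite ?invr_ge0 ?lef_pV2 ?posrE// ltW.
have qB := sqrt_div_le e0 (ltW t0) eB; have qD := sqrt_div_le e0 (ltW t0) eD.
rewrite -/q0 in qB qD; have qB0 := sqrtr_ge0 (t ^+ 2 / B); have qD0 := sqrtr_ge0 (t ^+ 2 / D).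
set h := 4 + 4 * _ in hK *.
have h0 : 0 <= h by rewrite addr_ge0// mulr_ge0 ?sqr_ge0.
have T0 : 0 <= (2 * T).+1%:R :> R by [].
rewrite natrM -[X in 2 ^+ 2 * X]expr2.
rewrite (_ : (2 * Num.sqrt (B / A)) ^+ 2 = 4 * (B / A)); last first.
  by rewrite exprMn sqr_sqrtr; [ring|case/andP: BA].
rewrite (_ : (2 * Num.sqrt (2 * _)) ^+ 2 = 8 * Num.sqrt (t ^+ 2 / B)); last first.
  by rewrite exprMn sqr_sqrtr ?mulr_ge0//; ring.
set m := (2 * T).+1%:R in TK T0 *; set l := ln t ^+ 2 in lt1 hK *.
set x := B / A in BA *; set r := Num.sqrt (t ^+ 2 / B) in qB qB0 *.
set y := D / B in DB *; set s := Num.sqrt (t ^+ 2 / D) in qD qD0 *.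
have /andP[x0 xM] := BA; have /andP[y0 yM] := DB.
have p1 : m ^+ 2 * h <= (K0 * t) ^+ 2 * (K1 * l).
  by apply: ler_pM; rewrite ?sqr_ge0// ler_pXn2r ?nnegrE// (le_trans T0).
have p2 : x * (r * m * h) <= (M / e) * (t * q0 * (K0 * t) * (K1 * l)).
  by apply: ler_pM => //; rewrite ?mulr_ge0//; apply: ler_pM; rewrite ?mulr_ge0//; apply: ler_pM.
have p3 : x * (kappa1 R * y * (4 * s)) ^+ 2 <= (M / e) * (kappa1 R * (M / e) * (4 * (t * q0))) ^+ 2.
  apply: ler_pM; rewrite ?sqr_ge0// ler_pXn2r// ?nnegrE; last 2 first.
  - by rewrite mulr_ge0 ?(mulr_ge0 k0 y0)// mulr_ge0.
  - by rewrite mulr_ge0 ?(mulr_ge0 k0 Me0)// mulr_ge0// mulr_ge0 ?(ltW t0).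
  apply: ler_pM; [by rewrite mulr_ge0|by rewrite mulr_ge0|exact: ler_wpM2l k0 _ _ yM|].
  by rewrite ler_wpM2l.
have p4 : (M / e) * (kappa1 R * (M / e) * (4 * (t * q0))) ^+ 2 <=
  (M / e) * (kappa1 R * (M / e) * (4 * (t * q0))) ^+ 2 * l.
  by rewrite ler_peMr// mulr_ge0 ?sqr_ge0.
rewrite /C; clearbody m l x r y s h q0.
by move: p1 p2 p3 p4; set Me := M / e; clearbody Me; lra.
Qed.

(** * The coordinates of a lattice *)

Definition sqnorm (R : realType) (n : nat) (M : 'M[R]_n) (v : 'cV[R]_n) : R :=
  \sum_i ((M *m v) i 0) ^+ 2.

Lemma dilate_ball_of (R : realType) (n : nat) (X : GL R n) (t : R) : 0 < t ->
  dilate t (ball_of X) = [set v | sqnorm (glmx X) v <= t ^+ 2].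
Proof.
move=> t0; have uX := glmx_unit X.
apply/seteqP; split => v /=.
  move=> [_ [w /= w1 <-] <-]; rewrite /sqnorm -scalemxAr mulKVmx//.
  under eq_bigr do rewrite mxE exprMn; rewrite -mulr_sumr.
  by rewrite ler_piMr ?sqr_ge0.
move=> vt; exists (t^-1 *: v); last by rewrite scalerA divff ?gt_eqF// scale1r.
exists (glmx X *m (t^-1 *: v)); last by rewrite mulKmx.
rewrite /unit_ball /= -scalemxAr.
under eq_bigr do rewrite mxE exprMn; rewrite -mulr_sumr exprVn.
by rewrite ler_pdivrMl ?exprn_gt0// mulr1.
Qed.

Lemma dilate_unit_ball (R : realType) (n : nat) (t : R) : 0 < t ->
  dilate t (@unit_ball R n) = [set v | \sum_i v i 0 ^+ 2 <= t ^+ 2].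
Proof.
move=> t0; apply/seteqP; split => v /=.
  move=> [w w1 <-]; under eq_bigr do rewrite mxE exprMn; rewrite -mulr_sumr.
  by rewrite ler_piMr ?sqr_ge0.
move=> vt; exists (t^-1 *: v); last by rewrite scalerA divff ?gt_eqF// scale1r.
rewrite /unit_ball /=; under eq_bigr do rewrite mxE exprMn; rewrite -mulr_sumr exprVn.
by rewrite ler_pdivrMl ?exprn_gt0// mulr1.
Qed.

Lemma lattice_count_sum (R : realType) (n : nat) (X : GL R n) (t : R)
    (s : seq 'cV[int]_n) : 0 < t -> uniq s ->
  (forall z, sqnorm (glmx X) (map_mx intr z) <= t ^+ 2 -> z \in s) ->
  (lattice_count X t)%:R =
  \sum_(z <- s) (sqnorm (glmx X) (map_mx intr z) <= t ^+ 2)%R%:R :> R.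
Proof.
move=> t0 us hs.
set P := fun z => sqnorm (glmx X) (map_mx intr z) <= t ^+ 2.
have uX := glmx_unit X.
pose f (z : 'cV[int]_n) : 'cV[R]_n := glmx X *m map_mx intr z.
have injf : injective f.
  move=> z w /(congr1 (mulmx (invmx (glmx X)))); rewrite !mulKmx// => /matrixP zw.
  by apply/matrixP => i j; have := zw i j; rewrite !mxE => /intr_inj.
have SE : lattice_of X `&` dilate t (@unit_ball R n) =
    [set` [fset x in [seq f z | z <- s & P z]]%fset].
  rewrite dilate_unit_ball//; apply/seteqP; split => v /=.
    move=> [[z _ <-] zt]; rewrite in_fset_ /=; apply/mapP; exists z => //.
    by rewrite mem_filter; apply/andP; split => //; apply: hs.
  rewrite in_fset_ /= => /mapP[z]; rewrite mem_filter => /andP[Pz _] ->.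
  by split => //; exists z.
rewrite /lattice_count SE set_fsetK card_fseq undup_id; last first.
  by rewrite map_inj_uniq// filter_uniq.
rewrite size_map size_filter -sum1_count natr_sum big_mkcond /=.
by apply: eq_bigr => z _; rewrite -/(P z); case: (P z).
Qed.

(* Natural number indices let [ring] and [field] identify the entries of small
   matrices syntactically. *)
Definition entry (R : realType) (n : nat) (M : 'M[R]_n.+1) (i j : nat) : R :=
  M (inord i) (inord j).

Lemma entryE (R : realType) (n : nat) (M : 'M[R]_n.+1) (i j : 'I_n.+1) :
  M i j = entry M i j.
Proof. by rewrite /entry !inord_val. Qed.

Definition vec2 (T : Type) (x y : T) : 'cV[T]_2 :=
  \col_i (if i == 0 :> nat then x else y).
Definition vec3 (T : Type) (x y z : T) : 'cV[T]_3 :=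
  \col_i (if i == 0 :> nat then x else if i == 1 :> nat then y else z).

Lemma vec2_eta (T : Type) (v : 'cV[T]_2) :
  v = vec2 (v ord0 0) (v (lift ord0 ord0) 0).
Proof.
apply/colP => i; rewrite mxE; case: (unliftP ord0 i) => [j ->|-> //] /=.
by rewrite (ord1 j).
Qed.

Lemma vec3_eta (T : Type) (v : 'cV[T]_3) :
  v = vec3 (v ord0 0) (v (lift ord0 ord0) 0) (v (lift ord0 (lift ord0 ord0)) 0).
Proof.
apply/colP => i; rewrite mxE; case: (unliftP ord0 i) => [j ->|-> //] /=.
case: (unliftP ord0 j) => [k ->|-> //] /=.
by rewrite (ord1 k).
Qed.

Lemma map_vec2 (R : realType) (x y : int) :
  map_mx intr (vec2 x y) = vec2 x%:~R y%:~R :> 'cV[R]_2.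
Proof. by apply/colP => i; rewrite !mxE; case: ifP. Qed.

Lemma map_vec3 (R : realType) (x y z : int) :
  map_mx intr (vec3 x y z) = vec3 x%:~R y%:~R z%:~R :> 'cV[R]_3.
Proof. by apply/colP => i; rewrite !mxE; do 2?case: ifP. Qed.

Section Gram.
Variables (R : realType) (n : nat) (M : 'M[R]_n.+1).

Definition gram (j k : nat) : R :=
  \sum_(i < n.+1) entry M i j * entry M i k.

Lemma gram_ge0 j : 0 <= gram j j.
Proof. by apply: sumr_ge0 => i _; rewrite -expr2 sqr_ge0. Qed.

End Gram.

Lemma sqnorm_vec2 (R : realType) (M : 'M[R]_2) (x y : R) :
  sqnorm M (vec2 x y) =
  gram M 0 0 * x ^+ 2 + gram M 1 1 * y ^+ 2 + 2 * gram M 0 1 * x * y.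
Proof.
rewrite /sqnorm /gram !big_ord_recl !big_ord0 !mxE !big_ord_recl !big_ord0 !mxE /=.
by rewrite !entryE /=; ring.
Qed.

Lemma sqnorm_vec3 (R : realType) (M : 'M[R]_3) (x y z : R) :
  sqnorm M (vec3 x y z) =
  gram M 0 0 * x ^+ 2 + gram M 1 1 * y ^+ 2 + gram M 2 2 * z ^+ 2 +
  2 * gram M 0 1 * x * y + 2 * gram M 0 2 * x * z + 2 * gram M 1 2 * y * z.
Proof.
rewrite /sqnorm /gram !big_ord_recl !big_ord0 !mxE !big_ord_recl !big_ord0 !mxE /=.
by rewrite !entryE /=; ring.
Qed.

Lemma det2E (R : realType) (M : 'M[R]_2) :
  \det M = entry M 0 0 * entry M 1 1 - entry M 0 1 * entry M 1 0.
Proof.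
rewrite (expand_det_row _ ord0) !big_ord_recl big_ord0 /cofactor !det_mx11 !mxE.
by rewrite !entryE /=; ring.
Qed.

Lemma det3E (R : realType) (M : 'M[R]_3) :
  \det M =
  entry M 0 0 * (entry M 1 1 * entry M 2 2 - entry M 1 2 * entry M 2 1) -
  entry M 0 1 * (entry M 1 0 * entry M 2 2 - entry M 1 2 * entry M 2 0) +
  entry M 0 2 * (entry M 1 0 * entry M 2 1 - entry M 1 1 * entry M 2 0).
Proof.
rewrite (expand_det_row _ ord0) !big_ord_recl big_ord0 /cofactor.
rewrite !(expand_det_row _ ord0) !big_ord_recl !big_ord0 /cofactor !det_mx11 !mxE.
by rewrite !entryE /=; ring.
Qed.

Lemma gram_det2 (R : realType) (M : 'M[R]_2) :
  gram M 0 0 * gram M 1 1 - gram M 0 1 ^+ 2 = \det M ^+ 2.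
Proof. by rewrite det2E /gram !big_ord_recl !big_ord0 /=; ring. Qed.

Lemma gram_det3 (R : realType) (M : 'M[R]_3) :
  gram M 0 0 * (gram M 1 1 * gram M 2 2 - gram M 1 2 ^+ 2)
  - gram M 0 1 * (gram M 0 1 * gram M 2 2 - gram M 1 2 * gram M 0 2)
  + gram M 0 2 * (gram M 0 1 * gram M 1 2 - gram M 1 1 * gram M 0 2) = \det M ^+ 2.
Proof. by rewrite det3E /gram !big_ord_recl !big_ord0 /=; ring. Qed.

(** Lagrange's identity for the last two columns. The three minors are those of the expansion of the
    determinant along the first column, so they cannot all vanish when [M] is invertible. *)
Lemma gram_minor3 (R : realType) (M : 'M[R]_3) :
  gram M 1 1 * gram M 2 2 - gram M 1 2 ^+ 2 =
  (entry M 1 1 * entry M 2 2 - entry M 1 2 * entry M 2 1) ^+ 2 +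
  (entry M 0 1 * entry M 2 2 - entry M 0 2 * entry M 2 1) ^+ 2 +
  (entry M 0 1 * entry M 1 2 - entry M 0 2 * entry M 1 1) ^+ 2.
Proof. by rewrite /gram !big_ord_recl !big_ord0 /=; ring. Qed.

(* The coefficients obtained by completing squares, starting with the last
   variable; see [sqnorm_shape2] and [sqnorm_shape3]. *)
Definition shape2A (R : realType) (M : 'M[R]_2) := gram M 1 1.
Definition shape2a (R : realType) (M : 'M[R]_2) := gram M 0 1 / gram M 1 1.
Definition shape2D (R : realType) (M : 'M[R]_2) := \det M ^+ 2 / gram M 1 1.

Definition shape3A (R : realType) (M : 'M[R]_3) := gram M 2 2.
Definition shape3B (R : realType) (M : 'M[R]_3) :=
  (gram M 1 1 * gram M 2 2 - gram M 1 2 ^+ 2) / gram M 2 2.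
Definition shape3D (R : realType) (M : 'M[R]_3) :=
  \det M ^+ 2 / (gram M 1 1 * gram M 2 2 - gram M 1 2 ^+ 2).
Definition shape3a (R : realType) (M : 'M[R]_3) := gram M 0 2 / gram M 2 2.
Definition shape3b (R : realType) (M : 'M[R]_3) := gram M 1 2 / gram M 2 2.
Definition shape3c (R : realType) (M : 'M[R]_3) :=
  (gram M 0 1 * gram M 2 2 - gram M 0 2 * gram M 1 2) /
  (gram M 1 1 * gram M 2 2 - gram M 1 2 ^+ 2).

Lemma shape2A_gt0 (R : realType) (M : 'M[R]_2) : \det M != 0 -> 0 < gram M 1 1.
Proof.
rewrite lt0r gram_ge0 andbT; apply: contraNneq => g0; rewrite -sqrf_eq0.
have : \det M ^+ 2 <= 0 by rewrite -gram_det2 g0 mulr0 sub0r oppr_le0 sqr_ge0.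
by move=> h; rewrite eq_le h sqr_ge0.
Qed.

Lemma gram_minor_gt0 (R : realType) (M : 'M[R]_3) : \det M != 0 ->
  0 < gram M 1 1 * gram M 2 2 - gram M 1 2 ^+ 2.
Proof.
rewrite gram_minor3.
set p := entry M 1 1 * _ - _; set q := entry M 0 1 * _ - _; set r := _ - entry M 0 2 * entry M 1 1.
have p0 := sqr_ge0 p; have q0 := sqr_ge0 q; have r0 := sqr_ge0 r.
rewrite lt0r !addr_ge0// andbT; apply: contraNneq => /eqP.
rewrite !paddr_eq0 ?addr_ge0// !sqrf_eq0 => /andP[/andP[/eqP pz /eqP qz] /eqP rz].
have -> : \det M = entry M 0 0 * p - entry M 1 0 * q + entry M 2 0 * r.
  by rewrite det3E /p /q /r; ring.
by rewrite pz qz rz !mulr0 subr0 addr0.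
Qed.

Lemma shape3A_gt0 (R : realType) (M : 'M[R]_3) : \det M != 0 -> 0 < gram M 2 2.
Proof.
move=> /gram_minor_gt0; rewrite (lt0r (gram _ _ _)) gram_ge0 andbT; apply: contraTneq => ->.
by rewrite mulr0 sub0r -leNgt oppr_le0 sqr_ge0.
Qed.

Lemma sqnorm_shape2 (R : realType) (M : 'M[R]_2) (x y : R) : \det M != 0 ->
  sqnorm M (vec2 x y) =
  shape2A M * (y + shape2a M * x) ^+ 2 + shape2D M * x ^+ 2.
Proof.
move=> d0; have A0 := shape2A_gt0 d0.
rewrite sqnorm_vec2 /shape2A /shape2a /shape2D -gram_det2; field.
by rewrite gt_eqF.
Qed.

Lemma sqnorm_shape3 (R : realType) (M : 'M[R]_3) (x y z : R) : \det M != 0 ->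
  sqnorm M (vec3 x y z) =
  shape3A M * (z + (shape3a M * x + shape3b M * y)) ^+ 2 +
  shape3B M * (y + shape3c M * x) ^+ 2 + shape3D M * x ^+ 2.
Proof.
move=> d0; have A0 := shape3A_gt0 d0; have B0 := gram_minor_gt0 d0.
rewrite sqnorm_vec3 /shape3A /shape3B /shape3D /shape3a /shape3b /shape3c -gram_det3; field.
by rewrite !gt_eqF.
Qed.

Lemma glmx_det (R : realType) (n : nat) (X : GL R n) : \det (glmx X) != 0.
Proof. by have := glmx_unit X; rewrite unitmxE unitfE. Qed.

(** * Volumes of ellipsoids as iterated integrals *)

Lemma col_mx_ord0 (R : realType) (n : nat) (x : R) (v : 'cV[R]_n) :
  (col_mx (x%:M : 'cV_1) v) (ord0 : 'I_n.+1) 0 = x.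
Proof.
rewrite (_ : ord0 = lshift n (0 : 'I_1)); last exact: val_inj.
by rewrite col_mxEu mxE mulr1n.
Qed.

Lemma col_mx_lift (R : realType) (n : nat) (x : R) (v : 'cV[R]_n) (i : 'I_n) :
  (col_mx (x%:M : 'cV_1) v) (lift (ord0 : 'I_n.+1) i) 0 = v i 0.
Proof.
rewrite (_ : lift ord0 i = rshift 1 i); last exact: val_inj.
by rewrite col_mxEd.
Qed.

Lemma col_mx_vec2 (R : realType) (x y : R) (v : 'cV[R]_0) :
  col_mx (x%:M : 'cV_1) (col_mx (y%:M : 'cV_1) v) = vec2 x y :> 'cV[R]_2.
Proof. by rewrite [LHS]vec2_eta col_mx_ord0 col_mx_lift col_mx_ord0. Qed.

Lemma col_mx_vec3 (R : realType) (x y z : R) (v : 'cV[R]_0) :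
  col_mx (x%:M : 'cV_1) (col_mx (y%:M : 'cV_1) (col_mx (z%:M : 'cV_1) v)) =
  vec3 x y z :> 'cV[R]_3.
Proof.
by rewrite [LHS]vec3_eta col_mx_ord0 !col_mx_lift !col_mx_ord0.
Qed.

Lemma integral_slice0_shift (R : realType) (A c s : R) : 0 < A ->
  (\int[@lebesgue_measure R]_z ((A * (z + c) ^+ 2 <= s)%R%:R)%:E)%E =
  (2 * Num.sqrt (s / A))%:E.
Proof.
move=> A0; rewrite -integral_slice0 [RHS](@integral_affine _ 1 c)//.
- rewrite mul1e; apply: eq_integral => z _; rewrite mul1r /slice0.
  by rewrite ler_pdivlMr// mulrC.
- by apply/measurable_EFinP; exact: measurable_slice0.
- by move=> u; rewrite lee_fin.
Qed.

(** [vol] integrates over the last coordinate innermost, the one in which the square was completed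
    first. The shift [a * x] then disappears by translation invariance of the inner integral. *)
Lemma vol_ellipse (R : realType) (X : GL R 2) (t : R) : 0 < t ->
  vol (dilate t (ball_of X)) = (vol2 (shape2A (glmx X)) (shape2D (glmx X)) t)%:E.
Proof.
move=> t0; have d0 := glmx_det X; rewrite dilate_ball_of//=.
set A := shape2A _; set D := shape2D _; set a := shape2a (glmx X).
have A0 : 0 < A by exact: shape2A_gt0.
have D0 : 0 < D by rewrite divr_gt0// exprn_even_gt0.
transitivity (\int[@lebesgue_measure R]_x
   \int[@lebesgue_measure R]_y ((A * (y + a * x) ^+ 2 <= t ^+ 2 - D * x ^+ 2)%R%:R)%:E)%E.
  apply: eq_integral => x _; apply: eq_integral => y _.
  rewrite indicE; congr ((nat_of_bool _)%:R)%:E.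
  by apply/idP/idP; rewrite inE /= col_mx_vec2 sqnorm_shape2// lerBrDr.
clearbody A D a.
under eq_integral do rewrite integral_slice0_shift//.
transitivity (\int[@lebesgue_measure R]_x
   ((2 * Num.sqrt (D / A))%:E * (slice1 (t ^+ 2 / D) x)%:E))%E.
  apply: eq_integral => x _; rewrite -EFinM /slice1 -mulrA -sqrtrM ?divr_ge0 ?ltW//.
  by congr (2 * Num.sqrt _)%:E; field; rewrite !gt_eqF.
rewrite ge0_integralZl//=.
- rewrite integral_slice1 /vol2 -EFinM max_r// divr_ge0 ?sqr_ge0 ?ltW//.
- by apply/measurable_EFinP; exact: measurable_slice1.
- by move=> x _; rewrite lee_fin sqrtr_ge0.
Qed.

Lemma vol_ellipsoid (R : realType) (X : GL R 3) (t : R) : 0 < t ->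
  vol (dilate t (ball_of X)) =
  (vol3 (shape3A (glmx X)) (shape3B (glmx X)) (shape3D (glmx X)) t)%:E.
Proof.
move=> t0; have d0 := glmx_det X; rewrite dilate_ball_of//=.
set A := shape3A _; set B := shape3B _; set D := shape3D _.
set a := shape3a (glmx X); set b := shape3b (glmx X); set c := shape3c (glmx X).
have A0 : 0 < A by exact: shape3A_gt0.
have B0 : 0 < B by rewrite divr_gt0// gram_minor_gt0.
have D0 : 0 < D by rewrite divr_gt0 ?gram_minor_gt0// exprn_even_gt0.
transitivity (\int[@lebesgue_measure R]_x \int[@lebesgue_measure R]_y
   \int[@lebesgue_measure R]_z ((A * (z + (a * x + b * y)) ^+ 2 <=
      t ^+ 2 - D * x ^+ 2 - B * (y + c * x) ^+ 2)%R%:R)%:E)%E.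
  apply: eq_integral => x _; apply: eq_integral => y _; apply: eq_integral => z _.
  rewrite indicE; congr ((nat_of_bool _)%:R)%:E.
  by apply/idP/idP; rewrite inE /= col_mx_vec3 sqnorm_shape3//= -/A -/B -/D -/a -/b -/c; clearbody A B D a b c; lra.
clearbody A B D a b c.
under eq_integral do under eq_integral do rewrite integral_slice0_shift//.
transitivity (\int[@lebesgue_measure R]_x ((2 * Num.sqrt (B / A) * (kappa1 R * (D / B)))%:E *
    (slice2 (t ^+ 2 / D) x)%:E))%E.
  apply: eq_integral => x _; set h := (t ^+ 2 - D * x ^+ 2) / B.
  transitivity (\int[@lebesgue_measure R]_y
     ((2 * Num.sqrt (B / A))%:E * (slice1 h (1 * y + c * x))%:E))%E.
    apply: eq_integral => y _; rewrite -EFinM /slice1 -mulrA -sqrtrM ?divr_ge0 ?ltW//.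
    by congr (2 * Num.sqrt _)%:E; rewrite /h; field; rewrite !gt_eqF.
  rewrite ge0_integralZl//=; last 2 first.
  - apply/measurable_EFinP; apply: measurableT_comp; first exact: measurable_slice1.
    by apply: measurable_funD => //; exact: measurable_funM.
  - by move=> y _; rewrite lee_fin sqrtr_ge0.
  have := integral_slice1 h; rewrite (@integral_affine _ 1 (c * x))//; last 2 first.
  - by apply/measurable_EFinP; exact: measurable_slice1.
  - by move=> y; rewrite lee_fin sqrtr_ge0.
  rewrite mul1e => ->; rewrite -!EFinM; congr EFin.
  rewrite -!mulrA; congr (_ * (_ * (_ * _))); rewrite /slice2 mulrA maxr_pMr ?divr_ge0 ?ltW// mulr0.
  by congr Num.max; rewrite /h; field; rewrite !gt_eqF.
rewrite ge0_integralZl//=.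
- by rewrite integral_slice2 /vol3 -EFinM !mulrA.
- by apply/measurable_EFinP; exact: measurable_slice2.
- by move=> x _; rewrite lee_fin le_max lexx.
- by rewrite lee_fin !mulr_ge0 ?sqrtr_ge0 ?kappa1_ge0 ?invr_ge0 ?(ltW B0) ?(ltW D0).
Qed.

Lemma norm_le_add_sqr (R : realType) (x : R) : `|x| <= 1 + x ^+ 2.
Proof.
have [x0|x0] := leP 0 x.
  by rewrite ger0_norm//; have := sqr_ge0 (x - 1); nra.
by rewrite ltr0_norm//; have := sqr_ge0 (x + 1); nra.
Qed.

Lemma shape2D_gt0 (R : realType) (X : GL R 2) : 0 < shape2D (glmx X).
Proof. by rewrite divr_gt0 ?shape2A_gt0 ?glmx_det// exprn_even_gt0 ?glmx_det. Qed.

Lemma shape3D_gt0 (R : realType) (X : GL R 3) : 0 < shape3D (glmx X).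
Proof. by rewrite divr_gt0 ?gram_minor_gt0 ?glmx_det// exprn_even_gt0 ?glmx_det. Qed.

Lemma shape3B_gt0 (R : realType) (X : GL R 3) : 0 < shape3B (glmx X).
Proof. by rewrite divr_gt0 ?shape3A_gt0 ?gram_minor_gt0 ?glmx_det. Qed.

Lemma lattice_error2E (R : realType) (X : GL R 2) (t : R) (T : nat) : 0 < t ->
  (forall x : int, shape2D (glmx X) * x%:~R ^+ 2 <= t ^+ 2 -> (`|x| <= T)%N) ->
  lattice_error X t =
  error2 (shape2A (glmx X)) (shape2D (glmx X)) t T (shape2a (glmx X)).
Proof.
move=> t0 xT; have d0 := glmx_det X.
set A := shape2A _; set D := shape2D _ in xT *; set a := shape2a _.
have A0 : 0 < A by exact: shape2A_gt0.
have D0 : 0 < D by exact: shape2D_gt0.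
have D0' x : 0 <= D * x ^+ 2 by rewrite mulr_ge0 ?sqr_ge0// ltW.
have A0' x : 0 <= A * x ^+ 2 by rewrite mulr_ge0 ?sqr_ge0// ltW.
(* A crude bound for |y|, from |y + a x| <= 1 + (y + a x)^2 <= 1 + t^2 / A and |x| <= T. Only
   finiteness matters, as [K] does not enter [error2]. *)
pose r := 1 + t ^+ 2 / A + `|a| * T%:R.
pose K := (T + Num.bound r)%N.
have r0 : 0 <= r by rewrite !addr_ge0// ?divr_ge0 ?sqr_ge0 ?(ltW A0)// mulr_ge0.
have TK : (T <= K)%N by rewrite leq_addr.
have yK (x y : int) : A * (y%:~R + a * x%:~R) ^+ 2 + D * x%:~R ^+ 2 <= t ^+ 2 -> (`|y| <= K)%N.
  move=> Q; have xT' : (`|x| <= T)%N by apply: xT; have := A0' (y%:~R + a * x%:~R); lra.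
  apply: leq_trans (leq_addl _ _); rewrite -(ler_nat R) natr_absz intr_norm.
  apply: le_trans (ltW (archi_boundP r0)).
  rewrite -[X in `|X|](addrK (a * x%:~R)) (le_trans (ler_normB _ _))// lerD//.
    apply: le_trans (norm_le_add_sqr _) _; rewrite lerD2l ler_pdivlMr// mulrC.
    by have := D0' x%:~R; lra.
  by rewrite normrM ler_wpM2l// -intr_norm -natr_absz ler_nat.
rewrite /lattice_error vol_ellipse//= -/A -/D -(count2E A0 D0 TK xT yK).
congr (_ - _).
rewrite (@lattice_count_sum _ _ _ _ [seq vec2 x y | x <- int_range K, y <- int_range K])//.
- rewrite big_allpairs_dep /=; apply: eq_bigr => x _; apply: eq_bigr => y _.
  by rewrite map_vec2 sqnorm_shape2.
- rewrite allpairs_uniq ?int_range_uniq// => -[x y] [z w] _ _ /= /colP h.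
  by have := h ord0; have := h (lift ord0 ord0); rewrite !mxE /= => -> ->.
move=> z; rewrite [z]vec2_eta map_vec2 sqnorm_shape2// => h.
apply/allpairsP; eexists (_, _); split; last by [].
  rewrite mem_int_range; apply: leq_trans TK; apply: xT.
  by move: h; rewrite -/A -/D -/a; have := A0' ((z (lift ord0 ord0) 0)%:~R + a * (z ord0 0)%:~R) => /=; lra.
by rewrite mem_int_range; apply: yK h.
Qed.

Lemma lattice_error3E (R : realType) (X : GL R 3) (t : R) (T : nat) : 0 < t ->
  (forall x : int, shape3D (glmx X) * x%:~R ^+ 2 <= t ^+ 2 -> (`|x| <= T)%N) ->
  (forall x y : int, shape3B (glmx X) * (y%:~R + shape3c (glmx X) * x%:~R) ^+ 2 +
     shape3D (glmx X) * x%:~R ^+ 2 <= t ^+ 2 -> (`|y| <= T)%N) ->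
  lattice_error X t =
  error3 (shape3A (glmx X)) (shape3B (glmx X)) (shape3D (glmx X)) t T
    (shape3a (glmx X)) (shape3b (glmx X)) (shape3c (glmx X)).
Proof.
move=> t0 xT yT; have d0 := glmx_det X.
set A := shape3A _; set B := shape3B _ in yT *; set D := shape3D _ in xT yT *.
set a := shape3a _; set b := shape3b _; set c := shape3c _ in yT *.
have A0 : 0 < A by exact: shape3A_gt0.
have B0 : 0 < B by exact: shape3B_gt0.
have D0 : 0 < D by exact: shape3D_gt0.
have D0' x : 0 <= D * x ^+ 2 by rewrite mulr_ge0 ?sqr_ge0// ltW.
have B0' x : 0 <= B * x ^+ 2 by rewrite mulr_ge0 ?sqr_ge0// ltW.
have A0' x : 0 <= A * x ^+ 2 by rewrite mulr_ge0 ?sqr_ge0// ltW.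
pose r := 1 + t ^+ 2 / A + (`|a| * T%:R + `|b| * T%:R).
pose K := (T + Num.bound r)%N.
have r0 : 0 <= r.
  by rewrite !addr_ge0// ?divr_ge0 ?sqr_ge0 ?(ltW A0)// mulr_ge0.
have TK : (T <= K)%N by rewrite leq_addr.
have zK (x y z : int) : A * (z%:~R + (a * x%:~R + b * y%:~R)) ^+ 2 +
    B * (y%:~R + c * x%:~R) ^+ 2 + D * x%:~R ^+ 2 <= t ^+ 2 -> (`|z| <= K)%N.
  move=> Q; have hA := A0' (z%:~R + (a * x%:~R + b * y%:~R)).
  have hB := B0' (y%:~R + c * x%:~R).
  have xT' : (`|x| <= T)%N by apply: xT; lra.
  have yT' : (`|y| <= T)%N by apply: (yT x); lra.
  apply: leq_trans (leq_addl _ _); rewrite -(ler_nat R) natr_absz intr_norm.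
  apply: le_trans (ltW (archi_boundP r0)).
  rewrite -[X in `|X|](addrK (a * x%:~R + b * y%:~R)) (le_trans (ler_normB _ _))// lerD//.
    apply: le_trans (norm_le_add_sqr _) _; rewrite lerD2l ler_pdivlMr// mulrC.
    by have := D0' x%:~R; lra.
  rewrite (le_trans (ler_normD _ _))// lerD//.
    by rewrite normrM ler_wpM2l// -intr_norm -natr_absz ler_nat.
  by rewrite normrM ler_wpM2l// -intr_norm -natr_absz ler_nat.
rewrite /lattice_error vol_ellipsoid//= -/A -/B -/D -(count3E A0 B0 D0 TK xT yT zK).
congr (_ - _).
rewrite (@lattice_count_sum _ _ _ _ [seq vec3 p.1 p.2 z |
   p <- [seq (x, y) | x <- int_range K, y <- int_range K], z <- int_range K])//.
- rewrite big_allpairs_dep big_allpairs_dep /=.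
  apply: eq_bigr => x _; apply: eq_bigr => y _; apply: eq_bigr => z _.
  by rewrite map_vec3 sqnorm_shape3.
- rewrite allpairs_uniq ?allpairs_uniq ?int_range_uniq//.
    by move=> [x y] [z w].
  move=> [[x y] z] [[x' y'] z'] _ _ /= /colP h.
  have := h ord0; have := h (lift ord0 ord0); have := h (lift ord0 (lift ord0 ord0)).
  by rewrite !mxE /= => -> -> ->.
move=> z; rewrite [z]vec3_eta map_vec3 sqnorm_shape3//.
set x1 := z ord0 0; set x2 := z (lift ord0 ord0) 0.
set x3 := z (lift ord0 (lift ord0 ord0)) 0 => h.
have h1 : (`|x1| <= K)%N.
  apply: leq_trans TK; apply: xT; apply: le_trans _ h; rewrite lerDr.
  by rewrite addr_ge0 ?A0' ?B0'.
have h2 : (`|x2| <= K)%N.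
  apply: leq_trans TK; apply: (yT x1); apply: le_trans _ h; rewrite lerD2r lerDr.
  exact: A0'.
have h3 : (`|x3| <= K)%N by apply: zK h.
apply/allpairsP; exists ((x1, x2), x3); split => //; rewrite ?mem_int_range//.
by apply/allpairsP; exists (x1, x2); rewrite !mem_int_range.
Qed.

(** * Unipotent matrices and their action on the coordinates *)

Definition uni2 (R : realType) (a : R) : 'M[R]_2 :=
  \matrix_(i < 2, j < 2)
    if i == j :> nat then 1 else if i == 1 :> nat then a else 0.
(** The substitution (x, y, z) -> (x, y + c x, z + a x + b y). Lower triangular matrices fit squares
    completed from the last variable on: they change the shears and keep the coefficients of the
    squares. *)
Definition uni3 (R : realType) (a b c : R) : 'M[R]_3 :=
  \matrix_(i < 3, j < 3)
    if i == j :> nat then 1 else if i == 1 :> nat then (if j == 0 :> nat then c else 0)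
    else if i == 2 :> nat then (if j == 0 :> nat then a else b) else 0.

Lemma uni2M (R : realType) (a a' : R) : uni2 a *m uni2 a' = uni2 (a + a').
Proof.
apply/matrixP => i j; rewrite !mxE !big_ord_recl big_ord0 !mxE /=.
by case: i => -[|[|//]] ? ; case: j => -[|[|//]] ? /=; ring.
Qed.

Lemma uni3M (R : realType) (a b c a' b' c' : R) :
  uni3 a b c *m uni3 a' b' c' = uni3 (a + b * c' + a') (b + b') (c + c').
Proof.
apply/matrixP => i j; rewrite !mxE !big_ord_recl big_ord0 !mxE /=.
by case: i => -[|[|[|//]]] ? ; case: j => -[|[|[|//]]] ? /=; ring.
Qed.

Lemma uni2_0 (R : realType) : uni2 0 = 1%:M :> 'M[R]_2.
Proof. by apply/matrixP => i j; rewrite !mxE -val_eqE; case: eqP => //= _; case: ifP. Qed.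

Lemma uni3_0 (R : realType) : uni3 0 0 0 = 1%:M :> 'M[R]_3.
Proof.
by apply/matrixP => i j; rewrite !mxE -val_eqE; case: eqP => //= _; do 3?case: ifP.
Qed.

Lemma uni2_unit (R : realType) (a : R) : uni2 a \in unitmx.
Proof. by have /mulmx1_unit[] : uni2 a *m uni2 (- a) = 1%:M by rewrite uni2M subrr uni2_0. Qed.

Lemma uni3_unit (R : realType) (a b c : R) : uni3 a b c \in unitmx.
Proof.
have /mulmx1_unit[]// : uni3 a b c *m uni3 (b * c - a) (- b) (- c) = 1%:M.
by rewrite uni3M !subrr (_ : _ + _ = 0) ?uni3_0//; ring.
Qed.

Lemma uni2V (R : realType) (a : R) : invmx (uni2 a) = uni2 (- a).
Proof.
by rewrite -[LHS]mulmx1 -uni2_0 -(subrr a) -uni2M mulKmx ?uni2_unit.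
Qed.

Lemma uni3V (R : realType) (a b c : R) :
  invmx (uni3 a b c) = uni3 (b * c - a) (- b) (- c).
Proof.
rewrite -[LHS]mulmx1 (_ : 1%:M = uni3 a b c *m uni3 (b * c - a) (- b) (- c)).
  by rewrite mulKmx ?uni3_unit.
by rewrite uni3M !subrr (_ : _ + _ = 0) ?uni3_0//; ring.
Qed.

(** Bounding the inverse as well keeps the determinant away from 0, so each box lies in a compact
    set. It also makes the family stable under inversion and, with a larger radius, under
    products. *)
Definition GLbox (R : realType) (n : nat) (M : R) : set (GL R n) :=
  [set X | forall i j, `|glmx X i j| <= M /\ `|invmx (glmx X) i j| <= M].

Definition guni2 (R : realType) (a : R) : GL R 2 := mkGL (uni2_unit a).
Definition guni3 (R : realType) (a b c : R) : GL R 3 := mkGL (uni3_unit a b c).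

Lemma guni2_box (R : realType) (a : R) : 0 <= a <= 1 -> GLbox 2 (guni2 a).
Proof.
move=> /andP[a0 a1] i j; rewrite /glmx /= uni2V !mxE; split.
  by case: ifP => _; [|case: ifP => _]; rewrite ?normr1 ?normr0 ?ger0_norm//; lra.
by case: ifP => _; [|case: ifP => _]; rewrite ?normr1 ?normr0 ?normrN ?ger0_norm//; lra.
Qed.

Lemma guni3_box (R : realType) (a b c : R) : 0 <= a <= 1 -> 0 <= b <= 1 ->
  0 <= c <= 1 -> GLbox 2 (guni3 a b c).
Proof.
move=> /andP[a0 a1] /andP[b0 b1] /andP[c0 c1] i j; rewrite /glmx /= uni3V !mxE; split.
  by do 5?[case: ifP => _]; rewrite ?normr1 ?normr0 ?ger0_norm//; lra.
have bc0 : 0 <= b * c by rewrite mulr_ge0.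
have bc1 : b * c <= 1 by rewrite mulr_ile1.
by do 5?[case: ifP => _]; rewrite ler_norml; lra.
Qed.

Lemma GLbox_mul (R : realType) (n : nat) (M N : R) (X Y : GL R n) :
  GLbox M X -> GLbox N Y -> GLbox (n%:R * (M * N)) (GLmul X Y).
Proof.
have sum_le (A B : 'M[R]_n) M' N' i j : (forall i j, `|A i j| <= M') ->
    (forall i j, `|B i j| <= N') -> `|(A *m B) i j| <= n%:R * (M' * N').
  move=> AM BN; rewrite mxE (le_trans (ler_norm_sum _ _ _))//.
  apply: (@le_trans _ _ (\sum_(k < n) M' * N')).
    by apply: ler_sum => k _; rewrite normrM ler_pM.
  by rewrite sumr_const card_ord mulr_natl.
move=> BX BY i j; rewrite /glmx /=; split.
  by apply: sum_le => k l; [have [] := BX k l|have [] := BY k l].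
have -> : invmx (glmx X *m glmx Y) = invmx (glmx Y) *m invmx (glmx X).
  have uX := glmx_unit X; have uY := glmx_unit Y.
  have uXY : glmx X *m glmx Y \in unitmx by rewrite unitmx_mul uX.
  rewrite -[RHS](mulKmx uXY) -[LHS]mulmx1; congr (_ *m _).
  by rewrite mulmxA -(mulmxA (glmx X)) mulmxV// mulmx1 mulmxV.
by rewrite (mulrC M); apply: sum_le => k l; [have [] := BY k l|have [] := BX k l].
Qed.

Lemma det_le (R : realType) (n : nat) (A : 'M[R]_n) (M : R) :
  (forall i j, `|A i j| <= M) -> `|\det A| <= n`!%:R * M ^+ n.
Proof.
move=> AM; rewrite /determinant (le_trans (ler_norm_sum _ _ _))//.
apply: (@le_trans _ _ (\sum_(s : 'S_n) M ^+ n)).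
  apply: ler_sum => s _; rewrite normrM normrX normrN1 expr1n mul1r normr_prod.
  by rewrite -[in leRHS](card_ord n) -prodr_const ler_prod// => i _; rewrite normr_ge0/=.
by rewrite sumr_const card_Sn mulr_natl.
Qed.

Lemma GLbox_det (R : realType) (n : nat) (M : R) (X : GL R n) : 0 < M -> GLbox M X ->
  (n`!%:R * M ^+ n)^-1 <= `|\det (glmx X)|.
Proof.
move=> M0 BX; have d0 := glmx_det X.
have : `|\det (invmx (glmx X))| <= n`!%:R * M ^+ n.
  by apply: det_le => i j; have [] := BX i j.
rewrite det_inv normfV => h.
have c0 : 0 < n`!%:R * M ^+ n by rewrite mulr_gt0 ?exprn_gt0// ltr0n fact_gt0.
by rewrite -[leRHS]invrK lef_pV2 ?posrE// invr_gt0 normr_gt0.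
Qed.

Lemma GLbox_gram (R : realType) (n : nat) (M : R) (X : GL R n.+1) (j : nat) :
  GLbox M X -> gram (glmx X) j j <= n.+1%:R * M ^+ 2.
Proof.
move=> BX; apply: (@le_trans _ _ (\sum_(i < n.+1) M ^+ 2)).
  apply: ler_sum => i _; rewrite -expr2 -real_normK ?num_real//.
  by rewrite ler_pXn2r ?nnegrE//; have [h _] := BX (inord i) (inord j); rewrite // (le_trans _ h).
by rewrite sumr_const card_ord mulr_natl.
Qed.

Lemma big_iota0 (R : realType) (N : nat) (F : nat -> R) :
  \sum_(i <- iota 0 N) F i = \sum_(i < N) F i.
Proof. by rewrite -(big_mkord xpredT F) /index_iota subn0. Qed.

Lemma entry_uni2 (R : realType) (M : 'M[R]_2) (a : R) (i : nat) :
  entry (M *m uni2 a) i 0 = entry M i 0 + a * entry M i 1 /\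
  entry (M *m uni2 a) i 1 = entry M i 1.
Proof.
rewrite /entry !mxE !big_ord_recl !big_ord0 !mxE !inordK//=.
by rewrite !entryE /entry /= !inord_val; split; ring.
Qed.

Lemma entry_uni3 (R : realType) (M : 'M[R]_3) (a b c : R) (i : nat) :
  [/\ entry (M *m uni3 a b c) i 0 = entry M i 0 + c * entry M i 1 + a * entry M i 2,
      entry (M *m uni3 a b c) i 1 = entry M i 1 + b * entry M i 2 &
      entry (M *m uni3 a b c) i 2 = entry M i 2].
Proof.
rewrite /entry !mxE !big_ord_recl !big_ord0 !mxE !inordK//=.
by rewrite !entryE /entry /= !inord_val; split; ring.
Qed.

Lemma det_uni2 (R : realType) (a : R) : \det (uni2 a) = 1.
Proof. by rewrite det2E /entry !mxE !inordK//=; ring. Qed.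

Lemma det_uni3 (R : realType) (a b c : R) : \det (uni3 a b c) = 1.
Proof. by rewrite det3E /entry !mxE !inordK//=; ring. Qed.

Lemma shape2_uni (R : realType) (M : 'M[R]_2) (a : R) : \det M != 0 ->
  [/\ shape2A (M *m uni2 a) = shape2A M, shape2D (M *m uni2 a) = shape2D M &
      shape2a (M *m uni2 a) = shape2a M + a].
Proof.
move=> d0; have A0 := shape2A_gt0 d0.
have g11 : gram (M *m uni2 a) 1 1 = gram M 1 1.
  by apply: eq_bigr => i _; have [_ ->] := entry_uni2 M a i.
have g01 : gram (M *m uni2 a) 0 1 = gram M 0 1 + a * gram M 1 1.
  rewrite /gram mulr_sumr -big_split /=; apply: eq_bigr => i _.
  by have [-> ->] := entry_uni2 M a i; ring.
rewrite /shape2A /shape2D /shape2a g11 g01 det_mulmx det_uni2 mulr1; split => //.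
by field; rewrite gt_eqF.
Qed.

Lemma shape3_uni (R : realType) (M : 'M[R]_3) (a b c : R) : \det M != 0 ->
  [/\ shape3A (M *m uni3 a b c) = shape3A M, shape3B (M *m uni3 a b c) = shape3B M &
      shape3D (M *m uni3 a b c) = shape3D M] /\
  [/\ shape3a (M *m uni3 a b c) = shape3a M + c * shape3b M + a,
      shape3b (M *m uni3 a b c) = shape3b M + b &
      shape3c (M *m uni3 a b c) = shape3c M + c].
Proof.
move=> d0; have A0 := shape3A_gt0 d0; have B0 := gram_minor_gt0 d0.
have e i := entry_uni3 M a b c i.
have g22 : gram (M *m uni3 a b c) 2 2 = gram M 2 2.
  by apply: eq_bigr => i _; have [_ _ ->] := e i.
have g12 : gram (M *m uni3 a b c) 1 2 = gram M 1 2 + b * gram M 2 2.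
  rewrite /gram mulr_sumr -big_split /=; apply: eq_bigr => i _.
  by have [_ -> ->] := e i; ring.
have g11 : gram (M *m uni3 a b c) 1 1 = gram M 1 1 + 2 * b * gram M 1 2 + b ^+ 2 * gram M 2 2.
  rewrite /gram !mulr_sumr -!big_split /=; apply: eq_bigr => i _.
  by have [_ -> _] := e i; ring.
have g02 : gram (M *m uni3 a b c) 0 2 = gram M 0 2 + c * gram M 1 2 + a * gram M 2 2.
  rewrite /gram !mulr_sumr -!big_split /=; apply: eq_bigr => i _.
  by have [-> _ ->] := e i; ring.
have g01 : gram (M *m uni3 a b c) 0 1 = gram M 0 1 + c * gram M 1 1 + a * gram M 1 2 +
   b * gram M 0 2 + b * c * gram M 1 2 + b * a * gram M 2 2.
  rewrite /gram !mulr_sumr -!big_split /=; apply: eq_bigr => i _.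
  by have [-> -> _] := e i; ring.
have minor : gram (M *m uni3 a b c) 1 1 * gram (M *m uni3 a b c) 2 2
   - gram (M *m uni3 a b c) 1 2 ^+ 2 = gram M 1 1 * gram M 2 2 - gram M 1 2 ^+ 2.
  by rewrite g11 g12 g22; ring.
rewrite /shape3A /shape3B /shape3D /shape3a /shape3b /shape3c minor g22 g12 g01 g02.
rewrite det_mulmx det_uni3 mulr1; split; split => //; field; by rewrite ?gt_eqF.
Qed.

(** The two coefficients have product det^2, which is bounded below on the box, and each is at most
    the value of the form at a basis vector. Hence each is bounded below as well. *)
Lemma shape2_bounds (R : realType) (M : R) : 0 < M ->
  exists e M1 : R, [/\ 0 < e, 0 <= M1 & forall X : GL R 2, GLbox M X ->
    e <= shape2A (glmx X) /\ e <= shape2D (glmx X) <= M1].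
Proof.
move=> M0; pose G : R := 2 * M ^+ 2; pose d : R := (2`!%:R * M ^+ 2)^-1.
have G0 : 0 < G by rewrite mulr_gt0// exprn_gt0.
have d0 : 0 < d by rewrite invr_gt0 mulr_gt0 ?exprn_gt0// ltr0n.
exists (d ^+ 2 / G), G; split; [by rewrite divr_gt0 ?exprn_gt0|exact: ltW|].
move=> X BX; have dX := glmx_det X; have A0 := shape2A_gt0 dX.
have D0 := shape2D_gt0 X.
have g0 : gram (glmx X) 0 0 <= G by exact: GLbox_gram.
have g1 : gram (glmx X) 1 1 <= G by exact: GLbox_gram.
have dd : d ^+ 2 <= \det (glmx X) ^+ 2.
  rewrite -[leRHS]real_normK ?num_real// ler_pXn2r ?nnegrE ?(ltW d0)//.
  exact: GLbox_det.
have ADd : shape2A (glmx X) * shape2D (glmx X) = \det (glmx X) ^+ 2.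
  by rewrite /shape2A /shape2D mulrCA divff ?mulr1// gt_eqF.
have DG : shape2D (glmx X) <= G.
  apply: le_trans _ g0.
  have : sqnorm (glmx X) (vec2 1 0) = gram (glmx X) 0 0 by rewrite sqnorm_vec2; ring.
  rewrite sqnorm_shape2// => <-; rewrite expr1n !mulr1 lerDr mulr_ge0 ?sqr_ge0//.
  exact: ltW.
split; last rewrite DG andbT.
  rewrite ler_pdivrMr//; apply: le_trans dd _; rewrite -ADd ler_wpM2l//; exact: ltW.
rewrite ler_pdivrMr//; apply: le_trans dd _; rewrite -ADd mulrC ler_wpM2l//; exact: ltW.
Qed.

(** As in dimension 2, with product A B D = det^2. Moreover B c^2 is at most the value of the form
    at the first basis vector, which bounds [shape3c] once B is bounded below. *)
Lemma shape3_bounds (R : realType) (M : R) : 0 < M ->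
  exists e M1 : R, [/\ 0 < e, 0 <= M1 & forall X : GL R 3, GLbox M X ->
    [/\ e <= shape3A (glmx X), e <= shape3B (glmx X) <= M1,
        e <= shape3D (glmx X) <= M1 & `|shape3c (glmx X)| <= M1]].
Proof.
move=> M0; pose G : R := 3 * M ^+ 2; pose d : R := (3`!%:R * M ^+ 3)^-1.
have G0 : 0 < G by rewrite mulr_gt0// exprn_gt0.
have d0 : 0 < d by rewrite invr_gt0 mulr_gt0 ?exprn_gt0// ltr0n.
pose e := d ^+ 2 / G ^+ 2.
have e0 : 0 < e by rewrite divr_gt0 ?exprn_gt0.
have Ge0 : 0 <= G / e by rewrite divr_ge0// ltW.
(* The term G bounds B and D, and 1 + G / e bounds |c| through |c| <= 1 + c^2. *)
exists e, (1 + G + G / e); split => //; first by rewrite !addr_ge0// ltW.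
move=> X BX; have dX := glmx_det X; have A0 := shape3A_gt0 dX.
have D0 := shape3D_gt0 X; have B0 := shape3B_gt0 X; have m0 := gram_minor_gt0 dX.
have g0 : gram (glmx X) 0 0 <= G by exact: GLbox_gram.
have g1 : gram (glmx X) 1 1 <= G by exact: GLbox_gram.
have g2 : gram (glmx X) 2 2 <= G by exact: GLbox_gram.
have dd : d ^+ 2 <= \det (glmx X) ^+ 2.
  rewrite -[leRHS]real_normK ?num_real// ler_pXn2r ?nnegrE ?(ltW d0)//.
  exact: GLbox_det.
have ADd : shape3A (glmx X) * shape3B (glmx X) * shape3D (glmx X) = \det (glmx X) ^+ 2.
  by rewrite /shape3A /shape3B /shape3D; field; rewrite !gt_eqF.
have q1 : shape3A (glmx X) * shape3a (glmx X) ^+ 2 +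
   shape3B (glmx X) * shape3c (glmx X) ^+ 2 + shape3D (glmx X) = gram (glmx X) 0 0.
  have -> : gram (glmx X) 0 0 = sqnorm (glmx X) (vec3 1 0 0) by rewrite sqnorm_vec3; ring.
  by rewrite sqnorm_shape3//; ring.
have q2 : shape3A (glmx X) * shape3b (glmx X) ^+ 2 + shape3B (glmx X) = gram (glmx X) 1 1.
  have -> : gram (glmx X) 1 1 = sqnorm (glmx X) (vec3 0 1 0) by rewrite sqnorm_vec3; ring.
  by rewrite sqnorm_shape3//; ring.
move: A0 B0 D0 g2 ADd q1 q2; rewrite -/(shape3A _).
move: (shape3A _) (shape3B _) (shape3D _) (shape3a _) (shape3b _) (shape3c _).
move=> A B D a b c A0 B0 D0 AG ADd q1 q2.
have Aa : 0 <= A * a ^+ 2 by rewrite mulr_ge0 ?sqr_ge0// ltW.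
have Ab : 0 <= A * b ^+ 2 by rewrite mulr_ge0 ?sqr_ge0// ltW.
have Bc : 0 <= B * c ^+ 2 by rewrite mulr_ge0 ?sqr_ge0// ltW.
have DG : D <= G by lra.
have BG : B <= G by lra.
have low (x y z : R) : 0 < x -> 0 < y -> 0 < z -> y <= G -> z <= G ->
    x * (y * z) = \det (glmx X) ^+ 2 -> e <= x.
  move=> x0 y0 z0 yG zG xyz; rewrite ler_pdivrMr ?exprn_gt0//.
  apply: le_trans dd _; rewrite -xyz ler_wpM2l ?(ltW x0)// expr2.
  by apply: ler_pM => //; exact: ltW.
have eB : e <= B by apply: (low B A D) => //; rewrite -ADd; ring.
split.
- by apply: (low A B D) => //; rewrite -ADd; ring.
- by rewrite eB; lra.
- by rewrite (low D A B)//; [lra|rewrite -ADd; ring].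
apply: le_trans (norm_le_add_sqr _) _.
have : c ^+ 2 <= G / e.
  rewrite ler_pdivlMr//; apply: (@le_trans _ _ (B * c ^+ 2)); last lra.
  by rewrite mulrC ler_wpM2r ?sqr_ge0.
by lra.
Qed.

Lemma mean_lattice_error2 (R : realType) (M : R) : 0 < M ->
  exists C : R, forall t, 4 <= t -> exists us : seq (GL R 2),
    [/\ (0 < size us)%N, forall u, u \in us -> GLbox 2 u & forall X, GLbox M X ->
      \sum_(u <- us) lattice_error (GLmul X u) t ^+ 2 <=
      (size us)%:R * (C * (t * ln t ^+ 2))].
Proof.
move=> M0; have [e [M1 [e0 M10 bnd]]] := shape2_bounds M0.
have [C HC] := mean_error2_le e0 M10.
exists C => t t4; have [T [N [N0 tT HN]]] := HC t t4.
have t0 : 0 < t by lra.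
exists [seq guni2 (i%:R / N%:R) | i <- iota 0 N]; rewrite size_map size_iota; split => //.
  move=> u /mapP[i]; rewrite mem_iota => /andP[_ iN] ->; apply: guni2_box.
  by rewrite divr_ge0//= ler_pdivrMr ?ltr0n// mul1r ler_nat ltnW.
move=> X BX; have [eA eD] := bnd X BX; have dX := glmx_det X.
have := HN _ _ (shape2a (glmx X)) eA eD.
have N0' : 0 < N%:R :> R by rewrite ltr0n.
have -> : torsion_sum N (fun u _ =>
    error2 (shape2A (glmx X)) (shape2D (glmx X)) t T (shape2a (glmx X) + u) ^+ 2) =
  N%:R * \sum_(u <- [seq guni2 (i%:R / N%:R) | i <- iota 0 N]) lattice_error (GLmul X u) t ^+ 2.
  rewrite /torsion_sum big_map big_iota0 mulr_sumr.
  apply: eq_bigr => i _; rewrite sumr_const card_ord -[LHS]mulr_natl; congr (_ * _ ^+ 2).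
  have [sA sD sa] := shape2_uni (i%:R / N%:R) dX.
  rewrite (@lattice_error2E _ _ _ T)//= ?sA ?sD ?sa// => x xt.
  have := window_le e0 M10 (ltW t0) tT (andP eD).1 xt.
  rewrite -intr_norm -natr_absz -(ler_nat R); apply: le_trans.
  by rewrite ler_peMr// lerDl.
by rewrite expr2 -mulrA ler_pM2l.
Qed.

Lemma mean_lattice_error3 (R : realType) (M : R) : 0 < M ->
  exists C : R, forall t, 4 <= t -> exists us : seq (GL R 3),
    [/\ (0 < size us)%N, forall u, u \in us -> GLbox 2 u & forall X, GLbox M X ->
      \sum_(u <- us) lattice_error (GLmul X u) t ^+ 2 <=
      (size us)%:R * (C * (t ^+ 2 * ln t ^+ 2))].
Proof.
move=> M0; have [e [M1 [e0 M10 bnd]]] := shape3_bounds M0.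
(* The window is taken for M1 + 1 because the translations k / N move [shape3c] by at most 1. *)
have M11 : 0 <= M1 + 1 by rewrite addr_ge0.
have [C HC] := mean_error3_le e0 M11.
exists C => t t4; have [T [N [N0 tT HN]]] := HC t t4.
have t0 : 0 < t by lra.
pose us : seq (GL R 3) := [seq guni3 (p.1%:R / N%:R) (p.2%:R / N%:R) (k%:R / N%:R) |
   k <- iota 0 N, p <- [seq (i, j) | i <- iota 0 N, j <- iota 0 N]].
have sus : size us = (N * (N * N))%N by rewrite !size_allpairs !size_iota.
exists us; rewrite sus; split => //.
- by rewrite !muln_gt0 N0.
- move=> u /allpairsP[[k p] /= [kN]] /allpairsP[[i j] /= [iN jN ->]] -> /=.
  have H m : m \in iota 0 N -> 0 <= (m%:R / N%:R : R) <= 1.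
    rewrite mem_iota => /andP[_ mN].
    by rewrite divr_ge0//= ler_pdivrMr ?ltr0n// mul1r ler_nat ltnW.
  by apply: guni3_box; apply: H.
move=> X BX; have [eA /andP[eB BM] /andP[eD DM] cM] := bnd X BX; have dX := glmx_det X.
(* The group is not commutative: translating c by w also translates a by w b. *)
pose a w := shape3a (glmx X) + w * shape3b (glmx X).
have B01 : e <= shape3B (glmx X) <= M1 + 1 by rewrite eB; lra.
have D01 : e <= shape3D (glmx X) <= M1 + 1 by rewrite eD; lra.
have := HN _ _ _ (shape3b (glmx X)) (shape3c (glmx X)) a eA B01 D01.
set S := \sum_(k < N) _; have -> : S = \sum_(u <- us) lattice_error (GLmul X u) t ^+ 2.
  rewrite /us big_allpairs_dep /= big_iota0.
  apply: eq_bigr => k _; rewrite big_allpairs_dep /= /torsion_sum.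
  rewrite big_iota0; apply: eq_bigr => i _.
  rewrite big_iota0; apply: eq_bigr => j _; congr (_ ^+ 2).
  have [[sA sB sD] [sa sb sc]] := shape3_uni (i%:R / N%:R) (j%:R / N%:R) (k%:R / N%:R) dX.
  have k01 : 0 <= (k%:R / N%:R : R) <= 1.
    by rewrite divr_ge0//= ler_pdivrMr ?ltr0n// mul1r ler_nat ltnW.
  rewrite (@lattice_error3E _ _ _ T)//= ?sA ?sB ?sD ?sa ?sb ?sc//.
    move=> x xt; have := window_le e0 M11 (ltW t0) tT eD xt.
    rewrite -intr_norm -natr_absz -(ler_nat R); apply: le_trans.
    by rewrite ler_peMr// lerDl.
  set c := shape3c _ + _ => x y Q.
  have c1 : `|c| <= M1 + 1.
    by rewrite (le_trans (ler_normD _ _))// lerD// ger0_norm; case/andP: k01.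
  have Dx : 0 <= shape3D (glmx X) * x%:~R ^+ 2 by rewrite mulr_ge0 ?sqr_ge0//; lra.
  have By : 0 <= shape3B (glmx X) * (y%:~R + c * x%:~R) ^+ 2 by rewrite mulr_ge0 ?sqr_ge0//; lra.
  have xT : `|x%:~R| * (1 + (M1 + 1)) <= T%:R :> R.
    by apply: (window_le e0 M11 (ltW t0) tT eD); lra.
  have yT : `|y%:~R + c * x%:~R| * (1 + (M1 + 1)) <= T%:R.
    by apply: (window_le e0 M11 (ltW t0) tT eB); lra.
  rewrite -(ler_nat R) natr_absz intr_norm.
  have M2 : 0 < 1 + (M1 + 1) by lra.
  rewrite -(ler_pM2r M2).
  apply: (@le_trans _ _ ((`|y%:~R + c * x%:~R| + (M1 + 1) * `|x%:~R|) * (1 + (M1 + 1)))).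
    rewrite ler_pM2r// -[X in `|X|](addrK (c * x%:~R)) (le_trans (ler_normB _ _))// lerD2l.
    by rewrite normrM ler_wpM2r.
  by have := ler_wpM2l M11 xT; move: yT; lra.
by rewrite !natrM -!expr2 -exprS.
Qed.

(** * Topology and Borel structure of GL_n *)

Lemma mx_continuous (R : realType) (T : topologicalType) (m n : nat)
    (f : T -> 'M[R]_(m, n)) :
  (forall i j, continuous (fun x => f x i j)) -> continuous f.
Proof.
move=> cf x A [P fP PA].
have : nbhs x [set y | forall ij : 'I_m * 'I_n, P ij.1 ij.2 (f y ij.1 ij.2)].
  apply: (@filter_forall _ _ (fun ij : 'I_m * 'I_n => [set y | P ij.1 ij.2 (f y ij.1 ij.2)])).
  by move=> [i j]; exact: (cf i j x _ (fP i j)).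
by apply: filterS => y /= Py; apply: PA => i j; exact: (Py (i, j)).
Qed.

Lemma det_continuous (R : realType) (T : topologicalType) (n : nat)
    (f : T -> 'M[R]_n) :
  (forall i j, continuous (fun x => f x i j)) -> continuous (fun x => \det (f x)).
Proof.
move=> cf; rewrite /determinant.
apply: continuous_big => [|s _]; first exact: add_continuous.
move=> x; apply: cvgM; first exact: cvg_cst.
apply: continuous_big => [|i _]; first exact: mul_continuous.
exact: cf.
Qed.

Lemma glmx_continuous (R : realType) (n : nat) : continuous (@glmx R n).
Proof. exact: initial_continuous. Qed.

Lemma entry_continuous (R : realType) (n : nat) (i j : 'I_n) :
  continuous (fun X : GL R n => glmx X i j).
Proof.
move=> X; apply: (@continuous_comp _ _ _ (@glmx R n) (fun M => M i j)).
  exact: glmx_continuous.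
exact: coord_continuous.
Qed.

Lemma into_GL_continuous (R : realType) (n : nat) (T : topologicalType) (f : T -> GL R n) :
  (forall i j, continuous (fun x => glmx (f x) i j)) -> continuous f.
Proof.
move=> cf; apply: continuous_comp_initial.
exact: (@mx_continuous _ _ _ _ (fun x => glmx (f x))).
Qed.

(** The lower bound on the determinant replaces the bound on the inverse: it is a closed condition
    on the space of all matrices, where compactness is bounded and closed. *)
Definition box_mx (R : realType) (n : nat) (M c : R) : set 'M[R]_n :=
  [set A : 'M[R]_n | (forall i j, `|A i j| <= M) /\ c <= `|\det A|].

Lemma box_mx_compact (R : realType) (n : nat) (M c : R) : compact (@box_mx R n M c).
Proof.
have h : compact ((@vec_mx R n n) @` [set v : 'rV[R]_(n * n) | forall i, `[- M, M]%classic (v ord0 i)]).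
  apply: continuous_compact; last first.
    by apply: (@rV_compact _ _ (fun=> `[- M, M]%classic)) => _; exact: segment_compact.
  apply: continuous_subspaceT; apply: mx_continuous => i j.
  rewrite (_ : (fun _ => _) = fun v : 'rV[R]_(n * n) => v ord0 (mxvec_index i j)).
    exact: coord_continuous.
  by apply/funext => v; rewrite mxE.
apply: subclosed_compact h _; last first.
  move=> A [AM _]; exists (mxvec A); last exact: mxvecK.
  move=> k; case/mxvec_indexP: k => i j; rewrite mxvecE /= in_itv /= -ler_norml.
  exact: AM.
rewrite (_ : @box_mx R n M c = (\bigcap_(ij : 'I_n * 'I_n) [set A : 'M[R]_n | `|A ij.1 ij.2| <= M]) `&` [set A : 'M[R]_n | c <= `|\det A|]).
  apply: closedI.
    apply: closed_bigI => -[i j] _.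
    apply: (@closed_comp _ _ (fun A : 'M[R]_n => `|A i j|) [set x | x <= M]); last exact: closed_le.
    by move=> A _; apply: continuous_comp; [exact: coord_continuous|exact: norm_continuous].
  apply: (@closed_comp _ _ (fun A : 'M[R]_n => `|\det A|) [set x | c <= x]); last exact: closed_ge.
  move=> A _; apply: continuous_comp; last exact: norm_continuous.
  by apply: det_continuous => i j; exact: coord_continuous.
apply/seteqP; split => A [].
  by move=> AM cA; split => // -[i j] _; exact: AM.
by move=> AM cA; split => // i j; exact: (AM (i, j)).
Qed.

Definition to_GL (R : realType) (n : nat) (A : 'M[R]_n) : GL R n :=
  if @idP (A \in unitmx) is ReflectT uA then mkGL uA else point.

Lemma glmx_to_GL (R : realType) (n : nat) (A : 'M[R]_n) : A \in unitmx ->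
  glmx (to_GL A) = A.
Proof. by rewrite /to_GL; case: {-}_ / idP. Qed.

Lemma glmx_inj (R : realType) (n : nat) : injective (@glmx R n).
Proof. exact: val_inj. Qed.

Definition GLcompact (R : realType) (n : nat) (M c : R) : set (GL R n) :=
  [set X | box_mx M c (glmx X)].

(** The image of a compact set of matrices under [to_GL]. Since GL_n carries the initial topology of
    [glmx], this map is continuous there as soon as its composite with [glmx] is, and that composite
    is the identity on the box. *)
Lemma GLcompact_compact (R : realType) (n : nat) (M c : R) : 0 < c ->
  compact (@GLcompact R n M c).
Proof.
move=> c0; have uA (A : 'M[R]_n) : box_mx M c A -> A \in unitmx.
  move=> [_ cA]; rewrite unitmxE unitfE -normr_gt0; exact: lt_le_trans cA.
have -> : @GLcompact R n M c = @to_GL R n @` box_mx M c.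
  apply/seteqP; split => [X BX|_ [A BA <-]].
    by exists (glmx X) => //; apply: glmx_inj; rewrite glmx_to_GL ?uA.
  by rewrite /GLcompact /= glmx_to_GL ?uA.
apply: continuous_compact; last exact: box_mx_compact.
have h : {within @box_mx R n M c, continuous (fun A => glmx (to_GL A))}.
  have hid : {within @box_mx R n M c, continuous (fun A : 'M[R]_n => A)}.
    by apply: continuous_subspaceT => x; exact: cvg_id.
  have e : {in @box_mx R n M c, (fun A : 'M[R]_n => A) =1 (fun A => glmx (to_GL A))}.
    by move=> A /set_mem BA /=; rewrite glmx_to_GL// uA.
  exact: subspace_eq_continuous e hid.
exact: continuous_comp_initial h.
Qed.

Lemma GLbox_sub_compact (R : realType) (n : nat) (M : R) : 0 < M ->
  @GLbox R n M `<=` GLcompact M (n`!%:R * M ^+ n)^-1.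
Proof. by move=> M0 X BX; split; [move=> i j; have [] := BX i j|exact: GLbox_det]. Qed.

(** The open counterpart of [GLbox]: an increasing open exhaustion of GL_n, suited to the extraction
    of finite subcovers. *)
Definition GLopen (R : realType) (n : nat) (M : R) : set (GL R n) :=
  [set X | (forall i j, `|glmx X i j| < M) /\ M^-1 < `|\det (glmx X)|].

Lemma GLopen_open (R : realType) (n : nat) (M : R) : open (@GLopen R n M).
Proof.
rewrite (_ : @GLopen R n M = [set X | forall ij : 'I_n * 'I_n, `|glmx X ij.1 ij.2| < M] `&`
   [set X | M^-1 < `|\det (glmx X)|]); last first.
  apply/seteqP; split => X [h d]; split => //.
  by move=> i j; exact: (h (i, j)).
apply: openI.
  rewrite openE => X /= XM.
  have h (ij : 'I_n * 'I_n) : nbhs X [set Y : GL R n | `|glmx Y ij.1 ij.2| < M].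
    have : open [set Y : GL R n | `|glmx Y ij.1 ij.2| < M].
      apply: (@open_comp _ _ (fun X : GL R n => `|glmx X ij.1 ij.2|) [set x | x < M]); last exact: open_lt.
      by move=> Y _; apply: continuous_comp; [exact: entry_continuous|exact: norm_continuous].
    by rewrite openE => /(_ X (XM ij)).
  exact: (@filter_forall _ _ _ (nbhs X) _ h).
apply: (@open_comp _ _ (fun X : GL R n => `|\det (glmx X)|) [set x | M^-1 < x]); last exact: open_gt.
move=> Y _; apply: (@continuous_comp _ _ _ (fun X : GL R n => \det (glmx X)) (fun x => `|x|)); last exact: norm_continuous.
by apply: det_continuous => i j; exact: entry_continuous.
Qed.

Lemma GLopen_cover (R : realType) (n : nat) (X : GL R n) :
  exists k : nat, GLopen k.+1%:R X.
Proof.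
have d0 := glmx_det X.
pose s := \sum_i \sum_j `|glmx X i j| + `|\det (glmx X)|^-1.
have s0 : 0 <= s by rewrite addr_ge0 ?invr_ge0// sumr_ge0// => i _; rewrite sumr_ge0.
exists (Num.bound s); have := archi_boundP s0 => sk.
have {}sk : s < (Num.bound s).+1%:R by rewrite -natr1; lra.
split.
  move=> i j; apply: le_lt_trans sk.
  rewrite /s (bigD1 i)//= (bigD1 j)//= -!addrA lerDl !addr_ge0 ?invr_ge0 ?sumr_ge0// => k _.
  by rewrite sumr_ge0.
rewrite -[ltRHS]invrK ltf_pV2 ?posrE ?ltr0n ?invr_gt0 ?normr_gt0//.
apply: le_lt_trans sk; rewrite /s lerDr sumr_ge0// => i _; exact: sumr_ge0.
Qed.

Lemma GLopen_sub_box (R : realType) (n : nat) (k : nat) :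
  exists2 M : R, 0 < M & @GLopen R n k.+1%:R `<=` GLbox M.
Proof.
set q : R := k.+1%:R; pose c : R := n.-1`!%:R * q ^+ n.-1.
have q0 : 0 < q by [].
have c0 : 0 <= c by rewrite mulr_ge0 ?exprn_ge0.
exists (q + q * c) => [|X [Xq dX] i j]; first by rewrite ltr_pwDl// mulr_ge0// ltW.
split; first by rewrite (le_trans (ltW (Xq i j)))// lerDl mulr_ge0// ltW.
rewrite /invmx glmx_unit !mxE normrM normfV /cofactor normrM normrX normrN1 expr1n mul1r.
apply: (@le_trans _ _ (q * c)); last by rewrite lerDr ltW.
apply: ler_pM; rewrite ?invr_ge0//.
  by rewrite -[leRHS]invrK lef_pV2 ?posrE ?invr_gt0 ?normr_gt0 ?glmx_det// ltW.
by apply: det_le => a b; rewrite !mxE ltW.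
Qed.

Lemma GLopenS (R : realType) (n : nat) (k l : nat) : (k <= l)%N ->
  @GLopen R n k.+1%:R `<=` GLopen l.+1%:R.
Proof.
move=> kl X [Xk dX]; split.
  by move=> i j; apply: lt_le_trans (Xk i j) _; rewrite ler_nat.
by apply: le_lt_trans dX; rewrite lef_pV2 ?posrE// ler_nat.
Qed.

(** * The quotient map onto the space of lattices *)

Lemma cosetP (R : realType) (n : nat) (X Y : GL R n) :
  coset X = coset Y <-> same_coset X Y.
Proof.
by split => [/(@eqquotP _ (same_coset_equiv R n))|h]; [|apply/(@eqquotP _ (same_coset_equiv R n))].
Qed.

Lemma entry_mulmx_continuous (R : realType) (n : nat) (i : 'I_n) (c : 'I_n -> R) :
  continuous (fun X : GL R n => \sum_k glmx X i k * c k).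
Proof.
apply: continuous_big => [|k _]; first exact: add_continuous.
by move=> Y; apply: (@cvgM _ _ (nbhs Y) (nbhs_filter Y)); [exact: entry_continuous|exact: cvg_cst].
Qed.

(** The saturation of [U] is the union, over V in GL_n(Z), of the preimages of [U] under right
    multiplication by V, which is continuous. *)
Lemma coset_image_open (R : realType) (n : nat) (U : set (GL R n)) : open U ->
  open (@coset R n @` U).
Proof.
move=> oU; rewrite /open /= /quotient_open.
pose r (V : 'M[int]_n) (X : GL R n) : GL R n := to_GL (glmx X *m map_mx intr V).
have glr V (X : GL R n) : V \in unitmx -> glmx (r V X) = glmx X *m map_mx intr V.
  move=> uV; rewrite /r glmx_to_GL// unitmx_mul glmx_unit /=.
  have /mulmx1_unit[]// : map_mx intr V *m map_mx intr (invmx V) = 1%:M :> 'M[R]_n.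
  by rewrite -map_mxM mulmxV// map_mx1.
rewrite (_ : _ @^-1` _ = \bigcup_(V in [set V : 'M[int]_n | V \in unitmx]) r V @^-1` U).
  apply: bigcup_open => V /= uV; apply: open_comp oU => X _.
  apply: into_GL_continuous => i j.
  rewrite (_ : (fun _ => _) = fun X => \sum_k glmx X i k * (V k j)%:~R).
    exact: entry_mulmx_continuous.
  apply/funext => Y; rewrite glr// mxE; apply: eq_bigr => k _; by rewrite !mxE.
apply/seteqP; split => X /=.
  move=> [Y UY /esym/cosetP/asboolP[V uV YX]]; exists V => //=.
  by rewrite (_ : r V X = Y)//; apply: glmx_inj; rewrite glr// YX.
move=> [V /= uV UX]; exists (r V X) => //; apply/esym/cosetP/asboolP.
by exists V => //; rewrite glr.
Qed.

(** The images of the open exhaustion cover [L]. They are open and increase with the index, so a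
    finite subcover reduces to its largest member. *)
Lemma compact_lattices_box (R : realType) (n : nat) (L : set (lattices R n)) :
  compact L -> exists2 M : R, 0 < M & L `<=` @coset R n @` GLbox M.
Proof.
rewrite compact_cover => /(_ nat setT (fun k => @coset R n @` GLopen k.+1%:R)).
move=> /(_ _ _)[||D _ LD].
- by move=> k _; apply: coset_image_open; exact: GLopen_open.
- move=> x _; have [k Xk] := GLopen_cover (repr x); exists k => //.
  by exists (repr x) => //; rewrite /coset reprK.
pose m := \max_(k <- enum_fset D) k.
have [M M0 MU] := GLopen_sub_box R n m.
exists M => // x /LD[k /= kD [X Xk <-]]; exists X => //; apply: MU.
by apply: GLopenS Xk; exact: leq_bigmax_seq.
Qed.

(** * Measurability of maps into GL_n *)

Lemma measurable_entry (R : realType) (n : nat) (i j : 'I_n) :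
  measurable_fun [set: borel (GL R n)] (fun X => glmx X i j).
Proof.
apply: (measurability _ (RGenOInfty.measurableE R)) => // _ [_ [x ->] <-].
rewrite setTI; apply: sub_sigma_algebra.
apply: (@open_comp _ _ (fun X : GL R n => glmx X i j)); last exact: interval_open.
by move=> X _; exact: entry_continuous.
Qed.

Lemma measurable_into_GL (R : realType) (n : nat) d (T : measurableType d)
    (h : T -> borel (GL R n)) :
  (forall i j, measurable_fun setT (fun x => glmx (h x) i j)) ->
  measurable_fun setT h.
Proof.
move=> mh; apply: (@measurability _ _ T (borel (GL R n)) setT h (@open (GL R n))) => // _ [U oU <-].
rewrite setTI; move: oU => [V oV <-].
pose Q := ('M[rat]_n * nat)%type.
pose B (q : Q) : set 'M[R]_n := [set A | forall ij : 'I_n * 'I_n,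
  `|A ij.1 ij.2 - ratr (q.1 ij.1 ij.2)| < q.2.+1%:R^-1].
have mB q : measurable [set x | B q (glmx (h x))].
  rewrite (_ : [set x | _] = \big[setI/setT]_(ij : 'I_n * 'I_n) [set x |
     `|glmx (h x) ij.1 ij.2 - ratr (q.1 ij.1 ij.2)| < q.2.+1%:R^-1]); last first.
    apply/seteqP; split => x /=.
      by move=> Bx; rewrite -bigcap_seq => ij _ /=; exact: Bx.
    by rewrite -bigcap_seq => Bx ij; apply: Bx => /=; rewrite mem_index_enum.
  apply: bigsetI_measurable => ij _.
  have mf : measurable_fun setT (fun x => `|glmx (h x) ij.1 ij.2 - ratr (q.1 ij.1 ij.2)|).
    by apply: measurableT_comp => //; exact: measurable_funB.
  rewrite (_ : [set x | _] = setT `&` (fun x => `|glmx (h x) ij.1 ij.2 - ratr (q.1 ij.1 ij.2)|) @^-1` `]-oo, q.2.+1%:R^-1[%classic).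
    by apply: mf => //; exact: measurable_itv.
  by rewrite setTI; apply/seteqP; split => x /=; rewrite in_itv.
rewrite (_ : h @^-1` _ = \bigcup_(q in [set q | B q `<=` V]) [set x | B q (glmx (h x))]).
  rewrite bigcup_mkcond; apply: countable_bigcupT_measurable => [|q]; first exact: (@countableP ('M[rat]_n * nat)%type).
  by case: ifP.
apply/seteqP; split => x /=; last by move=> [q qV Bq]; exact: qV Bq.
move=> Vx; move: oV; rewrite openE => /(_ _ Vx)/nbhs_ballP[e /= e0 eV].
have [k ke] : exists k : nat, 2 * k.+1%:R^-1 < e.
  exists (Num.bound (2 / e)); have := archi_boundP (divr_ge0 (ler0n R 2) (ltW e0)).
  rewrite ltr_pdivrMr// => h2; rewrite ltr_pdivrMr ?ltr0n// mulrC.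
  by apply: lt_le_trans h2 _; rewrite ler_pM2r// ler_nat.
have rq ij : exists q : rat, `|glmx (h x) ij.1 ij.2 - ratr q| < k.+1%:R^-1.
  have := @rat_in_itvoo R (glmx (h x) ij.1 ij.2 - k.+1%:R^-1) (glmx (h x) ij.1 ij.2 + k.+1%:R^-1).
  have k0 : 0 < k.+1%:R^-1 :> R by rewrite invr_gt0.
  move=> [|q]; first by rewrite ltrBlDr -addrA ltrDl addr_gt0.
  rewrite in_itv /= => /andP[q1 q2]; exists q; by rewrite distrC ltr_distl q1.
have [q qP] := choice rq.
exists (\matrix_(i, j) q (i, j), k) => [A BA|ij] /=; last first.
  by rewrite mxE -surjective_pairing; exact: qP.
apply: eV; split => // i j; rewrite /ball /=.
have := BA (i, j); have := qP (i, j); rewrite /= mxE => h1 h2.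
apply: le_lt_trans ke; rewrite mulrDl mul1r.
rewrite (_ : _ - _ = (glmx (h x) i j - ratr (q (i, j))) - (A i j - ratr (q (i, j)))); last ring.
by rewrite (le_trans (ler_normB _ _))// ltW// ltrD.
Qed.

Lemma measurable_det (R : realType) (n : nat) d (T : measurableType d)
    (f : T -> 'M[R]_n) :
  (forall i j, measurable_fun setT (fun x => f x i j)) ->
  measurable_fun setT (fun x => \det (f x)).
Proof.
move=> mf; rewrite /determinant; apply: measurable_sum => s.
apply: measurable_funM => //; apply: measurable_prod => i _; exact: mf.
Qed.

Lemma measurable_inv (R : realType) d (T : measurableType d) (f : T -> R) :
  measurable_fun setT f -> measurable_fun setT (fun x => (f x)^-1).
Proof.
apply: (@measurableT_comp _ _ _ _ _ _ (fun x : R => x^-1)).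
rewrite -(setvU [set 0 : R]); apply/measurable_funU => //.
  exact: measurableC.
split.
  apply: open_continuous_measurable_fun => [|x]; first exact/closed_openC/closed_eq.
  by rewrite inE /= => /eqP x0; exact: inv_continuous.
exact: measurable_fun_set1.
Qed.

Lemma measurable_invmx (R : realType) (n : nat) (i j : 'I_n) d (T : measurableType d)
    (h : T -> borel (GL R n)) : measurable_fun setT h ->
  measurable_fun setT (fun x => invmx (glmx (h x)) i j).
Proof.
move=> mh.
have me k l : measurable_fun setT (fun x => glmx (h x) k l).
  exact: (measurableT_comp (measurable_entry k l)).
rewrite (_ : (fun x => _) = fun x => (\det (glmx (h x)))^-1 *
    ((-1) ^+ (j + i) * \det (row' j (col' i (glmx (h x)))))); last first.
  by apply/funext => x; rewrite /invmx glmx_unit !mxE.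
apply: measurable_funM; first exact/measurable_inv/measurable_det.
apply: measurable_funM => //; apply: measurable_det => k l.
by under eq_fun do rewrite !mxE; exact: me.
Qed.

Lemma GLinv_subproof (R : realType) (n : nat) (X : GL R n) : invmx (glmx X) \in unitmx.
Proof. by rewrite unitmx_inv glmx_unit. Qed.

Definition GLinv (R : realType) (n : nat) (X : GL R n) : GL R n :=
  mkGL (GLinv_subproof X).

Lemma measurable_GLinv (R : realType) (n : nat) d (T : measurableType d)
    (h : T -> borel (GL R n)) : measurable_fun setT h ->
  measurable_fun setT (fun x => GLinv (h x) : borel (GL R n)).
Proof. by move=> mh; apply: measurable_into_GL => i j; exact: measurable_invmx. Qed.

Lemma measurable_GLmul (R : realType) (n : nat) d (T : measurableType d)
    (g h : T -> borel (GL R n)) : measurable_fun setT g -> measurable_fun setT h ->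
  measurable_fun setT (fun x => GLmul (g x) (h x) : borel (GL R n)).
Proof.
move=> mg mh; apply: measurable_into_GL => i j.
rewrite (_ : (fun x => _) = fun x => \sum_k glmx (g x) i k * glmx (h x) k j); last first.
  by apply/funext => x; rewrite /glmx /= mxE.
apply: measurable_sum => k; apply: measurable_funM.
  exact: (measurableT_comp (measurable_entry i k)).
exact: (measurableT_comp (measurable_entry k j)).
Qed.

Lemma measurable_GLbox (R : realType) (n : nat) (M : R) :
  measurable (@GLbox R n M : set (borel (GL R n))).
Proof.
rewrite (_ : GLbox M = \big[setI/setT]_(ij : 'I_n * 'I_n)
  ([set X : borel (GL R n) | `|glmx X ij.1 ij.2| <= M] `&`
   [set X : borel (GL R n) | `|invmx (glmx X) ij.1 ij.2| <= M])); last first.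
  apply/seteqP; split => X /=.
    by move=> BX; rewrite -bigcap_seq => -[i j] _ /=; exact: BX.
  by rewrite -bigcap_seq => BX i j; apply: (BX (i, j)) => /=; rewrite mem_index_enum.
apply: bigsetI_measurable => -[i j] _; apply: measurableI; rewrite -[X in measurable X]setTI.
  apply: measurable_fun_le => //; apply: measurableT_comp => //.
  exact: measurable_entry.
apply: measurable_fun_le => //; apply: measurableT_comp => //.
exact: measurable_invmx.
Qed.

Lemma measurable_GLcompact (R : realType) (n : nat) (M c : R) :
  measurable (@GLcompact R n M c : set (borel (GL R n))).
Proof.
rewrite (_ : GLcompact M c = (\big[setI/setT]_(ij : 'I_n * 'I_n)
  [set X : borel (GL R n) | `|glmx X ij.1 ij.2| <= M]) `&`
   [set X : borel (GL R n) | c <= `|\det (glmx X)|]); last first.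
  apply/seteqP; split => X /=.
    by move=> [BX cX]; split => //; rewrite -bigcap_seq => -[i j] _ /=; exact: BX.
  rewrite -bigcap_seq => -[BX cX]; split => // i j; apply: (BX (i, j)) => /=.
  by rewrite mem_index_enum.
apply: measurableI.
  apply: bigsetI_measurable => -[i j] _; rewrite -[X in measurable X]setTI.
  apply: measurable_fun_le => //; apply: measurableT_comp => //.
  exact: measurable_entry.
rewrite -[X in measurable X]setTI.
apply: measurable_fun_le => //; apply: measurableT_comp => //.
by apply: measurable_det => i j; exact: measurable_entry.
Qed.

(** * Averaging with respect to a Haar measure *)

Lemma glmxM (R : realType) (n : nat) (X Y : GL R n) :
  glmx (GLmul X Y) = glmx X *m glmx Y.
Proof. by []. Qed.

Lemma glmxV (R : realType) (n : nat) (X : GL R n) : glmx (GLinv X) = invmx (glmx X).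
Proof. by []. Qed.

Lemma GLmulA (R : realType) (n : nat) (X Y Z : GL R n) :
  GLmul X (GLmul Y Z) = GLmul (GLmul X Y) Z.
Proof. by apply: glmx_inj; rewrite ?glmxM ?glmxV mulmxA. Qed.

Lemma GLmulKV (R : realType) (n : nat) (X Y : GL R n) :
  GLmul X (GLmul (GLinv X) Y) = Y.
Proof. by apply: glmx_inj; rewrite ?glmxM ?glmxV mulmxA mulmxV ?mul1mx ?glmx_unit. Qed.

Lemma GLmulK (R : realType) (n : nat) (X Y : GL R n) :
  GLmul (GLinv X) (GLmul X Y) = Y.
Proof. by apply: glmx_inj; rewrite ?glmxM ?glmxV mulmxA mulVmx ?mul1mx ?glmx_unit. Qed.

Lemma GLmulVK (R : realType) (n : nat) (X Y : GL R n) :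
  GLmul (GLmul X Y) (GLinv Y) = X.
Proof. by apply: glmx_inj; rewrite ?glmxM ?glmxV -mulmxA mulmxV ?mulmx1 ?glmx_unit. Qed.

Lemma GLinvK (R : realType) (n : nat) : involutive (@GLinv R n).
Proof. by move=> X; apply: glmx_inj; rewrite ?glmxM ?glmxV invmxK. Qed.

Lemma GLinvM (R : realType) (n : nat) (X Y : GL R n) :
  GLinv (GLmul X Y) = GLmul (GLinv Y) (GLinv X).
Proof.
rewrite -[RHS](GLmulK (GLmul X Y)) -GLmulA GLmulKV; apply: glmx_inj.
by rewrite !glmxM !glmxV mulmxV ?mulmx1 ?glmx_unit.
Qed.

Lemma GLbox_inv (R : realType) (n : nat) (M : R) (X : GL R n) :
  GLbox M X -> GLbox M (GLinv X).
Proof. by move=> BX i j; have [h1 h2] := BX i j; rewrite ?glmxM ?glmxV invmxK. Qed.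

Lemma GLbox_le (R : realType) (n : nat) (M N : R) (X : GL R n) :
  M <= N -> GLbox M X -> GLbox N X.
Proof. by move=> MN BX i j; have [h1 h2] := BX i j; split; apply: le_trans MN. Qed.

(* Tonelli's theorem needs a canonical instance of sigma-finiteness. *)
Definition sigma_finite_copy d (T : measurableType d) (R : realType)
  (m : {measure set T -> \bar R}) (mT : sigma_finite setT m) : set T -> \bar R := m.

Section SigmaFiniteCopy.
Context d (T : measurableType d) (R : realType) (m : {measure set T -> \bar R}).
Context (mT : sigma_finite setT m).
HB.instance Definition _ := Measure.on (sigma_finite_copy mT).
HB.instance Definition _ :=
  Measure_isSigmaFinite.Build _ _ _ (sigma_finite_copy mT) mT.
End SigmaFiniteCopy.

Lemma sume_const_seq (R : realType) (I : Type) (s : seq I) (x : \bar R) :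
  (0 <= x)%E -> (\sum_(i <- s) x = (size s)%:R%:E * x)%E.
Proof.
move=> x0; elim: s => [|i s IHs]; first by rewrite big_nil mul0e.
by rewrite big_cons IHs /= -nat1r EFinD ge0_muleDl ?lee_fin// mul1e.
Qed.

Section Haar.
Local Open Scope ereal_scope.
Variables (R : realType) (n : nat) (nu : {measure set (borel (GL R n)) -> \bar R}).
Context (nu_haar : is_haar nu).

Lemma haar_box_lty (M : R) : (0 < M)%R -> nu (@GLbox R n M) < +oo.
Proof.
move=> M0; have [_ fin _] := nu_haar.
have c0 : (0 < (n`!%:R * M ^+ n)^-1 :> R)%R.
  by rewrite invr_gt0 mulr_gt0 ?exprn_gt0// ltr0n fact_gt0.
apply: le_lt_trans (fin _ (GLcompact_compact c0)).
apply: le_measure; last exact: GLbox_sub_compact.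
  by rewrite inE; exact: measurable_GLbox.
by rewrite inE; exact: measurable_GLcompact.
Qed.

Lemma GLbox_exhaust (X : GL R n) : exists k : nat, GLbox (k.+1%:R : R) X.
Proof.
have [k Xk] := GLopen_cover X; have [M M0 MU] := GLopen_sub_box R n k.
exists (Num.bound M); apply: GLbox_le (MU _ Xk).
by rewrite ltW// (lt_le_trans (archi_boundP (ltW M0)))// ler_nat.
Qed.

Lemma haar_sigma_finite : sigma_finite setT nu.
Proof.
exists (fun k => @GLbox R n k.+1%:R).
  by apply/seteqP; split => // X _; have [k Xk] := GLbox_exhaust X; exists k.
by move=> k; split; [exact: measurable_GLbox|exact: haar_box_lty].
Qed.

Lemma haar_box_neq0 : exists2 M : R, (0 < M)%R & nu (@GLbox R n M) != 0.
Proof.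
have [_ _ nuT] := nu_haar; apply: contrapT => h; move/eqP: nuT; apply.
have nu0 k : nu (@GLbox R n k.+1%:R) = 0.
  by apply/eqP; apply: contrapT => /negP k0; apply: h; exists k.+1%:R.
apply/eqP; rewrite eq_le measure_ge0 andbT.
have -> : [set: GL R n] = \bigcup_k (@GLbox R n k.+1%:R).
  by apply/seteqP; split => // X _; have [k Xk] := GLbox_exhaust X; exists k.
apply: le_trans (measure_sigma_subadditive _ _ _ (@subset_refl _ _)) _.
- by move=> k; exact: measurable_GLbox.
- by apply: bigcupT_measurable => k; exact: measurable_GLbox.
by rewrite eseries0.
Qed.

Lemma haar_integral (g : GL R n) (f : borel (GL R n) -> \bar R) :
  measurable_fun setT f -> (forall X, 0 <= f X) ->
  \int[nu]_X f (GLmul g X) = \int[nu]_X f X.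
Proof.
move=> mf f0; have [inv _ _] := nu_haar.
have mg : measurable_fun setT (fun X : borel (GL R n) => GLmul g X : borel (GL R n)).
  by apply: measurable_GLmul.
rewrite [RHS](@eq_measure_integral _ _ _ _
  (measure_function_pushforward__canonical__measure_function_Measure nu mg)).
  by rewrite [RHS]ge0_integral_pushforward//= preimage_setT.
move=> A mA _; rewrite /= /pushforward -(inv (GLinv g) A mA); congr (nu _).
apply/seteqP; split => X /=.
  by move=> [Y AY <-]; rewrite GLmulKV.
by move=> AX; exists (GLmul g X) => //; rewrite GLmulK.
Qed.

Lemma haar_tonelli (f : borel (GL R n) * borel (GL R n) -> \bar R) :
  measurable_fun setT f -> (forall z, 0 <= f z) ->
  \int[nu]_g \int[nu]_X f (g, X) = \int[nu]_X \int[nu]_g f (g, X).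
Proof.
move=> mf f0.
exact: (@fubini_tonelli _ _ _ _ _ (sigma_finite_copy haar_sigma_finite)
  (sigma_finite_copy haar_sigma_finite) f mf f0).
Qed.

(* Integrate [1_K(g) f(g^-1 X)] over g and X in both orders, and substitute X g
   for g in the inner integral over g.  Comparing f with [f \o GLinv] on compact
   sets in this way avoids the unimodularity of GL_n. *)
Lemma haar_inv_le (M0 M : R) (f : borel (GL R n) -> \bar R) :
  measurable_fun setT f -> (forall X, 0 <= f X) ->
  (forall X, ~ GLbox M X -> f X = 0) ->
  nu (@GLbox R n M0) * \int[nu]_X f X <=
  nu (@GLbox R n (n%:R * (M0 * M))) * \int[nu]_X f (GLinv X).
Proof.
move=> mf f0 fM.
pose K := @GLbox R n M0; pose B1 := @GLbox R n (n%:R * (M0 * M)).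
have mK : measurable (K : set (borel (GL R n))) by exact: measurable_GLbox.
have mB1 : measurable (B1 : set (borel (GL R n))) by exact: measurable_GLbox.
have m1K : measurable_fun [set: borel (GL R n)] (fun X => (\1_K X : R)%:E).
  by apply/measurable_EFinP; exact: measurable_indic.
have m1B : measurable_fun [set: borel (GL R n)] (fun X => (\1_B1 X : R)%:E).
  by apply/measurable_EFinP; exact: measurable_indic.
have mfV : measurable_fun [set: borel (GL R n)] (fun X => f (GLinv X)).
  by apply: (measurableT_comp mf); exact: measurable_GLinv.
have i0 (A : set (borel (GL R n))) X : 0 <= (\1_A X : R)%:E by rewrite lee_fin.
have E A : measurable A -> nu A = \int[nu]_X (\1_A X)%:E by move=> mA; rewrite integral_indic// setIT.
pose F (z : borel (GL R n) * borel (GL R n)) := (\1_K z.1 : R)%:E * f (GLmul (GLinv z.1) z.2).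
have mF : measurable_fun setT F.
  apply: emeasurable_funM; first exact: (measurableT_comp m1K).
  apply: (measurableT_comp mf); apply: measurable_GLmul; last exact: measurable_snd.
  by apply: measurable_GLinv; exact: measurable_fst.
have F0 z : 0 <= F z by rewrite mule_ge0.
have -> : nu K * \int[nu]_X f X = \int[nu]_g \int[nu]_X F (g, X).
  rewrite E// -ge0_integralZr//; last by apply: integral_ge0.
  apply: eq_integral => g _; rewrite /F /=.
  rewrite (@ge0_integralZl _ _ _ _ _ _ (fun X : borel (GL R n) => f (GLmul (GLinv g) X)))//.
    by rewrite haar_integral.
  by apply: (measurableT_comp mf); exact: measurable_GLmul.
rewrite haar_tonelli// E// -ge0_integralZr//; last by apply: integral_ge0.
apply: ge0_le_integral => //.
- by move=> X _; apply: integral_ge0.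
- exact: (measurable_fun_fubini_tonelli_G (m1 := sigma_finite_copy haar_sigma_finite) F mF F0).
- by apply: emeasurable_funM.
move=> X _; rewrite -(haar_integral X); last 2 first.
- by apply: (measurableT_comp mF); exact: measurable_fun_pair.
- by move=> g; exact: F0.
rewrite -ge0_integralZl//; apply: ge0_le_integral => //.
- apply: (measurableT_comp mF); apply: measurable_fun_pair => //.
  exact: measurable_GLmul.
- exact: emeasurable_funM.
(* At X g the integrand is 1_K(X g) f(g^-1). Where it is nonzero, X = (X g) g^-1 is a product of
   elements of the boxes of radii [M0] and [M], hence lies in [B1]. *)
move=> g _; rewrite /F /= GLinvM -{3}[X]GLinvK GLmulVK !indicE.
have [Xg|Xg] := boolP (GLmul X g \in K); last by rewrite mul0e mule_ge0.
have [Bg|Bg] := pselect (GLbox M (GLinv g)); last by rewrite fM// !mule0.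
rewrite mem_set//; have := GLbox_mul (set_mem Xg) Bg.
by rewrite GLmulVK.
Qed.

(** [haar_inv_le] passes from f(X) to f(X^-1). There, translating X on the left by u^-1 multiplies
    X^-1 on the right by u, so left invariance alone allows averaging over right translations. The
    radius M' is large enough that, outside its box, all the f(X u) vanish. *)
Lemma haar_average (M : R) : (0 < M)%R -> exists C M' : R, [/\ (0 <= C)%R, (0 < M')%R &
  forall (f : borel (GL R n) -> \bar R) (us : seq (GL R n)) (c : R),
  measurable_fun setT f -> (forall X, 0 <= f X) ->
  (forall X, ~ GLbox M X -> f X = 0) -> (0 < size us)%N ->
  (forall u, u \in us -> GLbox 2 u) -> (0 <= c)%R ->
  (forall X, GLbox M' X -> \sum_(u <- us) f (GLmul X u) <= ((size us)%:R * c)%:E) ->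
  \int[nu]_X f X <= (C * c)%:E].
Proof.
move=> M_gt0; have [M0 M00 nuM0] := haar_box_neq0.
pose b0 := fine (nu (@GLbox R n M0)).
(* The summand 1 keeps the radii positive also for n = 0. *)
pose b1 := fine (nu (@GLbox R n (n%:R * (M0 * M) + 1))).
pose b2 := fine (nu (@GLbox R n (n%:R * (M * 2) + 1))).
have M10 : (0 < n%:R * (M0 * M) + 1)%R by rewrite ltr_pwDr// !mulr_ge0// ltW.
have M20 : (0 < n%:R * (M * 2) + 1)%R by rewrite ltr_pwDr// !mulr_ge0// ltW.
have fin (r : R) : (0 < r)%R -> nu (@GLbox R n r) = (fine (nu (@GLbox R n r)))%:E.
  by move=> r0; rewrite fineK// ge0_fin_numE// haar_box_lty.
have b00 : (0 < b0)%R by rewrite fine_gt0// lt0e nuM0 measure_ge0 haar_box_lty.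
exists (b0^-1 * (b1 * b2))%R, (n%:R * (M * 2) + 1)%R; split => //.
  by rewrite mulr_ge0 ?invr_ge0 ?(ltW b00)// mulr_ge0// fine_ge0.
move=> f us c mf f0 fM us0 u2 c0 avg.
have h1 := @haar_inv_le M0 M f mf f0 fM.
have mfu u : measurable_fun [set: borel (GL R n)] (fun X => f (GLmul (GLinv X) u)).
  apply: (measurableT_comp mf); apply: measurable_GLmul => //.
  exact: measurable_GLinv.
have shift u : \int[nu]_X f (GLinv X) = \int[nu]_X f (GLmul (GLinv X) u).
  rewrite -(haar_integral (GLinv u)) => [|//|//]; last first.
    by apply: (measurableT_comp mf); exact: measurable_GLinv.
  by apply: eq_integral => X _; rewrite GLinvM GLinvK.
pose B2 := @GLbox R n (n%:R * (M * 2) + 1).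
have mB2 : measurable (B2 : set (borel (GL R n))) by exact: measurable_GLbox.
have h2 : (size us)%:R%:E * \int[nu]_X f (GLinv X) <= (size us)%:R%:E * (b2 * c)%:E.
  have -> : (size us)%:R%:E * \int[nu]_X f (GLinv X) =
      \int[nu]_X \sum_(u <- us) f (GLmul (GLinv X) u).
    rewrite ge0_integral_sum//.
    under eq_bigr do rewrite -shift.
    by rewrite sume_const_seq// integral_ge0.
  apply: (@le_trans _ _ (\int[nu]_X (((size us)%:R * c)%:E * (\1_B2 X : R)%:E))).
    apply: ge0_le_integral => //.
    - by move=> X _; apply: sume_ge0.
    - exact: emeasurable_sum.
    - apply: emeasurable_funM => //; apply/measurable_EFinP; exact: measurable_indic.
    move=> X _; rewrite indicE; case: (boolP (X \in B2)) => XB.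
      rewrite mule1; apply: avg; apply: GLbox_inv; exact: set_mem XB.
    rewrite mule0 big_seq big1// => u uu; apply: fM => Bu.
    case/negP: XB; rewrite inE /B2 -(GLinvK X); apply: GLbox_inv.
    rewrite -(GLmulVK (GLinv X) u); apply: (@GLbox_le _ _ (n%:R * (M * 2))%R).
      by rewrite lerDl.
    by apply: GLbox_mul => //; exact/GLbox_inv/u2.
  rewrite ge0_integralZl//; last 2 first.
  - by apply/measurable_EFinP; exact: measurable_indic.
  - by rewrite lee_fin mulr_ge0.
  rewrite integral_indic// setIT fin// -/b2 -!EFinM lee_fin.
  by rewrite -mulrA [(c * b2)%R]mulrC.
have {}h2 : \int[nu]_X f (GLinv X) <= (b2 * c)%:E.
  by move: h2; rewrite lee_pmul2l// lte_fin ltr0n.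
have h3 : nu (@GLbox R n (n%:R * (M0 * M))) <= b1%:E.
  rewrite /b1 -fin//; apply: le_measure; rewrite ?inE; try exact: measurable_GLbox.
  by move=> X; apply: GLbox_le; rewrite lerDl.
have : b0%:E * \int[nu]_X f X <= b1%:E * (b2 * c)%:E.
  rewrite -(fin M0 M00); apply: le_trans h1 _; apply: lee_pmul => //.
  by apply: integral_ge0.
rewrite -lee_pdivlMl// => /le_trans; apply; rewrite -!EFinM lee_fin !mulrA.
by rewrite lexx.
Qed.
End Haar.

(** * Descent to the space of lattices *)

(** This form of the volume, with [K] independent of the lattice, shows at once that it depends only
    on the coset and that it is measurable in [X]. *)
Lemma vol_ellipse_det (R : realType) (t : R) : 0 < t ->
  exists K : R, forall X : GL R 2, fine (vol (dilate t (ball_of X))) = K / `|\det (glmx X)|.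
Proof.
move=> t0; exists (2 * kappa1 R * t ^+ 2) => X.
rewrite vol_ellipse//; set A := shape2A _; set D := shape2D _.
have A0 : 0 < A by apply: shape2A_gt0; exact: glmx_det.
have D0 : 0 < D := shape2D_gt0 X.
have : \det (glmx X) ^+ 2 = A * D by rewrite /D /shape2D mulrC divfK ?gt_eqF.
move=> /(congr1 Num.sqrt); rewrite sqrtr_sqr => ->; move: A D A0 D0 => A D A0 D0.
rewrite /vol2 /= !sqrtrM ?(ltW A0) ?(ltW D0)// sqrtrV ?(ltW A0)//.
rewrite (_ : t ^+ 2 / D = t ^+ 2 / Num.sqrt D ^+ 2); last by rewrite sqr_sqrtr ?ltW.
move: A0 D0; rewrite -(sqrtr_gt0 A) -(sqrtr_gt0 D).
by move: (Num.sqrt A) (Num.sqrt D) => p q p0 q0; field; rewrite !gt_eqF.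
Qed.

Lemma vol_ellipsoid_det (R : realType) (t : R) : 0 < t ->
  exists K : R, forall X : GL R 3, fine (vol (dilate t (ball_of X))) = K / `|\det (glmx X)|.
Proof.
move=> t0; exists (2 * kappa1 R * kappa2 R * t ^+ 3) => X.
rewrite vol_ellipsoid//; set A := shape3A _; set B := shape3B _; set D := shape3D _.
have A0 : 0 < A by apply: shape3A_gt0; exact: glmx_det.
have B0 : 0 < B := shape3B_gt0 X; have D0 : 0 < D := shape3D_gt0 X.
have : \det (glmx X) ^+ 2 = A * B * D.
  rewrite /A /D /B /shape3D /shape3B /shape3A; move: A0 (gram_minor_gt0 (glmx_det X)).
  rewrite /A /shape3A; move: (\det _) (gram _ 2 2) (gram _ _ _ * gram _ _ _ - _).
  by move=> e a d a0 d0; field; rewrite !gt_eqF.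
move=> /(congr1 Num.sqrt); rewrite sqrtr_sqr => ->; move: A B D A0 B0 D0 => A B D A0 B0 D0; rewrite /vol3.
have -> : Num.sqrt (t ^+ 2 / D) = t / Num.sqrt D.
  by rewrite sqrtrM ?sqr_ge0// sqrtr_sqr gtr0_norm// sqrtrV// ltW.
rewrite /= !sqrtrM ?mulr_ge0 ?(ltW A0) ?(ltW B0)// sqrtrV ?(ltW A0)//.
have h : D / B = Num.sqrt D ^+ 2 / Num.sqrt B ^+ 2 by rewrite !sqr_sqrtr// ltW.
rewrite h; move: A0 B0 D0; rewrite -(sqrtr_gt0 A) -(sqrtr_gt0 B) -(sqrtr_gt0 D) {h}.
move: (Num.sqrt A) (Num.sqrt B) (Num.sqrt D) => p q r p0 q0 r0.
by field; rewrite !gt_eqF.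
Qed.

Lemma unitmx_int_det (n : nat) (V : 'M[int]_n) (R : realType) : V \in unitmx ->
  `|\det (map_mx intr V : 'M[R]_n)| = 1.
Proof.
rewrite unitmxE det_map_mx /= => /unitrP[w [_ ]].
move=> /(congr1 (fun z : int => `|z%:~R : R|)); rewrite intrM normrM normr1 => vw.
have h (z w' : int) : `|z%:~R| * `|w'%:~R| = 1 :> R -> 1 <= `|z%:~R| :> R.
  rewrite -!intr_norm => e; rewrite (ler_int R 1) -gtz0_ge1.
  rewrite normr_gt0; apply/eqP => z0; move: e; rewrite z0 normr0 mul0r => /eqP.
  by rewrite eq_sym oner_eq0.
have {}vw : `|(\det V)%:~R| * `|w%:~R| = 1 :> R by exact: vw.
apply/eqP; rewrite eq_le (h _ _ vw) andbT -[leRHS]vw ler_peMr//.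
by apply: (h w (\det V)); rewrite mulrC.
Qed.

Lemma lattice_of_coset (R : realType) (n : nat) (X Y : GL R n) :
  same_coset X Y -> lattice_of X = lattice_of Y.
Proof.
suff H (Z W : GL R n) : same_coset Z W -> lattice_of W `<=` lattice_of Z.
  by move=> XY; apply/seteqP; split; apply: H => //; rewrite same_coset_sym.
move=> /asboolP[V uV e] _ [z _ <-]; exists (V *m z) => //.
by rewrite e map_mxM mulmxA.
Qed.

Lemma lattice_error_coset (R : realType) (n : nat) (K t : R) :
  (forall X : GL R n, fine (vol (dilate t (ball_of X))) = K / `|\det (glmx X)|) ->
  forall X Y : GL R n, same_coset X Y -> lattice_error X t = lattice_error Y t.
Proof.
move=> HK X Y XY; rewrite /lattice_error !HK /lattice_count (lattice_of_coset XY).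
by case/asboolP: XY => V uV ->; rewrite det_mulmx normrM unitmx_int_det// mulr1.
Qed.

(** Writing z = X^-1 (X z) bounds its coordinates by n M t. As the list [s] serves the whole box,
    the lattice count is there a fixed finite sum of indicators, hence measurable. *)
Lemma GLbox_lattice_points (R : realType) (n : nat) (M t : R) : 0 < t ->
  exists2 s : seq 'cV[int]_n, uniq s & forall X : GL R n, GLbox M X ->
    forall z, sqnorm (glmx X) (map_mx intr z) <= t ^+ 2 -> z \in s.
Proof.
move=> t0; pose K := Num.bound (n%:R * (M * t)).
pose F (f : {ffun 'I_n -> 'I_(K + K).+1}) : 'cV[int]_n :=
  \col_i ((f i : nat)%:Z - K%:Z).
have Finj : injective F.
  move=> f g /matrixP fg; apply/ffunP => i; apply: val_inj.
  by have := fg i 0; rewrite !mxE => /addIr [].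
exists (map F (enum {ffun 'I_n -> 'I_(K + K).+1})).
  by rewrite map_inj_uniq// enum_uniq.
move=> X BX z zt.
have bz i : `|(z i 0)%:~R| <= K%:R :> R.
  have -> : (z i 0)%:~R = (invmx (glmx X) *m (glmx X *m map_mx intr z)) i 0 :> R.
    by rewrite mulKmx ?glmx_unit// mxE.
  have ub : n%:R * (M * t) <= K%:R.
    have [h|h] := leP 0 (n%:R * (M * t)); first by rewrite ltW// archi_boundP.
    by rewrite (le_trans (ltW h)).
  apply: le_trans ub; rewrite mxE (le_trans (ler_norm_sum _ _ _))//.
  rewrite -[X in X%:R * _]card_ord mulr_natl -sumr_const; apply: ler_sum => j _.
  rewrite normrM; apply: ler_pM => //; first by have [] := BX i j.
  rewrite -(@ler_pXn2r _ 2) ?nnegrE ?(ltW t0)// real_normK ?num_real//.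
  apply: le_trans zt; rewrite /sqnorm (bigD1 j)//= lerDl.
  by apply: sumr_ge0 => k _; exact: sqr_ge0.
apply/mapP; exists [ffun i => inord (absz (z i 0 + K%:Z))]; first by rewrite mem_enum.
apply/colP => i; rewrite !mxE ffunE inordK.
  have := bz i; rewrite -intr_norm (ler_int R _ K%:Z) ler_norml => /andP[h _].
  by rewrite gez0_abs ?addrK// -lerBlDr sub0r.
have := bz i; rewrite -intr_norm (ler_int R _ K%:Z) ler_norml => /andP[h h'].
by lia.
Qed.

Lemma measurable_lattice_error (R : realType) (n : nat) (M K t : R) : 0 < t ->
  (forall X : GL R n, fine (vol (dilate t (ball_of X))) = K / `|\det (glmx X)|) ->
  measurable_fun setT (fun X : borel (GL R n) => \1_(@GLbox R n M) X * lattice_error X t ^+ 2).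
Proof.
move=> t0 HK; have [s us hs] := GLbox_lattice_points n M t0.
pose g (X : borel (GL R n)) : R :=
  \sum_(z <- s) (sqnorm (glmx X) (map_mx intr z) <= t ^+ 2)%R%:R - K / `|\det (glmx X)|.
rewrite (_ : (fun _ => _) = fun X => \1_(@GLbox R n M) X * g X ^+ 2); last first.
  apply/funext => X; rewrite indicE.
  have [XB|XB] := boolP (X \in @GLbox R n M); last by rewrite !mul0r.
  congr (_ * _ ^+ 2); rewrite /lattice_error HK /g; congr (_ - _).
  by apply: lattice_count_sum => //; apply: hs; exact: set_mem XB.
have mB : measurable (@GLbox R n M : set (borel (GL R n))) by exact: measurable_GLbox.
apply: measurable_funM; first exact: measurable_indic.
apply: measurable_funX; apply: measurable_funB.
  apply: measurable_sum => z.
  rewrite (_ : (fun _ => _) = \1_[set X : borel (GL R n) | sqnorm (glmx X) (map_mx intr z) <= t ^+ 2]); last first.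
    by apply/funext => X; rewrite indicE; congr (nat_of_bool _)%:R; apply/idP/idP; rewrite inE.
  apply: measurable_indic; rewrite -[X in measurable X]setTI.
  apply: measurable_fun_le => //; rewrite /sqnorm; apply: measurable_sum => i.
  apply: measurable_funX; under eq_fun do rewrite mxE; apply: measurable_sum => j.
  by apply: measurable_funM => //; exact: measurable_entry.
apply: measurable_funM => //; apply: measurable_inv; apply: measurableT_comp => //.
by apply: measurable_det => i j; exact: measurable_entry.
Qed.

Section Dominated.
Import HBNNSimple.
Local Open Scope ereal_scope.

(* The monotonicity lemma of the library assumes measurability, which is not
   available for [coset_error]. *)
Lemma ge0_integral_le d (T : measurableType d) (R : realType)
    (m : {measure set T -> \bar R}) (f g : T -> \bar R) :
  (forall x, 0 <= f x) -> (forall x, f x <= g x) ->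
  \int[m]_x f x <= \int[m]_x g x.
Proof.
move=> f0 fg; have g0 x := le_trans (f0 x) (fg x).
rewrite !ge0_integralTE//; apply: le_ereal_sup => _ [h hf <-].
by exists h => // x; exact: le_trans (hf x) (fg x).
Qed.
End Dominated.

(** In Weil's formula the sum over a coset has nonnegative terms, so it is at least its term at one
    representative in the box; there the error equals [coset_error], whichever representative was
    chosen. *)
Lemma integral_coset_error_le (R : realType) (n : nat) (M K t : R)
    (nu : {measure set (borel (GL R n)) -> \bar R})
    (mu : {measure set (borel (lattices R n)) -> \bar R})
    (L0 : set (lattices R n)) :
  is_induced_measure nu mu -> 0 < t ->
  (forall X : GL R n, fine (vol (dilate t (ball_of X))) = K / `|\det (glmx X)|) ->
  L0 `<=` @coset R n @` GLbox M ->
  (\int[mu]_(L in L0) (`|coset_error L t| ^+ 2)%:E <=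
   \int[nu]_X (\1_(@GLbox R n M) X * lattice_error X t ^+ 2)%:E)%E.
Proof.
move=> nu_mu t0 HK L0B.
rewrite nu_mu; last 2 first.
- by apply/measurable_EFinP; exact: measurable_lattice_error HK.
- by move=> X; rewrite lee_fin mulr_ge0 ?sqr_ge0.
rewrite integral_mkcond; apply: ge0_integral_le => [L|L].
  by apply: erestrict_ge0 => ? _; rewrite lee_fin sqr_ge0.
have F0 (X : GL R n) : (0 <= (\1_(@GLbox R n M) X * lattice_error X t ^+ 2)%:E)%E.
  by rewrite lee_fin mulr_ge0 ?sqr_ge0.
rewrite patchE; case: ifPn => [LL0|_]; last by apply: esum_ge0 => X _; exact: F0.
have [X BX XL] := L0B _ (set_mem LL0).
apply: esum_ge; exists [set X].
  by split; [exact: finite_set1|move=> _ ->].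
rewrite fsbig_set1 indicE mem_set// mul1r lee_fin real_normK ?num_real//.
rewrite /coset_error (@lattice_error_coset _ _ _ _ HK (repr L) X)//.
by apply/cosetP; rewrite XL /coset reprK.
Qed.

Lemma rms_coset_error_le (R : realType) (n : nat)
    (nu : {measure set (borel (GL R n)) -> \bar R}) (nu_haar : is_haar nu)
    (mu : {measure set (borel (lattices R n)) -> \bar R})
    (nu_mu : is_induced_measure nu mu)
    (L0 : set (lattices R n)) (L0_compact : compact L0) (p : nat) :
  (forall t : R, 0 < t -> exists K : R,
    forall X : GL R n, fine (vol (dilate t (ball_of X))) = K / `|\det (glmx X)|) ->
  (forall M : R, 0 < M -> exists C : R, forall t, 4 <= t -> exists us : seq (GL R n),
    [/\ (0 < size us)%N, forall u, u \in us -> GLbox 2 u & forall X, GLbox M X ->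
      \sum_(u <- us) lattice_error (GLmul X u) t ^+ 2 <=
      (size us)%:R * (C * (t ^+ p * ln t ^+ 2))]) ->
  exists C : R, forall t, 4 <= t ->
    ((\int[mu]_(L in L0) (`|coset_error L t| ^+ 2)%:E) `^ 2^-1
      <= (C * (t `^ (p%:R / 2) * ln t))%:E)%E.
Proof.
move=> Hvol Hmean; have [M M0 L0B] := compact_lattices_box L0_compact.
have [Ch [M' [Ch0 M'0 avg]]] := haar_average nu_haar M0.
have [C HC] := Hmean _ M'0.
(* The absolute value of [C] supplies the nonnegative constant that [avg] asks for. *)
exists (Num.sqrt (Ch * `|C|)) => t t4.
have t0 : 0 < t by lra.
have ln1 := ln4_ge1 t4.
have [us [us0 us2 HX]] := HC t t4; have [K HK] := Hvol t t0.
have tl0 : 0 <= t ^+ p * ln t ^+ 2 by rewrite mulr_ge0 ?sqr_ge0 ?exprn_ge0 ?(ltW t0)//.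
have bound : (\int[mu]_(L in L0) (`|coset_error L t| ^+ 2)%:E <=
    (Ch * (`|C| * (t ^+ p * ln t ^+ 2)))%:E)%E.
  apply: le_trans (integral_coset_error_le nu_mu t0 HK L0B) _.
  apply: (avg _ us) => //.
  - by apply/measurable_EFinP; exact: measurable_lattice_error HK.
  - by move=> X; rewrite lee_fin mulr_ge0 ?sqr_ge0.
  - by move=> X XB; rewrite indicE memNset// mul0r.
  - by rewrite mulr_ge0.
  move=> X BX; rewrite sumEFin lee_fin.
  apply: (@le_trans _ _ (\sum_(u <- us) lattice_error (GLmul X u) t ^+ 2)).
    by apply: ler_sum => u _; rewrite ler_piMl ?sqr_ge0// indicE; case: (_ \in _).
  apply: le_trans (HX X BX) _; rewrite ler_pM2l ?ltr0n//.
  by rewrite ler_wpM2r// ler_norm.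
apply: (@le_trans _ _ (((Ch * (`|C| * (t ^+ p * ln t ^+ 2)))%:E `^ 2^-1)%E)).
  apply: gt0_ler_poweR => //.
  - rewrite in_itv /= leey andbT.
    by apply: integral_ge0 => L _; rewrite lee_fin sqr_ge0.
  - by rewrite in_itv /= leey andbT lee_fin mulr_ge0// mulr_ge0.
rewrite poweR_EFin lee_fin powR12_sqrt; last by rewrite mulr_ge0// mulr_ge0.
rewrite (mulrA Ch) sqrtrM ?mulr_ge0// [X in _ * X]sqrtrM ?exprn_ge0 ?(ltW t0)// sqrtr_sqr (ger0_norm (le_trans ler01 ln1)).
by rewrite -(powR12_sqrt (exprn_ge0 p (ltW t0))) -powR_mulrn ?(ltW t0)// -powRrM.
Qed.

Theorem theorem1 (R : realType) (n : nat) (n23 : n = 2%N \/ n = 3%N)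
    (nu : {measure set (borel (GL R n)) -> \bar R}) (nu_haar : is_haar nu)
    (mu : {measure set (borel (lattices R n)) -> \bar R})
    (nu_mu : is_induced_measure nu mu)
    (L0 : set (lattices R n)) (L0_compact : compact L0) :
  exists2 m : nat, (0 < m)%N &
    exists C : R, \forall t \near +oo,
      ((\int[mu]_(L in L0) (`|coset_error L t| ^+ 2)%:E) `^ 2^-1
        <= (C * (t `^ ((n%:R - 1) / 2) * ln t ^+ m))%:E)%E.
Proof.
suff [C HC] : exists C : R, forall t, 4 <= t ->
    ((\int[mu]_(L in L0) (`|coset_error L t| ^+ 2)%:E) `^ 2^-1
      <= (C * (t `^ (n.-1%:R / 2) * ln t))%:E)%E.
  (* The square root of the squared logarithm leaves the exponent 1. *)
  exists 1%N => //; exists C; near=> t; rewrite expr1.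
  have -> : n%:R - 1 = n.-1%:R :> R by case: n23 => ->; rewrite /=; lra.
  by apply: HC; near: t; exact: nbhs_pinfty_ge.
case: n23 nu nu_haar mu nu_mu L0 L0_compact => -> nu nu_haar mu nu_mu L0 L0_compact.
  apply: rms_coset_error_le nu_haar mu nu_mu L0 L0_compact _ _ _.
    by move=> t; exact: vol_ellipse_det.
  exact: mean_lattice_error2.
apply: rms_coset_error_le nu_haar mu nu_mu L0 L0_compact _ _ _.
  by move=> t; exact: vol_ellipsoid_det.
exact: mean_lattice_error3.
Unshelve. all: by end_near. Qed.
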